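(* Assume that there exist $s_1\in I_\mu^\circ$ and $\beta\in(0,1)$ such that $\int_{\mathbb G}\|g\|^{s_1+\beta}\iota(g)^{-\beta}\,\mu(dg)<+\infty$; that no finite union of proper subspaces of $\mathbb R^d$ is $\Gamma_\mu$-invariant; and that $\Gamma_\mu$ contains at least one proximal matrix. Then, for any $s\in I_\mu^\circ$, there exists a constant $\alpha>0$ such that $$\sup_{y\in(\mathbb P^{d-1})^*}\int_{\mathbb P^{d-1}}\frac{1}{\delta(y,x)^\alpha}\,\pi_s(dx)<+\infty.$$ In particular, for any $s\in I_\mu^\circ$, there exist constants $\alpha,C>0$ such that for any $r\ge0$, $$\sup_{y\in(\mathbb P^{d-1})^*}\pi_s\big(B(y,r)\big)\le C r^\alpha,\qquad B(y,r)=\{x\in\mathbb P^{d-1}:\delta(y,x)\le r\}.$$ Moreover, both assertions remain valid when the stationary measure $\pi_s$ is replaced by the eigenmeasure $\nu_s$.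
   Context: Let $d\ge2$, $\mathbb G=GL(d,\mathbb R)$, $(g_n)_{n\ge1}$ i.i.d. with law $\mu$ on $\mathbb G$, and $G_n=g_n\cdots g_1$. $|\cdot|$ is the Euclidean norm on $\mathbb R^d$ and on its dual, $\langle f,v\rangle$ the dual bracket, $\|g\|=\sup_{v\ne0}|gv|/|v|$, $\iota(g)=\inf_{v\neq0}|gv|/|v|$. $\Gamma_\mu$ is the smallest closed semigroup generated by $\operatorname{supp}\mu$. A matrix is proximal if it has an algebraically simple eigenvalue whose modulus strictly exceeds that of all other eigenvalues. $I_\mu=\{s\ge0:\mathbb E\|g_1\|^s<\infty\}$, with interior $I_\mu^\circ$; it is always assumed that $\mathbb E\|g_1\|^s<\infty$ for some $s>0$. $\mathbb P^{d-1}$ and $(\mathbb P^{d-1})^*$ are the projective spaces of $\mathbb R^d$ and $(\mathbb R^d)^*$. For $x=\mathbb Rv$, $y=\mathbb Rf$: $gx=\mathbb Rgv$, $\sigma(g,x)=\log(|gv|/|v|)$, $\delta(y,x)=|\langle f,v\rangle|/(|f||v|)$; $g^*$ is the adjoint of $g$, acting on $(\mathbb R^d)^*$. Transfer operators: $P_s\varphi(x)=\int e^{s\sigma(g,x)}\varphi(gx)\mu(dg)$ on $\mathcal C(\mathbb P^{d-1})$ and $P_s^*\varphi(y)=\int e^{s\sigma(g^*,y)}\varphi(g^*y)\mu(dg)$ on $\mathcal C((\mathbb P^{d-1})^* )$. For $s\in I_\mu^\circ$, $\kappa(s)=\lim_n(\mathbb E\|G_n\|^s)^{1/n}$ and (known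 facts under strong irreducibility and proximality) $\nu_s$, $\nu_s^*$ are the unique probability measures with $\nu_s(P_s\varphi)=\kappa(s)\nu_s(\varphi)$, $\nu_s^*(P_s^*\varphi)=\kappa(s)\nu_s^*(\varphi)$ for all continuous $\varphi$; $r_s(x)=\int\delta(y,x)^s\nu_s^*(dy)$ is strictly positive, continuous and satisfies $P_sr_s=\kappa(s)r_s$. The measure $\pi_s$, defined by $\pi_s(\varphi)=\nu_s(\varphi r_s)/\nu_s(r_s)$, is the unique stationary probability measure of the Markov operator $Q_s\varphi=\frac{1}{\kappa(s)r_s}P_s(\varphi r_s)$. *)

(* Defs.v *)
From HB Require Import structures.
From mathcomp Require Import all_boot all_order all_algebra.
From mathcomp Require Import complex.
From mathcomp Require Import all_classical all_reals all_analysis.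

Set Implicit Arguments.
Unset Strict Implicit.
Unset Printing Implicit Defensive.

Import Order.TTheory GRing.Theory Num.Theory.
Import numFieldNormedType.Exports.

Local Open Scope classical_set_scope.
Local Open Scope ring_scope.

(* Conventions.  The dimension is n.+1, because a measurableType is inhabited  *)
(* and the projective space of R^0 is empty.  Vectors are columns and linear   *)
(* forms are rows, so that <f, v> is the entry of f *m v, and the adjoint of g *)
(* maps the form f to f *m g.                                                  *)

Section Norms.
Context {R : realType}.

(* The library norm on matrices is the sup norm.  This one is only used on     *)
(* rows and columns, where it is the Euclidean norm.                           *)
Definition enorm {m k : nat} (A : 'M[R]_(m, k)) : R :=
  Num.sqrt (\sum_i \sum_j A i j ^+ 2).

Definition opnorm {n : nat} (g : 'M[R]_n) : R :=
  sup [set enorm (g *m v) / enorm v | v in [set v : 'cV[R]_n | v != 0]].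

Definition iotamx {n : nat} (g : 'M[R]_n) : R :=
  inf [set enorm (g *m v) / enorm v | v in [set v : 'cV[R]_n | v != 0]].

Definition proximal {n : nat} (g : 'M[R]_n) : Prop :=
  let gC : 'M[complex R]_n := map_mx (real_complex R) g in
  exists l : complex R, [/\ eigenvalue gC l, mup l (char_poly gC) = 1%N &
    forall l' : complex R, eigenvalue gC l' -> l' != l -> `|l'| < `|l|].

End Norms.

Section GeneralLinearGroup.
Context {R : realType} {n : nat}.

Definition GL : Type := set_type [set g : 'M[R]_n.+1 | g \in unitmx].

HB.instance Definition _ := Topological.on GL.

Definition GLmx (g : GL) : 'M[R]_n.+1 := set_val g.

Lemma GLmx_unit (g : GL) : GLmx g \in unitmx.
Proof. exact: set_valP g. Qed.

Definition GL_of (g : 'M[R]_n.+1) (ug : g \in unitmx) : GL :=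
  exist _ g (mem_set ug).

Definition GL1 : GL := GL_of (unitmx1 R n.+1).

Lemma GLM_subproof (g h : GL) : GLmx g *m GLmx h \in unitmx.
Proof. by rewrite unitmx_mul !GLmx_unit. Qed.

Definition GLM (g h : GL) : GL := GL_of (GLM_subproof g h).

HB.instance Definition _ := isPointed.Build GL GL1.
HB.instance Definition _ :=
  Measurable.copy GL (g_sigma_algebraType (@open GL)).

End GeneralLinearGroup.
Arguments GL : clear implicits.

Section ProjectiveSpace.
Context {R : realType} {m k : nat}.
Local Notation V := 'M[R]_(m.+1, k.+1).

Definition nonzero : Type := set_type [set v : V | v != 0].

HB.instance Definition _ := Topological.on nonzero.

Definition collinear (u v : nonzero) : bool :=
  `[< exists a : R, set_val u = a *: set_val v >].

Lemma collinear_refl : reflexive collinear.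
Proof. by move=> u; apply/asboolP; exists 1; rewrite scale1r. Qed.

Lemma collinear_sym : symmetric collinear.
Proof.
suff H u v : collinear u v -> collinear v u by move=> u v; apply/idP/idP; apply: H.
move=> /asboolP[a uav]; apply/asboolP; exists a^-1.
have a0 : a != 0.
  have u0 : set_val u != 0 := set_valP u.
  by apply: contraNneq u0 => a0; rewrite uav a0 scale0r.
by rewrite uav scalerA mulVf// scale1r.
Qed.

Lemma collinear_trans : transitive collinear.
Proof.
move=> v u w /asboolP[a uav] /asboolP[b vbw]; apply/asboolP; exists (a * b).
by rewrite uav vbw scalerA.
Qed.

Canonical collinear_equiv :=
  EquivRel collinear collinear_refl collinear_sym collinear_trans.

Definition projspace : Type := quotient_topology {eq_quot collinear}%qT.

HB.instance Definition _ := Topological.on projspace.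
HB.instance Definition _ := Quotient.on projspace.

Lemma nonzero_subproof : (const_mx 1 : V) \in [set v : V | v != 0].
Proof.
apply/mem_set/eqP => /matrixP/(_ ord0 ord0); rewrite !mxE.
by apply/eqP; exact: oner_neq0.
Qed.

Definition nonzero1 : nonzero := exist _ (const_mx 1 : V) nonzero_subproof.

HB.instance Definition _ := isPointed.Build projspace (\pi_projspace nonzero1)%qT.
HB.instance Definition _ :=
  Measurable.copy projspace (g_sigma_algebraType (@open projspace)).

Definition line_vec (x : projspace) : V := set_val (repr x : nonzero).

End ProjectiveSpace.
Arguments nonzero : clear implicits.
Arguments projspace : clear implicits.

Section Action.
Context {R : realType} {m k : nat}.
Local Notation V := 'M[R]_(m.+1, k.+1).

(* For h linear and injective, the line R v is mapped to R (h v): the default  *)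
(* value of insubd is not used.                                                *)
Definition line_map (h : V -> V) (x : projspace R m k) : projspace R m k :=
  (\pi_(projspace R m k) (insubd (repr x : nonzero R m k) (h (line_vec x))))%qT.

Definition line_sigma (h : V -> V) (x : projspace R m k) : R :=
  ln (enorm (h (line_vec x)) / enorm (line_vec x)).

(* \int e^(s sigma(g, x)) phi(g x) mu(dg), for an action act of GL(n.+1, R).   *)
Definition transfer {n : nat} (mu : probability (GL R n) R)
    (act : GL R n -> V -> V) (s : R) (phi : projspace R m k -> R)
    (x : projspace R m k) : R :=
  \int[mu]_g (expR (s * line_sigma (act g) x) * phi (line_map (act g) x)).

(* nu (T phi) = c * nu phi for all continuous phi.                             *)
Definition eigenmeasure (T : (projspace R m k -> R) -> projspace R m k -> R)
    (c : R) (nu : probability (projspace R m k) R) : Prop :=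
  forall phi : projspace R m k -> R, continuous phi ->
    \int[nu]_x T phi x = c * \int[nu]_x phi x.

Definition unique_eigenmeasure
    (T : (projspace R m k -> R) -> projspace R m k -> R) (c : R)
    (nu : probability (projspace R m k) R) : Prop :=
  eigenmeasure T c nu /\
  forall nu' : probability (projspace R m k) R, eigenmeasure T c nu' ->
    forall A, measurable A -> nu' A = nu A.

End Action.

Section RandomMatrixProduct.
Context {R : realType} {n : nat}.

Definition lact (g : GL R n) (v : 'cV[R]_n.+1) : 'cV[R]_n.+1 := GLmx g *m v.

Definition adjact (g : GL R n) (f : 'rV[R]_n.+1) : 'rV[R]_n.+1 := f *m GLmx g.

Definition msupport (mu : probability (GL R n) R) : set (GL R n) :=
  [set g | forall U, open U -> U g -> (0 < mu U)%E].

Definition closed_semigroup (S : set (GL R n)) : Prop :=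
  closed S /\ forall g h, S g -> S h -> S (GLM g h).

Definition Gamma (mu : probability (GL R n) R) : set (GL R n) :=
  smallest closed_semigroup (msupport mu).

(* The zero subspace is excluded: it is invariant under every matrix.          *)
Definition strongly_irreducible (S : set (GL R n)) : Prop :=
  forall Ws : seq {vspace 'cV[R]_n.+1}, Ws != [::] ->
    (forall W, W \in Ws -> W != 0%VS /\ W != fullv) ->
    ~ (forall (g : GL R n) (v : 'cV[R]_n.+1), S g ->
         (exists2 W, W \in Ws & v \in W) ->
         (exists2 W, W \in Ws & lact g v \in W)).

Definition iid {dO} {Omega : measurableType dO} (P : probability Omega R)
    (mu : probability (GL R n) R) (g : nat -> {RV P >-> GL R n}) : Prop :=
  (forall i A, measurable A -> distribution P (g i) A = mu A) /\
  (forall (J : seq nat) (A : nat -> set (GL R n)), uniq J ->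
     (forall i, measurable (A i)) ->
     P (\bigcap_(i in [set` J]) (g i @^-1` A i)) =
       (\prod_(i <- J) P (g i @^-1` A i))%E).

(* walk g j = g_j ... g_1, where the factor g_i is indexed by i.-1: it is g i.-1. *)
Fixpoint walk {dO} {Omega : measurableType dO} {P : probability Omega R}
    (g : nat -> {RV P >-> GL R n}) (j : nat) (w : Omega) : GL R n :=
  if j is i.+1 then GLM (g i w) (walk g i w) else GL1.

Definition moment {dO} {Omega : measurableType dO} {P : probability Omega R}
    (g : nat -> {RV P >-> GL R n}) (j : nat) (s : R) : \bar R :=
  ('E_P[fun w => (opnorm (GLmx (walk g j w)) `^ s)%R])%E.

Definition I_mu {dO} {Omega : measurableType dO} {P : probability Omega R}
    (g : nat -> {RV P >-> GL R n}) : set R :=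
  [set s | 0 <= s /\
    ('E_P[fun w => (opnorm (GLmx (g 0%N w)) `^ s)%R] < +oo)%E].

Definition kappa {dO} {Omega : measurableType dO} {P : probability Omega R}
    (g : nat -> {RV P >-> GL R n}) (s : R) : R :=
  lim ((fun j : nat => fine (moment g j s) `^ (j%:R^-1)) @ \oo).

Definition delta (y : projspace R 0 n) (x : projspace R n 0) : R :=
  `|(line_vec y *m line_vec x) ord0 ord0| /
    (enorm (line_vec y) * enorm (line_vec x)).

Definition delta_ball (y : projspace R 0 n) (r : R) : set (projspace R n 0) :=
  [set x | delta y x <= r].

Definition P_ (mu : probability (GL R n) R) (s : R) :
    (projspace R n 0 -> R) -> projspace R n 0 -> R :=
  transfer mu lact s.

Definition Pstar_ (mu : probability (GL R n) R) (s : R) :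
    (projspace R 0 n -> R) -> projspace R 0 n -> R :=
  transfer mu adjact s.

Definition r_ (nustar : probability (projspace R 0 n) R) (s : R)
    (x : projspace R n 0) : R :=
  \int[nustar]_y (delta y x `^ s).

(* pi phi = nu (phi r) / nu r for all continuous phi.                          *)
Definition normalized_by (nu : probability (projspace R n 0) R)
    (r : projspace R n 0 -> R) (pi : probability (projspace R n 0) R) : Prop :=
  forall phi : projspace R n 0 -> R, continuous phi ->
    \int[pi]_x phi x = (\int[nu]_x (phi x * r x)) / \int[nu]_x r x.

(* sup_y \int delta(y, x)^(-a) m(dx); the inverse is taken in \bar R, so that  *)
(* the integrand is +oo where delta(y, x) = 0 (when a > 0).                    *)
Definition sup_inv_delta (m : probability (projspace R n 0) R) (a : R) : \bar R :=
  ereal_sup [set (\int[m]_x ((delta y x `^ a)%:E)^-1)%E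
            | y in [set: projspace R 0 n]].

Definition sup_delta_ball (m : probability (projspace R n 0) R) (r : R) : \bar R :=
  ereal_sup [set m (delta_ball y r) | y in [set: projspace R 0 n]].

End RandomMatrixProduct.

(* Main.v *)
Require Import Defs.
From HB Require Import structures.
From mathcomp Require Import all_boot all_order all_algebra.
From mathcomp Require Import complex.
From mathcomp Require Import all_classical all_reals all_analysis.
From mathcomp Require Import measurable_realfun ring lra.

(* Put N(v) = \int |<f, v>|^s nustar(df) and N*(f) = \int |<f, v>|^s nu(dv) over *)
(* unit representatives.  The eigenmeasure equations say that N and N* are       *)
(* multiplied by kappa when averaged over g, and irreducibility makes them       *)
(* comparable to |v|^s and |f|^s; hence the n-step average of |g|^s is at most   *)
(* C kappa^n.                                                                    *)
(*   Two events are negligible for the n-step average weighted by |g|^s, up to   *)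
(* the factor kappa^n.  The event |fg| < e |g| is, uniformly in n and in the     *)
(* unit form f, as e tends to 0, because nu does not charge hyperplanes: a       *)
(* minimal charged subspace of maximal relative mass would have a finite         *)
(* Gamma_mu-invariant orbit.  The event that some 2 x 2 minor of g exceeds       *)
(* e |g|^2 is, as n grows, because the average of sqrt (N(gv) N(gw)) is          *)
(* nonincreasing after normalization, and a matrix of rank at least 2 at which   *)
(* it were constant would contradict proximality.                                *)
(*   Outside of these events g is close to rank one, and                         *)
(*      |fg| |gv| <= |<f, gv>| |g| + |f| |v| (2 x 2 minors of g)                 *)
(* bounds <f, gv> / |gv| from below, except for vectors v with |gv| small, whose *)
(* weight |gv|^s is small.  So H = sup_f \int |<f, v>|^(-a) nu(dv), with a small *)
(* and the integrand truncated, satisfies H <= H / 2 + D with D independent of   *)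
(* the truncation.  The moment assumption controls the bad events, on which      *)
(* |<f, gv>| / |gv| can drop by the condition number of g.                       *)

(** The steps of this outline are carried by the following lemmas. The equations for N and N* are
    [potential_eigen] and [copotential_eigen], their comparison with norms is [potential_ge] and
    [copotential_ge], and the resulting growth bound is [conv_power_moment]. A maximum principle,
    [null_subspace], shows that nu charges no proper subspace; compactness makes this uniform in
    [bump_mass_uniform], and [small_coefficients] deduces the first negligible event. The second
    one, [wedge_small], follows from the rigidity statement [mean_defect_neq0] by compactness, in
    [wedge_cover]. [bracket_wedge] and [drift_fun_bound] give the pointwise estimate, [drift_step]
    integrates it to H <= H / 2 + D, and [inv_cutoff_bounded] iterates this inequality. The
    hypothesis on s1 and beta enters through [condition_number_moment], which moves it from s1 to s.
    The bound passes to pi_s by [normalized_by_bound], since r_s lies between two positive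
    constants. Monotone convergence removes the truncation in [sup_inv_delta_le], and Markov's
    inequality gives the estimate of balls in [sup_delta_ball_le]. *)

Set Implicit Arguments.
Unset Strict Implicit.
Unset Printing Implicit Defensive.

Import Order.TTheory GRing.Theory Num.Theory.
Import numFieldNormedType.Exports.

Local Open Scope classical_set_scope.
Local Open Scope ring_scope.

(** * The Frobenius norm and continuity of matrix operations *)

Section RealPowers.
Context {R : realType}.
Implicit Types (a b t s : R).

Lemma continuous_powR_norm s : 0 < s -> continuous (fun t : R => `|t| `^ s).
Proof.
move=> s0 t; rewrite /continuous_at.
have [t0|tn0] := eqVneq t 0.
  rewrite t0 normr0 powR0 ?gt_eqF//.
  apply/cvgrPdist_lt => e e0; near=> x.
  rewrite sub0r normrN ger0_norm ?powR_ge0//.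
  have -> : e = (e `^ s^-1) `^ s by rewrite -powRrM mulVf ?gt_eqF// powRr1// ltW.
  apply: gt0_ltr_powR; rewrite ?nnegrE ?powR_ge0//.
  near: x; apply: (@cvgr0_norm_lt _ _ _ _ _ id); first exact: cvg_id.
  by rewrite powR_gt0.
have E : {near t, (fun x : R => expR (s * ln `|x|)) =1 (fun x : R => `|x| `^ s)}.
  near=> x; rewrite /powR normr_eq0 ifF//; apply/negbTE.
  by near: x; exact: (@cvgr_neq0 _ _ _ (nbhs t) _ (fun y : R => y) t).
rewrite (_ : `|t| `^ s = expR (s * ln `|t|)); last first.
  by rewrite /powR normr_eq0 (negbTE tn0).
apply: cvg_trans; first exact: (near_eq_cvg E).
apply: continuous_cvg; first exact: continuous_expR.
apply: cvgMr; apply: continuous_cvg.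
  by apply: continuous_ln; rewrite normr_gt0.
exact: cvg_norm.
Unshelve. all: by end_near. Qed.

Lemma le_powR_ge0 s a b : 0 <= s -> 0 <= a -> a <= b -> a `^ s <= b `^ s.
Proof.
move=> s0 a0 ab; apply: ge0_ler_powR; rewrite ?nnegrE//.
exact: le_trans ab.
Qed.

End RealPowers.

Section EuclideanNorm.
Context {R : realType}.

(** Lagrange's identity: the sum of the squares of a_i b_j - a_j b_i is twice the defect of the
    inequality. *)
Lemma cauchy_schwarz_sum (I : finType) (a b : I -> R) :
  (\sum_i a i * b i) ^+ 2 <= (\sum_i a i ^+ 2) * (\sum_i b i ^+ 2).
Proof.
have : 0 <= \sum_i \sum_j (a i * b j - a j * b i) ^+ 2.
  by apply: sumr_ge0 => i _; apply: sumr_ge0 => j _; exact: sqr_ge0.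
have -> : \sum_i \sum_j (a i * b j - a j * b i) ^+ 2 =
    2 * ((\sum_i a i ^+ 2) * (\sum_i b i ^+ 2) - (\sum_i a i * b i) ^+ 2).
  transitivity (\sum_i \sum_j (a i ^+ 2 * b j ^+ 2 + a j ^+ 2 * b i ^+ 2
      - 2 * ((a i * b i) * (a j * b j)))).
    by apply: eq_bigr => i _; apply: eq_bigr => j _; ring.
  under eq_bigr do rewrite sumrB big_split /= -mulr_sumr -mulr_suml -mulr_sumr.
  rewrite sumrB big_split /= -mulr_suml -mulr_sumr -[X in _ - X]mulr_sumr.
  under [X in _ - _ * X]eq_bigr do rewrite -mulr_sumr.
  rewrite -mulr_suml; ring.
by rewrite pmulr_rge0// subr_ge0.
Qed.

Context {m k : nat}.
Implicit Types (A B : 'M[R]_(m, k)) (c : R).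

Lemma enorm_ge0 A : 0 <= enorm A.
Proof. exact: sqrtr_ge0. Qed.

Lemma enorm_sqr A : enorm A ^+ 2 = \sum_p A p.1 p.2 ^+ 2.
Proof.
rewrite sqr_sqrtr; first by rewrite pair_bigA.
by apply: sumr_ge0 => i _; apply: sumr_ge0 => j _; exact: sqr_ge0.
Qed.

Lemma enormE A : enorm A = Num.sqrt (\sum_p A p.1 p.2 ^+ 2).
Proof. by rewrite /enorm pair_bigA. Qed.

Lemma enorm0 : enorm (0 : 'M[R]_(m, k)) = 0.
Proof.
rewrite enormE big1 ?sqrtr0// => p _.
by rewrite mxE expr0n.
Qed.

Lemma entry_le_enorm A i j : `|A i j| <= enorm A.
Proof.
rewrite -ler_sqr ?nnegrE ?enorm_ge0// enorm_sqr (bigD1 (i, j))//= real_normK ?num_real//.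
by rewrite lerDl sumr_ge0// => p _; exact: sqr_ge0.
Qed.

Lemma enorm_eq0 A : (enorm A == 0) = (A == 0).
Proof.
apply/eqP/eqP => [A0|->]; last exact: enorm0.
apply/matrixP => i j; rewrite mxE; apply/eqP.
by rewrite -normr_le0 -A0 entry_le_enorm.
Qed.

Lemma enorm_gt0 A : (0 < enorm A) = (A != 0).
Proof. by rewrite lt_neqAle enorm_ge0 andbT eq_sym enorm_eq0. Qed.

Lemma enormZ c A : enorm (c *: A) = `|c| * enorm A.
Proof.
apply/eqP; rewrite -(@eqrXn2 _ 2) ?enorm_ge0 ?mulr_ge0 ?enorm_ge0//.
rewrite exprMn !enorm_sqr real_normK ?num_real// mulr_sumr; apply/eqP.
by apply: eq_bigr => p _; rewrite mxE exprMn.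
Qed.

Lemma enormN A : enorm (- A) = enorm A.
Proof. by rewrite -scaleN1r enormZ normrN1 mul1r. Qed.

Lemma enormD A B : enorm (A + B) <= enorm A + enorm B.
Proof.
rewrite -ler_sqr ?nnegrE ?enorm_ge0 ?addr_ge0 ?enorm_ge0//.
rewrite sqrrD !enorm_sqr.
under eq_bigr do rewrite mxE sqrrD.
rewrite !big_split /= lerD2r lerD2l -mulr2n lerMn2r /=.
apply: (le_trans (ler_norm _)).
rewrite -ler_sqr ?nnegrE ?mulr_ge0 ?enorm_ge0// real_normK ?num_real//.
by rewrite exprMn !enorm_sqr cauchy_schwarz_sum.
Qed.

End EuclideanNorm.

Section EuclideanNormProducts.
Context {R : realType}.

(** On square matrices [enorm] is the Frobenius norm. The proof measures matrices by it rather than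
    by [opnorm], because it is an explicit continuous function of the entries; [enorm_le_opnorm]
    makes the link at the end. *)
Lemma enormM m k l (A : 'M[R]_(m, k)) (B : 'M[R]_(k, l)) :
  enorm (A *m B) <= enorm A * enorm B.
Proof.
rewrite -ler_sqr ?nnegrE ?mulr_ge0 ?enorm_ge0// exprMn !enorm_sqr.
rewrite -[X in _ * X](pair_bigA _ (fun i j => B i j ^+ 2)) /=.
rewrite exchange_big -(pair_bigA _ (fun i j => (A *m B) i j ^+ 2))
  -(pair_bigA _ (fun i j => A i j ^+ 2)) /=.
rewrite mulr_suml; apply: ler_sum => i _; rewrite mulr_sumr; apply: ler_sum => j _.
by rewrite mxE cauchy_schwarz_sum.
Qed.

Lemma enormMdyad m k (v : 'cV[R]_m) (f : 'rV[R]_k) :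
  enorm (v *m f) = enorm v * enorm f.
Proof.
apply/eqP; rewrite -(@eqrXn2 _ 2) ?enorm_ge0 ?mulr_ge0 ?enorm_ge0//.
rewrite exprMn !enorm_sqr.
rewrite -(pair_bigA _ (fun i j => v i j ^+ 2))
  -(pair_bigA _ (fun i j => f i j ^+ 2)) -(pair_bigA _ (fun i j => (v *m f) i j ^+ 2)) /=.
rewrite big_ord1 mulr_suml; apply/eqP; apply: eq_bigr => i _.
by rewrite big_ord1 mulr_sumr; apply: eq_bigr => j _; rewrite mxE big_ord1 exprMn.
Qed.

Lemma enorm_scalar (A : 'M[R]_1) : enorm A = `|A ord0 ord0|.
Proof. by rewrite /enorm !big_ord1 sqrtr_sqr. Qed.

Lemma enorm_tr m k (A : 'M[R]_(m, k)) : enorm A^T = enorm A.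
Proof.
rewrite /enorm exchange_big; congr Num.sqrt.
by apply: eq_bigr => i _; apply: eq_bigr => j _; rewrite mxE.
Qed.

Lemma enorm_col_sqr m k (A : 'M[R]_(m, k)) :
  enorm A ^+ 2 = \sum_j enorm (col j A) ^+ 2.
Proof.
rewrite enorm_sqr -(pair_bigA _ (fun i j => A i j ^+ 2)) /= exchange_big /=.
apply: eq_bigr => j _; rewrite enorm_sqr.
rewrite -(pair_bigA _ (fun i l => col j A i l ^+ 2)) /=.
by apply: eq_bigr => i _; rewrite big_ord1 mxE.
Qed.

End EuclideanNormProducts.

Section MatrixTopology.
Context {R : realType}.

Lemma cvg_mx (T : Type) (F : set_system T) (FF : Filter F) m k
    (f : T -> 'M[R]_(m, k)) (M : 'M[R]_(m, k)) :
  (forall i j, f x i j @[x --> F] --> M i j) -> f x @[x --> F] --> M.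
Proof.
move=> fM A [P PM PA].
have : \forall x \near F, forall i j, P i j (f x i j).
  have H : \forall x \near F, forall p : 'I_m * 'I_k, P p.1 p.2 (f x p.1 p.2).
    by apply: filter_forall => -[i j] /=; apply: fM; exact: PM.
  by apply: filterS H => x H i j; exact: (H (i, j)).
by apply: filterS => x H; exact: PA.
Qed.

Lemma continuous_mx (T : topologicalType) m k (f : T -> 'M[R]_(m, k)) :
  (forall i j, continuous (fun x => f x i j)) -> continuous f.
Proof. by move=> H x; apply: cvg_mx => i j; exact: H. Qed.

Lemma continuous_entry (T : topologicalType) m k (f : T -> 'M[R]_(m, k)) i j :
  continuous f -> continuous (fun x => f x i j).
Proof.
move=> cf x; apply: (@continuous_comp _ _ _ f (fun M : 'M[R]_(m, k) => M i j)).
  exact: cf.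
exact: coord_continuous.
Qed.

Lemma continuous_sumr (T : topologicalType) (I : Type) (r : seq I) (P : pred I)
    (F : I -> T -> R) :
  (forall i, continuous (F i)) -> continuous (fun x => \sum_(i <- r | P i) F i x).
Proof.
move=> cF; elim: r => [|i r IH].
  by under eq_fun do rewrite big_nil; exact: cst_continuous.
under eq_fun do rewrite big_cons; case: (P i); last exact: IH.
by move=> x; apply: (@continuousD _ _ _ (F i)); [exact: cF | exact: IH].
Qed.

Lemma continuous_mulmx (T : topologicalType) m k l
    (f : T -> 'M[R]_(m, k)) (g : T -> 'M[R]_(k, l)) :
  continuous f -> continuous g -> continuous (fun x => f x *m g x).
Proof.
move=> cf cg; apply: continuous_mx => i j; under eq_fun do rewrite mxE.
apply: continuous_sumr => p x.
by apply: continuousM; apply: continuous_entry.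
Qed.

Lemma continuous_enorm m k : continuous (@enorm R m k).
Proof.
move=> A; rewrite (_ : enorm = Num.sqrt \o (fun B : 'M[R]_(m, k) => \sum_p B p.1 p.2 ^+ 2));
  last by apply/funext => B; rewrite enormE.
apply: (@continuous_comp _ _ _ (fun B : 'M[R]_(m, k) => \sum_p B p.1 p.2 ^+ 2) Num.sqrt).
  apply: continuous_sumr => p B.
  by apply: (@continuous_comp _ _ _ (fun B : 'M[R]_(m, k) => B p.1 p.2) (fun t : R => t ^+ 2));
    [exact: coord_continuous | exact: exprn_continuous].
exact: sqrt_continuous.
Qed.

(** Matrices are read as row vectors through [vec_mx], where closed bounded sets are compact. *)
Lemma compact_sphere m k : compact [set A : 'M[R]_(m, k) | enorm A = 1].
Proof.
have cv : continuous (@vec_mx R m k).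
  apply: continuous_mx => i j; under eq_fun do rewrite mxE.
  exact: coord_continuous.
have -> : [set A : 'M[R]_(m, k) | enorm A = 1] =
    vec_mx @` [set v | enorm (vec_mx v : 'M[R]_(m, k)) = 1].
  apply/seteqP; split => [A /= A1|_ [v /= v1 <-]//].
  by exists (mxvec A); rewrite ?mxvecK.
apply: continuous_compact; first by apply: continuous_subspaceT.
apply: bounded_closed_compact.
  exists 1; split; first exact: num_real.
  move=> M M1 v /= v1; apply: le_trans (ltW M1).
  rewrite /Num.norm /= mx_normrE; apply/bigmax_leP; split => // -[i p] _ /=.
  have -> : v i p = mxvec (vec_mx v) i p by rewrite vec_mxK.
  rewrite ord1; case/mxvec_indexP: p => a b; rewrite mxvecE.
  by rewrite -v1 entry_le_enorm.
rewrite (_ : [set _ | _] = (fun v => enorm (vec_mx v : 'M[R]_(m, k))) @^-1` [set 1])//.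
apply: closed_comp; last exact: closed_eq.
move=> v _; apply: (@continuous_comp _ _ _ (@vec_mx R m k) (@enorm R m k)).
  exact: cv.
exact: continuous_enorm.
Qed.

End MatrixTopology.

(** * Measurability of matrix-valued functions and unit representatives of lines *)

Section MeasurableMatrices.
Context {R : realType} d (T : measurableType d).

(** Entrywise measurability stands for measurability of a matrix-valued map; [mxmeasurable_open]
    shows that it has the expected consequence for open sets. *)
Definition mxmeasurable m k (A : T -> 'M[R]_(m, k)) : Prop :=
  forall i j, measurable_fun setT (fun t => A t i j).

Lemma mxmeasurable_cst m k (A : 'M[R]_(m, k)) : mxmeasurable (fun=> A).
Proof. by move=> i j; exact: measurable_cst. Qed.

Lemma mxmeasurable_mul m k l (A : T -> 'M[R]_(m, k)) (B : T -> 'M[R]_(k, l)) :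
  mxmeasurable A -> mxmeasurable B -> mxmeasurable (fun t => A t *m B t).
Proof.
move=> mA mB i j; under eq_fun do rewrite mxE.
by apply: measurable_sum => p; apply: measurable_funM; [exact: mA | exact: mB].
Qed.

(** An open set of matrices is the union of the countably many boxes with rational centre and radius
    that it contains, and the preimage of a box is a finite intersection of measurable conditions on
    entries. *)
Lemma mxmeasurable_open m k (A : T -> 'M[R]_(m, k)) (O : set 'M[R]_(m, k)) :
  mxmeasurable A -> open O -> measurable (A @^-1` O).
Proof.
move=> mA oO.
pose box (q : 'M[rat]_(m, k)) (r : rat) : set 'M[R]_(m, k) :=
  [set M | forall p : 'I_m * 'I_k, `|M p.1 p.2 - ratr (q p.1 p.2)| < ratr r].
pose F (z : 'M[rat]_(m, k) * rat) : set T :=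
  if `[< box z.1 z.2 `<=` O >] then A @^-1` box z.1 z.2 else set0.
have -> : A @^-1` O = \bigcup_z F z.
  apply/seteqP; split => [t /= Ot|t [z _]]; last first.
    by rewrite /F; case: asboolP => // zO; exact: zO.
  have [e /= e0 eO] : exists2 e : R, 0 < e & ball (A t) e `<=` O.
    by have /nbhs_ballP[e /= e0 eO] := open_nbhs_nbhs (conj oO Ot); exists e.
  have [r] := rat_in_itvoo (divr_gt0 e0 (@ltr0n R 2)).
  rewrite in_itv /= => /andP[r0 re].
  have /choice[q Hq] : forall p : 'I_m * 'I_k, exists q : rat,
      `|A t p.1 p.2 - ratr q| < ratr r.
    move=> p.
    have : A t p.1 p.2 - ratr r < A t p.1 p.2 + ratr r.
      by rewrite ltrD2l gtrN.
    move=> /rat_in_itvoo[q]; rewrite in_itv /= => qp; exists q.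
    by rewrite distrC ltr_distl.
  exists (\matrix_(i, j) q (i, j), r) => //.
  rewrite /F asboolT /= => [p|M HM]; first by rewrite mxE; case: p => i j; exact: Hq (i, j).
  apply: eO; split => // i j; have := HM (i, j); rewrite /= mxE => HMij.
  rewrite /ball /= (splitr e) -(subrKA (ratr (q (i, j)))).
  apply: (le_lt_trans (ler_normD _ _)); apply: ltrD.
    exact: lt_trans (Hq (i, j)) re.
  by rewrite distrC; exact: lt_trans HMij re.
apply: countable_bigcupT_measurable => [|z].
  exact: countableP.
rewrite /F; case: asboolP => // _.
have -> : A @^-1` box z.1 z.2 = \bigcap_(p in [set: 'I_m * 'I_k])
    [set t | `|A t p.1 p.2 - ratr (z.1 p.1 p.2)| < ratr z.2].
  by apply/seteqP; split => [t H p _|t H p]; [exact: H | exact: (H p)].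
apply: fin_bigcap_measurable => [|p _]; first exact: finite_finset.
rewrite -[X in measurable X]setTI.
apply: (measurable_fun_ltr (f := fun t => `|A t p.1 p.2 - ratr (z.1 p.1 p.2)|)
   (g := fun=> ratr z.2) _ _ _ (Y := [set true])) => //.
apply: measurableT_comp => //; apply: measurable_funB => //; exact: mA.
Qed.

End MeasurableMatrices.

Lemma mxmeasurable_comp {R : realType} d d' (T : measurableType d)
    (T' : measurableType d') m k (A : T -> 'M[R]_(m, k)) (f : T' -> T) :
  measurable_fun setT f -> mxmeasurable A -> mxmeasurable (A \o f).
Proof. by move=> mf mA i j; exact: (measurableT_comp (mA i j) mf). Qed.

Lemma measurable_fun_real_open {R : realType} d (T : measurableType d) (f : T -> R) :
  (forall O : set R, open O -> measurable (f @^-1` O)) -> measurable_fun setT f.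
Proof.
move=> H; apply: (measurability _ (RGenOpens.measurableE R)).
by move=> _ [_ [a [b ->] <-]]; rewrite setTI; apply: H; exact: interval_open.
Qed.

Lemma measurable_continuous_mx {R : realType} d (T : measurableType d) m k
    (A : T -> 'M[R]_(m, k)) (F : 'M[R]_(m, k) -> R) :
  mxmeasurable A -> continuous F -> measurable_fun setT (F \o A).
Proof.
move=> mA /continuousP cF; apply: measurable_fun_real_open => O oO.
by rewrite comp_preimage; apply: mxmeasurable_open => //; exact: cF.
Qed.

Section GLMeasurability.
Context {R : realType} {n : nat}.

Lemma continuous_GLmx : continuous (@GLmx R n).
Proof. exact: initial_continuous. Qed.

Lemma measurable_GL_continuous (F : GL R n -> R) :
  continuous F -> measurable_fun setT F.
Proof.
move=> /continuousP cF; apply: measurable_fun_real_open => O oO.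
by apply: sub_sigma_algebra; exact: cF.
Qed.

Lemma mxmeasurable_GLmx : mxmeasurable (@GLmx R n).
Proof.
move=> i j; apply: measurable_GL_continuous.
by apply: continuous_entry; exact: continuous_GLmx.
Qed.

Lemma measurable_GL d (T : measurableType d) (f : T -> GL R n) :
  mxmeasurable (fun t => GLmx (f t)) -> measurable_fun setT f.
Proof.
move=> mf; apply: (measurability (@open (GL R n))) => // _ [_ [U oU <-] <-].
rewrite setTI -comp_preimage.
exact: mxmeasurable_open.
Qed.

End GLMeasurability.

Section Representatives.
Context {R : realType} {m k : nat}.
Local Notation V := 'M[R]_(m.+1, k.+1).
Local Notation idx := ('I_m.+1 * 'I_k.+1)%type.
Local Notation PV := (projspace R m k).

Lemma line_vec_neq0 (x : PV) : line_vec x != 0.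
Proof. exact: (set_valP (repr x : nonzero R m k)). Qed.

Lemma line_vec_pi (v : nonzero R m k) :
  exists2 c : R, c != 0 & line_vec (\pi_PV v)%qT = c *: set_val v.
Proof.
have : collinear (repr (\pi_PV v)%qT) v.
  by have /eqquotP := reprK (\pi_PV v)%qT.
move=> /asboolP[c cv]; exists c => //.
have := line_vec_neq0 (\pi_PV v)%qT; rewrite /line_vec cv.
by apply: contraNneq => ->; rewrite scale0r.
Qed.

(** Scale invariance makes the value independent of the representative picked by [repr], so
    continuity can be checked on nonzero matrices, before the quotient. *)
Lemma continuous_projspace (F : V -> R) :
  (forall v, v != 0 -> {for v, continuous F}) ->
  (forall c v, c != 0 -> F (c *: v) = F v) ->
  continuous (fun x : PV => F (line_vec x)).
Proof.
move=> cF hF; apply/quotient_continuous.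
have -> : (fun x : PV => F (line_vec x)) \o \pi_PV%qT =
    (fun v : nonzero R m k => F (set_val v)).
  apply/funext => v /=; have [c c0 ->] := line_vec_pi v; exact: hF.
move=> v; apply: (@continuous_comp _ _ _ (set_val : nonzero R m k -> V) F).
  exact: initial_continuous.
by apply: cF; exact: (set_valP v).
Qed.

Lemma measurable_projspace_continuous (F : PV -> R) :
  continuous F -> measurable_fun setT F.
Proof.
move=> /continuousP cF; apply: measurable_fun_real_open => O oO.
by apply: sub_sigma_algebra; exact: cF.
Qed.

Fixpoint signed_unit (s : seq idx) (v : V) : V :=
  if s is p :: s' then
    if v p.1 p.2 != 0 then (v p.1 p.2 / `|v p.1 p.2| / enorm v) *: v
    else signed_unit s' v
  else 0.

(* The representatives chosen by repr need not depend measurably on the line. *)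
(* Here the sign is that of the first nonzero entry.                         *)
Definition uvec (x : PV) : V := signed_unit (enum {: idx}) (line_vec x).

Lemma uvecE (x : PV) : exists2 c : R, `|c| = (enorm (line_vec x))^-1 &
  uvec x = c *: line_vec x.
Proof.
rewrite /uvec; set v := line_vec x.
have [p vp] : exists p : idx, v p.1 p.2 != 0.
  apply/existsP; apply: contraT; rewrite negb_exists => /forallP H.
  have := line_vec_neq0 x; rewrite -/v => /eqP; case.
  by apply/matrixP => i j; rewrite mxE; apply/eqP; move: (H (i, j)); rewrite negbK.
have : p \in enum {: idx} by rewrite mem_enum.
elim: (enum _) => //= q s IH; rewrite inE => ps.
case: ifPn => [vq|/negPn/eqP vq].
  exists (v q.1 q.2 / `|v q.1 q.2| / enorm v) => //.
  rewrite normrM normrM !normfV normr_id divff ?normr_eq0// mul1r.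
  by rewrite ger0_norm ?enorm_ge0.
by apply: IH; case/orP: ps => // /eqP pq; rewrite pq vq eqxx in vp.
Qed.

Lemma enorm_uvec (x : PV) : enorm (uvec x) = 1.
Proof.
have [c c1 ->] := uvecE x.
by rewrite enormZ c1 mulVf// enorm_eq0 line_vec_neq0.
Qed.

(** The functions v_p v_q / |v|^2 are continuous on the projective space. If p is the first nonzero
    entry, then the entry q of the unit representative is the function of index (p, q) divided by
    the square root of the one of index (p, p). *)
Lemma mxmeasurable_uvec : mxmeasurable (uvec : PV -> V).
Proof.
move=> i j.
have mq p q : measurable_fun setT
    (fun x : PV => line_vec x p.1 p.2 * line_vec x q.1 q.2 / enorm (line_vec x) ^+ 2).
  apply: measurable_projspace_continuous.
  apply: (@continuous_projspace
    (fun v : V => v p.1 p.2 * v q.1 q.2 / enorm v ^+ 2)) => [v v0|c v c0]; last first.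
    rewrite !mxE enormZ exprMn real_normK ?num_real//.
    have [->|v0] := eqVneq v 0; first by rewrite enorm0 expr0n /= mulr0 invr0 !mulr0.
    have E (a b e t : R) : t != 0 -> e != 0 ->
        t * a * (t * b) / (t ^+ 2 * e ^+ 2) = a * b / e ^+ 2.
      by move=> t0 e0; field; rewrite t0 e0.
    by apply: E => //; rewrite enorm_eq0.
  apply: continuousM.
    by apply: continuousM; exact: coord_continuous.
  apply: continuousV; first by rewrite expf_neq0// enorm_eq0.
  apply: (@continuous_comp _ _ _ (@enorm R m.+1 k.+1) (fun t : R => t ^+ 2)).
    exact: continuous_enorm.
  exact: exprn_continuous.
rewrite /uvec; elim: (enum _) => [|p s IH] /=.
  by under eq_fun do rewrite mxE; exact: measurable_cst.
pose Q p q (x : PV) := line_vec x p.1 p.2 * line_vec x q.1 q.2 / enorm (line_vec x) ^+ 2.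
have lv0 (x : PV) : enorm (line_vec x) != 0 by rewrite enorm_eq0 line_vec_neq0.
rewrite (_ : (fun _ => _) = (fun x => if Q p p x == 0 then
    signed_unit s (line_vec x) i j else Q p (i, j) x * Q p p x `^ (- 2^-1))); last first.
  apply/funext => x; rewrite /Q -expr2.
  have -> : (line_vec x p.1 p.2 ^+ 2 / enorm (line_vec x) ^+ 2 == 0) =
      (line_vec x p.1 p.2 == 0).
    by rewrite mulf_eq0 invr_eq0 !expf_eq0/= (negbTE (lv0 x)) orbF.
  case: ifPn => [|/negPn/eqP ->]; last by rewrite eqxx.
  move=> vp; rewrite (negbTE vp) !mxE -expr_div_n powRN powR12_sqrt ?sqr_ge0//.
  rewrite sqrtr_sqr normrM normfV (ger0_norm (enorm_ge0 _)) /=.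
  have E (a b e t : R) : t != 0 -> e != 0 ->
      a / t / e * b = a * b / e ^+ 2 * (t / e)^-1.
    by move=> t0 e0; field; rewrite t0 e0.
  by apply: E; rewrite ?normr_eq0.
apply: measurable_fun_ifT => //.
- by apply: measurable_fun_eqr => //; exact: mq.
- apply: measurable_funM; first exact: mq.
  apply: (measurableT_comp (measurable_powR (- 2^-1))); exact: mq.
Qed.

End Representatives.

(** * Homogeneous functions and eigenmeasures *)

Section Homogeneous.
Context {R : realType} {m k : nat}.
Local Notation V := 'M[R]_(m.+1, k.+1).
Local Notation PV := (projspace R m k).

(** For s > 0 these are the functions |v|^s phi(R v) with phi nonnegative and continuous on the
    projective space. In this form the transfer operator is the plain average of H(g v) over g, see
    [transfer_integrand]. *)
Definition homogeneous_fun (s : R) (H : V -> R) : Prop :=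
  [/\ continuous H, forall (c : R) (v : V), H (c *: v) = `|c| `^ s * H v & forall v, 0 <= H v].

Lemma enorm_sphere_neq0 : [set v : V | enorm v = 1] !=set0.
Proof.
have c0 : (const_mx 1 : V) != 0.
  apply/eqP => /matrixP/(_ ord0 ord0); rewrite !mxE => /eqP.
  by rewrite oner_eq0.
exists ((enorm (const_mx 1 : V))^-1 *: const_mx 1) => /=.
by rewrite enormZ normfV ger0_norm ?enorm_ge0// mulVf// enorm_eq0.
Qed.

Lemma homogeneous_normalize s H (v : V) : homogeneous_fun s H -> v != 0 ->
  H v = enorm v `^ s * H ((enorm v)^-1 *: v).
Proof.
move=> [_ hH _] v0; rewrite hH mulrA normfV ger0_norm ?enorm_ge0//.
by rewrite -powRM ?invr_ge0 ?enorm_ge0// divff ?enorm_eq0// powR1 mul1r.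
Qed.

Lemma homogeneous_le s H : 0 < s -> homogeneous_fun s H ->
  exists2 C : R, 0 <= C & forall v, H v <= C * enorm v `^ s.
Proof.
move=> s0 hH; have [cH HZ H0] := hH.
have [c /set_mem/= c1 cmax] := compact_EVT_max enorm_sphere_neq0 (@compact_sphere R m.+1 k.+1)
  (continuous_subspaceT cH).
exists (H c) => // v; have [->|v0] := eqVneq v 0.
  by rewrite -(scale0r (0 : V)) HZ normr0 powR0 ?gt_eqF// mul0r mulr_ge0// powR_ge0.
rewrite (homogeneous_normalize hH v0) mulrC ler_wpM2r ?powR_ge0//.
apply: cmax; rewrite inE /=.
by rewrite enormZ normfV ger0_norm ?enorm_ge0// mulVf// enorm_eq0.
Qed.

Lemma homogeneous_uvec s H (x : PV) : homogeneous_fun s H ->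
  H (uvec x) = H (line_vec x) / enorm (line_vec x) `^ s.
Proof.
move=> [_ hH _]; have [c c1 ->] := uvecE x.
by rewrite hH c1 mulrC -powR_inv1 ?enorm_ge0// -powRrM mulN1r powRN.
Qed.

Lemma continuous_homogeneous_uvec s H : 0 < s -> homogeneous_fun s H ->
  continuous (fun x : PV => H (uvec x)).
Proof.
move=> s0 hH; have [cH HZ _] := hH.
rewrite (_ : (fun _ => _) = fun x => H (line_vec x) / enorm (line_vec x) `^ s); last first.
  by apply/funext => x; exact: homogeneous_uvec.
apply: (@continuous_projspace R m k (fun v => H v / enorm v `^ s)) => [v v0|c v c0].
  apply: continuousM; first exact: cH.
  apply: continuousV; first by rewrite powR_eq0 negb_and enorm_eq0 v0.
  rewrite (_ : (fun v : V => enorm v `^ s) = (fun t : R => `|t| `^ s) \o (@enorm R m.+1 k.+1)).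
    apply: continuous_comp; first exact: continuous_enorm.
    exact: continuous_powR_norm.
  by apply/funext => w /=; rewrite ger0_norm ?enorm_ge0.
rewrite HZ enormZ powRM ?enorm_ge0//.
have E (a t e : R) : t != 0 -> t * a / (t * e) = a / e.
  move=> t0; have [->|e0] := eqVneq e 0; first by rewrite mulr0 invr0 !mulr0.
  by field; rewrite t0 e0.
by apply: E; rewrite powR_eq0 normr_eq0 negb_and c0.
Qed.

Lemma line_vec_line_map (h : V -> V) (x : PV) : h (line_vec x) != 0 ->
  exists2 c : R, c != 0 & line_vec (line_map h x) = c *: h (line_vec x).
Proof.
move=> hx; rewrite /line_map.
have [c c0 ->] := line_vec_pi (insubd (repr x : nonzero R m k) (h (line_vec x))).
exists c => //; congr (_ *: _).
have hx' : h (line_vec x) \in [set v : V | v != 0] by rewrite inE.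
exact: (insubdK (repr x : nonzero R m k) hx').
Qed.

End Homogeneous.

(** The bridge between the real-valued integrals of the definitions and the extended ones in which
    the proof computes: the real-valued integral returns a default value on an infinite integral, so
    finiteness has to be supplied each time. *)
Lemma EFin_Rintegral_ge0 {R : realType} d (T : measurableType d)
    (mu : {measure set T -> \bar R}) (f : T -> R) :
  (forall x, 0 <= f x) -> (\int[mu]_x (f x)%:E < +oo)%E ->
  (\int[mu]_x f x)%R%:E = (\int[mu]_x (f x)%:E)%E.
Proof.
move=> f0 foo; rewrite /Rintegral fineK// ge0_fin_numE//.
by apply: integral_ge0 => x _; rewrite lee_fin.
Qed.

Lemma le_integral_fin {R : realType} d (T : measurableType d)
    (mu : {measure set T -> \bar R}) (f g : T -> R) :
  measurable_fun setT f -> measurable_fun setT g ->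
  (forall x, 0 <= f x <= g x) ->
  (\int[mu]_x (f x)%:E <= \int[mu]_x (g x)%:E)%E.
Proof.
move=> mf mg fg; apply: ge0_le_integral => //.
- by move=> x _; rewrite lee_fin; case/andP: (fg x).
- exact/measurable_EFinP.
- exact/measurable_EFinP.
- by move=> x _; rewrite lee_fin; case/andP: (fg x).
Qed.

Lemma integral_probability_le {R : realType} d (T : measurableType d)
    (mu : probability T R) (f : T -> R) (C : R) :
  measurable_fun setT f -> (forall x, 0 <= f x <= C) ->
  (\int[mu]_x (f x)%:E <= C%:E)%E.
Proof.
move=> mf fC; apply: le_trans.
  apply: (@le_integral_fin _ _ _ mu f (fun=> C)) => //; exact: measurable_cst.
rewrite (@integral_cst _ _ _ mu setT _ C%:E)//.
by rewrite [X in (_ * X)%E](_ : _ = 1%E) ?mule1//; exact: probability_setT.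
Qed.

Section Eigenmeasure.
Context {R : realType} {m k n : nat}.
Local Notation V := 'M[R]_(m.+1, k.+1).
Local Notation PV := (projspace R m k).

(** What the actions on vectors and on forms have in common, so that the eigenmeasure equations of
    nu and of nustar are treated at once. *)
Record linear_action (act : GL R n -> V -> V) : Prop := LinearAction {
  actZ : forall g c v, act g (c *: v) = c *: act g v;
  act_neq0 : forall g v, v != 0 -> act g v != 0;
  act_le : forall g v, enorm (act g v) <= enorm (GLmx g) * enorm v;
  act_measurable : mxmeasurable (fun z : GL R n * PV => act z.1 (uvec z.2)) }.

(** The cocycle factor is |g u|^s for the unit representative u of x, and homogeneity turns |g u|^s
    H(g u / |g u|) into H(g u). The unknown scalars between representatives cancel. *)
Lemma transfer_integrand (act : GL R n -> V -> V) s H g (x : PV) :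
  linear_action act -> homogeneous_fun s H ->
  expR (s * line_sigma (act g) x) * H (uvec (line_map (act g) x)) = H (act g (uvec x)).
Proof.
move=> la hH; have [_ HZ _] := hH.
have gx0 := act_neq0 la g (line_vec_neq0 x).
have := line_vec_neq0 x; move: gx0; rewrite -!enorm_gt0 => gx0 x0.
rewrite /line_sigma (homogeneous_uvec _ hH).
have [c c0 ->] := line_vec_line_map (act_neq0 la g (line_vec_neq0 x)).
have [e e1 ->] := uvecE x; rewrite (actZ la) !HZ e1 enormZ powRM ?enorm_ge0//.
have -> : expR (s * ln (enorm (act g (line_vec x)) / enorm (line_vec x))) =
   enorm (act g (line_vec x)) `^ s * (enorm (line_vec x))^-1 `^ s.
  rewrite -powRM ?invr_ge0 ?enorm_ge0//.
  by rewrite /powR gt_eqF// divr_gt0.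
set a := _ `^ s; set b := _ `^ s; set t := `|c| `^ s.
have E (p q r h : R) : r != 0 -> p != 0 -> p * q * (r * h / (r * p)) = q * h.
  by move=> r0 p0; field; rewrite r0 p0.
by apply: E; rewrite powR_eq0 negb_and ?normr_eq0 ?c0// gt_eqF.
Qed.

Context (mu : probability (GL R n) R) (s : R) (s0 : 0 < s).
Hypothesis moment : (\int[mu]_g (enorm (GLmx g) `^ s)%:E < +oo)%E.

Lemma measurable_enorm_powR d (T : measurableType d) a b (A : T -> 'M[R]_(a, b)) (e : R) :
  mxmeasurable A -> measurable_fun setT (fun t => enorm (A t) `^ e).
Proof.
move=> mA; apply: (measurableT_comp (measurable_powR e)).
by apply: measurable_continuous_mx => //; exact: continuous_enorm.
Qed.

(** The bound H(g u) <= C |g|^s and the moment of order s make both sides finite, so that the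
    equation between real-valued integrals becomes one between extended integrals, to which
    Tonelli's theorem applies. *)
Lemma eigenmeasure_homogeneous (act : GL R n -> V -> V) (c : R)
    (nu : probability PV R) H :
  linear_action act -> eigenmeasure (transfer mu act s) c nu -> homogeneous_fun s H ->
  (\int[nu]_x \int[mu]_g (H (act g (uvec x)))%:E =
    c%:E * \int[nu]_x (H (uvec x))%:E)%E.
Proof.
move=> la nuE hH; have [cH HZ H0] := hH.
have [C C0 HC] := homogeneous_le s0 hH.
have mj : measurable_fun setT (fun z : GL R n * PV => H (act z.1 (uvec z.2))).
  by apply: measurable_continuous_mx => //; exact: act_measurable la.
have mx (x : PV) : measurable_fun setT (fun g => H (act g (uvec x))).
  exact: measurableT_comp mj (pair2_measurable x).
have bx (x : PV) : (\int[mu]_g (H (act g (uvec x)))%:E <=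
    C%:E * \int[mu]_g (enorm (GLmx g) `^ s)%:E)%E.
  rewrite -ge0_integralZl//; last 2 first.
  - by apply/measurable_EFinP; apply: measurable_enorm_powR; exact: mxmeasurable_GLmx.
  - by move=> g _; rewrite lee_fin powR_ge0.
  apply: (@le_integral_fin _ _ _ mu _ (fun g => C * enorm (GLmx g) `^ s)) => //.
    apply: measurable_funM; first exact: measurable_cst.
    by apply: measurable_enorm_powR; exact: mxmeasurable_GLmx.
  move=> g; rewrite H0 (le_trans (HC _))// ler_wpM2l// le_powR_ge0 ?enorm_ge0 ?(ltW s0)//.
  by rewrite (le_trans (act_le la _ _))// enorm_uvec mulr1.
have Coo : (C%:E * \int[mu]_g (enorm (GLmx g) `^ s)%:E < +oo)%E.
  by rewrite lte_mul_pinfty// lee_fin.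
have tE (x : PV) : (transfer mu act s (fun x => H (uvec x)) x)%:E =
    (\int[mu]_g (H (act g (uvec x)))%:E)%E.
  rewrite /transfer EFin_Rintegral_ge0.
  - by apply: eq_integral => g _; rewrite (transfer_integrand _ _ la hH).
  - by move=> g; rewrite (transfer_integrand _ _ la hH).
  - under eq_integral do rewrite (transfer_integrand _ _ la hH).
    exact: le_lt_trans (bx x) Coo.
under eq_integral do rewrite -tE.
have t0 (x : PV) : 0 <= transfer mu act s (fun x => H (uvec x)) x.
  by rewrite -lee_fin tE integral_ge0// => g _; rewrite lee_fin.
have fin1 : (\int[nu]_x (H (uvec x))%:E < +oo)%E.
  apply: (@le_lt_trans _ _ C%:E); last exact: ltry.
  apply: integral_probability_le => [|x]; last first.
    by rewrite H0 (le_trans (HC _))// enorm_uvec powR1 mulr1.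
  exact: measurable_projspace_continuous (continuous_homogeneous_uvec s0 hH).
have fin2 : (\int[nu]_x (transfer mu act s (fun x => H (uvec x)) x)%:E < +oo)%E.
  have [M HM] : exists M : R, (C%:E * \int[mu]_g (enorm (GLmx g) `^ s)%:E)%E = M%:E.
    exists (fine (C%:E * \int[mu]_g (enorm (GLmx g) `^ s)%:E)); rewrite fineK//.
    rewrite ge0_fin_numE// mule_ge0// integral_ge0// => g _.
    by rewrite lee_fin powR_ge0.
  apply: (@le_lt_trans _ _ M%:E); last exact: ltry.
  apply: integral_probability_le => [|x].
    apply/measurable_EFinP; rewrite /comp; under eq_fun do rewrite tE.
    apply: (measurable_fun_fubini_tonelli_G (m1 := mu)
      (fun z : GL R n * PV => (H (act z.1 (uvec z.2)))%:E)) => [|z].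
      exact/measurable_EFinP.
    by rewrite lee_fin.
  by rewrite t0 -lee_fin tE -HM bx.
have e1 := EFin_Rintegral_ge0 (fun x => H0 (uvec x)) fin1.
have e2 := EFin_Rintegral_ge0 t0 fin2.
rewrite -e1 -e2 (nuE _ (continuous_homogeneous_uvec s0 hH)) EFinM.
by [].
Qed.

Lemma eigenmeasure_tonelli (act : GL R n -> V -> V) (c : R)
    (nu : probability PV R) H :
  linear_action act -> eigenmeasure (transfer mu act s) c nu -> homogeneous_fun s H ->
  (\int[mu]_g \int[nu]_x (H (act g (uvec x)))%:E =
    c%:E * \int[nu]_x (H (uvec x))%:E)%E.
Proof.
move=> la nuE hH; rewrite -(eigenmeasure_homogeneous la nuE hH).
have [cH _ H0] := hH.
apply: (fubini_tonelli (m1 := mu) (m2 := nu)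
  (fun z : GL R n * PV => (H (act z.1 (uvec z.2)))%:E)) => [|z]; last by rewrite lee_fin.
apply/measurable_EFinP/measurable_continuous_mx => //; exact: act_measurable la.
Qed.

End Eigenmeasure.

(** * Continuity of integrals in a matrix parameter *)

Section ParameterIntegral.
Context {R : realType}.

Lemma sequential_continuous (V : pseudoMetricType R) (f : V -> R) (p : V) :
  (forall u : nat -> V, u @ \oo --> p -> f \o u @ \oo --> f p) ->
  {for p, continuous f}.
Proof.
move=> H; apply: contrapT => Hf.
have [e e0 He] : exists2 e : R, 0 < e &
    forall k : nat, exists x, ball p k.+1%:R^-1 x /\ e <= `|f p - f x|.
  apply: contrapT => He; apply: Hf; apply/cvgrPdist_lt => e e0.
  have : ~ forall k : nat, exists x, ball p k.+1%:R^-1 x /\ e <= `|f p - f x|.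
    by move=> Hk; apply: He; exists e.
  move=> /existsNP[k] /forallNP Hk.
  apply/nbhs_ballP; exists k.+1%:R^-1 => /=; first by rewrite invr_gt0.
  move=> x px; rewrite ltNge; apply/negP => ex; exact: (Hk x).
have [u Hu] := choice He.
have up : u @ \oo --> p.
  apply/cvg_ballP => r r0; near=> k.
  apply: (@le_ball _ _ p k.+1%:R^-1); last by have [] := Hu k.
  by apply/ltW; near: k; exact: (near_infty_natSinv_lt (PosNum r0)).
have /cvgrPdist_lt/(_ e e0)[k _ /(_ k (leqnn k))] := H u up.
by rewrite /= ltNge; have [_ ->] := Hu k.
Unshelve. all: by end_near. Qed.

(** Dominated convergence along sequences. A convergent sequence eventually stays in a ball, so a
    dominating function on each ball is enough. *)
Lemma continuous_param_integral d (T : measurableType d)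
    (mu : {measure set T -> \bar R}) a b (F : 'M[R]_(a, b) -> T -> R) :
  (forall X, measurable_fun setT (F X)) -> (forall t, continuous (F ^~ t)) ->
  (forall M, exists2 g : T -> R, mu.-integrable setT (EFin \o g) &
     forall X t, enorm X <= M -> `|F X t| <= g t) ->
  continuous (fun X => \int[mu]_t F X t).
Proof.
move=> mF cF bF p; apply: sequential_continuous => u up.
have [g ig Hg] := bF (enorm p + 1).
have [k0 _ Hk0] : \forall k \near \oo, enorm (u k) <= enorm p + 1.
  have : enorm (u k) @[k --> \oo] --> enorm p.
    by apply: continuous_cvg => //; exact: continuous_enorm.
  move=> /cvgrPdist_lt/(_ 1 ltr01); apply: filterS => k /ltW.
  by rewrite ler_distl => /andP[]; rewrite lerBlDr => + _; rewrite -lerBlDr.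
rewrite -(cvg_shiftn k0) /comp /Rintegral.
apply: fine_cvg; rewrite fineK; last first.
  apply: integrable_fin_num => //.
  apply: (le_integrable measurableT _ _ ig); first exact/measurable_EFinP.
  move=> t _ /=; rewrite lee_fin (le_trans (Hg _ _ _))// ?ler_norm//.
  by rewrite lerDl.
apply: (@dominated_cvg _ _ _ mu setT measurableT
  (fun k t => (F (u (k + k0)%N) t)%:E) _ (EFin \o g)) => //.
- by move=> k; exact/measurable_EFinP.
- move=> t _; apply: cvg_EFin; first exact: nearW.
  have : u (k + k0)%N @[k --> \oo] --> p by rewrite cvg_shiftn.
  move=> up'; rewrite (_ : fine \o _ = (F ^~ t) \o (fun k => u (k + k0)%N))//.
  exact: (cvg_comp _ _ up' (cF t p)).
- move=> k t _; rewrite /= lee_fin; apply: Hg; apply: Hk0 => /=.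
  by rewrite leq_addl.
Unshelve. all: by end_near. Qed.

End ParameterIntegral.

(** * The pairing and the two potentials *)

Section Pairing.
Context {R : realType} {n : nat}.
Local Notation cV := 'cV[R]_n.+1.
Local Notation rV := 'rV[R]_n.+1.
Local Notation MV := 'M[R]_n.+1.

(** This is |<f, v>|: the product is a 1 x 1 matrix, whose norm is the absolute value of its entry.
    In this form the lemmas on [enorm] apply to it. *)
Definition bracket (f : rV) (v : cV) : R := enorm (f *m v).

Lemma bracket_ge0 f v : 0 <= bracket f v. Proof. exact: enorm_ge0. Qed.

Lemma bracket_le f v : bracket f v <= enorm f * enorm v.
Proof. exact: enormM. Qed.

Lemma bracketZl c f v : bracket (c *: f) v = `|c| * bracket f v.
Proof. by rewrite /bracket -scalemxAl enormZ. Qed.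

Lemma bracketZr c f v : bracket f (c *: v) = `|c| * bracket f v.
Proof. by rewrite /bracket -scalemxAr enormZ. Qed.

Lemma bracketA f (A : MV) v : bracket (f *m A) v = bracket f (A *m v).
Proof. by rewrite /bracket mulmxA. Qed.

Lemma deltaE (y : projspace R 0 n) (x : projspace R n 0) :
  delta y x = bracket (uvec y) (uvec x).
Proof.
have [a a1 ->] := uvecE y; have [b b1 ->] := uvecE x.
rewrite bracketZl bracketZr a1 b1 /delta /bracket enorm_scalar invfM.
by rewrite [LHS]mulrC -mulrA.
Qed.

Lemma linear_action_lact : linear_action (m := n) (k := 0) (@lact R n).
Proof.
split.
- by move=> g c v; rewrite /lact -scalemxAr.
- move=> g v; apply: contra_neq => gv0.
  by rewrite -(mulKmx (GLmx_unit g) v) -/(lact g v) gv0 mulmx0.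
- by move=> g v; exact: enormM.
- apply: mxmeasurable_mul.
    exact: (mxmeasurable_comp measurable_fst mxmeasurable_GLmx).
  exact: (mxmeasurable_comp measurable_snd mxmeasurable_uvec).
Qed.

Lemma linear_action_adjact : linear_action (m := 0) (k := n) (@adjact R n).
Proof.
split.
- by move=> g c v; rewrite /adjact -scalemxAl.
- move=> g v; apply: contra_neq => gv0.
  by rewrite -(mulmxK (GLmx_unit g) v) -/(adjact g v) gv0 mul0mx.
- by move=> g v; rewrite mulrC; exact: enormM.
- apply: mxmeasurable_mul.
    exact: (mxmeasurable_comp measurable_snd mxmeasurable_uvec).
  exact: (mxmeasurable_comp measurable_fst mxmeasurable_GLmx).
Qed.

Lemma homogeneous_powR_enorm (s : R) m k (l : 'M[R]_(m.+1, k.+1) -> R) : 0 < s ->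
  continuous l -> (forall c v, l (c *: v) = `|c| * l v) -> (forall v, 0 <= l v) ->
  homogeneous_fun s (fun v => l v `^ s).
Proof.
move=> s0 cl lZ l0; split.
- rewrite (_ : (fun v => l v `^ s) = (fun t : R => `|t| `^ s) \o l).
    by move=> v; apply: continuous_comp; [exact: cl | exact: continuous_powR_norm].
  by apply/funext => v /=; rewrite ger0_norm.
- by move=> c v; rewrite lZ powRM.
- by move=> v; exact: powR_ge0.
Qed.

Lemma continuous_bracketl v : continuous (bracket ^~ v).
Proof.
have c : continuous (fun f : rV => f *m v).
  by apply: continuous_mulmx => [w|]; [exact: cvg_id | exact: cst_continuous].
by move=> f; apply: (continuous_comp (c f)); exact: continuous_enorm.
Qed.

Lemma continuous_bracketr f : continuous (bracket f).
Proof.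
have c : continuous (fun v : cV => f *m v).
  by apply: continuous_mulmx => [|w]; [exact: cst_continuous | exact: cvg_id].
by move=> v; apply: (continuous_comp (c v)); exact: continuous_enorm.
Qed.

End Pairing.

(** The s-homogeneous extension of r_s to all vectors: at the unit representative of x it equals
    [r_ nustar s x]. *)
HB.lock Definition potential (R : realType) (n : nat)
  (nustar : probability (projspace R 0 n) R) (s : R) (v : 'cV[R]_n.+1) : R :=
  \int[nustar]_y (bracket (uvec y) v `^ s).

(** The dual object, with the roles of vectors and forms exchanged: an eigenfunction for the action
    on forms, built from nu. *)
HB.lock Definition copotential (R : realType) (n : nat)
  (nu : probability (projspace R n 0) R) (s : R) (f : 'rV[R]_n.+1) : R :=
  \int[nu]_x (bracket f (uvec x) `^ s).

Section Potentials.
Context {R : realType} {n : nat}.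
Local Notation cV := 'cV[R]_n.+1.
Local Notation rV := 'rV[R]_n.+1.
Context (mu : probability (GL R n) R) (s : R) (s0 : 0 < s).
Hypothesis moment : (\int[mu]_g (enorm (GLmx g) `^ s)%:E < +oo)%E.
Context (nu : probability (projspace R n 0) R) (nustar : probability (projspace R 0 n) R).

Lemma measurable_bracket d (T : measurableType d) (f : T -> rV) (v : T -> cV) :
  mxmeasurable f -> mxmeasurable v -> measurable_fun setT (fun t => bracket (f t) (v t) `^ s).
Proof. by move=> mf mv; apply: measurable_enorm_powR; exact: mxmeasurable_mul. Qed.

Lemma potential_ereal v :
  (potential nustar s v)%:E = (\int[nustar]_y (bracket (uvec y) v `^ s)%:E)%E.
Proof.
rewrite unlock; apply: EFin_Rintegral_ge0 => [y|]; first exact: powR_ge0.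
apply: (@le_lt_trans _ _ (enorm v `^ s)%:E); last exact: ltry.
apply: integral_probability_le => [|y].
  apply: measurable_bracket; first exact: mxmeasurable_uvec.
  exact: mxmeasurable_cst.
rewrite powR_ge0 le_powR_ge0 ?bracket_ge0 ?(ltW s0)//.
by rewrite (le_trans (bracket_le _ _))// enorm_uvec mul1r.
Qed.

Lemma copotential_ereal f :
  (copotential nu s f)%:E = (\int[nu]_x (bracket f (uvec x) `^ s)%:E)%E.
Proof.
rewrite unlock; apply: EFin_Rintegral_ge0 => [y|]; first exact: powR_ge0.
apply: (@le_lt_trans _ _ (enorm f `^ s)%:E); last exact: ltry.
apply: integral_probability_le => [|y].
  apply: measurable_bracket; last exact: mxmeasurable_uvec.
  exact: mxmeasurable_cst.
rewrite powR_ge0 le_powR_ge0 ?bracket_ge0 ?(ltW s0)//.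
by rewrite (le_trans (bracket_le _ _))// enorm_uvec mulr1.
Qed.

Lemma continuous_potential : continuous (potential nustar s).
Proof.
rewrite unlock; apply: continuous_param_integral => [v|y|M].
- apply: measurable_bracket; [exact: mxmeasurable_uvec | exact: mxmeasurable_cst].
- have [] := @homogeneous_powR_enorm R s n 0 (bracket (uvec y)) s0 => //.
  + exact: continuous_bracketr.
  + by move=> c v; exact: bracketZr.
  + by move=> v; exact: bracket_ge0.
- exists (fun=> `|M| `^ s).
    exact: finite_measure_integrable_cst.
  move=> v y vM; rewrite ger0_norm ?powR_ge0// le_powR_ge0 ?bracket_ge0 ?(ltW s0)//.
  rewrite (le_trans (bracket_le _ _))// enorm_uvec mul1r (le_trans vM)//.
  exact: ler_norm.
Qed.

Lemma continuous_copotential : continuous (copotential nu s).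
Proof.
rewrite unlock; apply: continuous_param_integral => [v|y|M].
- apply: measurable_bracket; [exact: mxmeasurable_cst | exact: mxmeasurable_uvec].
- have [] := @homogeneous_powR_enorm R s 0 n (bracket ^~ (uvec y)) s0 => //.
  + exact: continuous_bracketl.
  + by move=> c v; exact: bracketZl.
  + by move=> v; exact: bracket_ge0.
- exists (fun=> `|M| `^ s).
    exact: finite_measure_integrable_cst.
  move=> v y vM; rewrite ger0_norm ?powR_ge0// le_powR_ge0 ?bracket_ge0 ?(ltW s0)//.
  rewrite (le_trans (bracket_le _ _))// enorm_uvec mulr1 (le_trans vM)//.
  exact: ler_norm.
Qed.

Lemma homogeneous_potential : homogeneous_fun s (potential nustar s).
Proof.
split; first exact: continuous_potential.
- move=> c v; apply: EFin_inj.
  transitivity ((`|c| `^ s)%:E * (potential nustar s v)%:E)%E; last by [].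
  rewrite [LHS]potential_ereal [X in (_ * X)%E]potential_ereal.
  rewrite -ge0_integralZl//; last 2 first.
  + by apply/measurable_EFinP/measurable_bracket; [exact: mxmeasurable_uvec | exact: mxmeasurable_cst].
  + by move=> y _; rewrite lee_fin powR_ge0.
  apply: eq_integral => y _.
  by rewrite bracketZr powRM ?bracket_ge0.
- move=> v; rewrite -lee_fin [leRHS]potential_ereal integral_ge0// => y _.
  by rewrite lee_fin powR_ge0.
Qed.

Lemma homogeneous_copotential : homogeneous_fun s (copotential nu s).
Proof.
split; first exact: continuous_copotential.
- move=> c v; apply: EFin_inj.
  transitivity ((`|c| `^ s)%:E * (copotential nu s v)%:E)%E; last by [].
  rewrite [LHS]copotential_ereal [X in (_ * X)%E]copotential_ereal.
  rewrite -ge0_integralZl//; last 2 first.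
  + by apply/measurable_EFinP/measurable_bracket; [exact: mxmeasurable_cst | exact: mxmeasurable_uvec].
  + by move=> y _; rewrite lee_fin powR_ge0.
  apply: eq_integral => y _.
  by rewrite bracketZl powRM ?bracket_ge0.
- move=> v; rewrite -lee_fin [leRHS]copotential_ereal integral_ge0// => y _.
  by rewrite lee_fin powR_ge0.
Qed.

Context (K : R).
Hypothesis nuE : eigenmeasure (P_ mu s) K nu.
Hypothesis nustarE : eigenmeasure (Pstar_ mu s) K nustar.

(** For fixed v, the function |<f, v>|^s of f is homogeneous, and <f g, v> = <f, g v>. Tonelli's
    theorem thus turns the eigenmeasure equation of nustar into an eigenfunction equation for N. *)
Lemma potential_eigen v :
  (\int[mu]_g (potential nustar s (GLmx g *m v))%:E = (K * potential nustar s v)%:E)%E.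
Proof.
have h : homogeneous_fun s (fun f : rV => bracket f v `^ s).
  apply: homogeneous_powR_enorm => //.
  - exact: continuous_bracketl.
  - by move=> c f; exact: bracketZl.
  - by move=> f; exact: bracket_ge0.
have := eigenmeasure_tonelli s0 moment linear_action_adjact nustarE h.
move=> E; transitivity (K%:E * (potential nustar s v)%:E)%E; last by [].
rewrite [X in (_ * X)%E]potential_ereal -E; apply: eq_integral => g _.
by rewrite [LHS]potential_ereal; apply: eq_integral => y _; rewrite /adjact bracketA.
Qed.

Lemma copotential_eigen f :
  (\int[mu]_g (copotential nu s (f *m GLmx g))%:E = (K * copotential nu s f)%:E)%E.
Proof.
have h : homogeneous_fun s (fun v : cV => bracket f v `^ s).
  apply: homogeneous_powR_enorm => //.
  - exact: continuous_bracketr.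
  - by move=> c v; exact: bracketZr.
  - by move=> v; exact: bracket_ge0.
have := eigenmeasure_tonelli s0 moment linear_action_lact nuE h.
move=> E; transitivity (K%:E * (copotential nu s f)%:E)%E; last by [].
rewrite [X in (_ * X)%E]copotential_ereal -E; apply: eq_integral => g _.
by rewrite [LHS]copotential_ereal; apply: eq_integral => x _; rewrite /lact bracketA.
Qed.

End Potentials.

(** * Positivity of the potentials *)

Section Irreducibility.
Context {R : realType} {n : nat}.
Local Notation cV := 'cV[R]_n.+1.

Definition linear_pred (V : lmodType R) (Z : V -> Prop) : Prop :=
  Z 0 /\ forall a u v, Z u -> Z v -> Z (a *: u + v).

(** A subspace of maximal dimension inside Z is all of Z: adding the line of a missing vector would
    give a larger one. *)
Lemma linear_pred_vspace (V : vectType R) (Z : V -> Prop) : linear_pred Z ->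
  exists W : {vspace V}, forall v, v \in W <-> Z v.
Proof.
move=> [Z0 Zlin].
pose D k := `[< exists W : {vspace V}, \dim W = k /\ forall v, v \in W -> Z v >].
have D0 : exists k, D k.
  by exists 0%N; apply/asboolP; exists 0%VS; split; [rewrite dimv0|move=> v; rewrite memv0 => /eqP ->].
have Dle k : D k -> (k <= \dim (fullv : {vspace V}))%N.
  by move=> /asboolP[W [<- _]]; rewrite dimvS// subvf.
case: (ex_maxnP D0 Dle) => k /asboolP[W [Wk WZ]] kmax.
exists W => v; split => [|Zv]; first exact: WZ.
apply: contraT => vW.
have : D (\dim (W + <[v]>)%VS).
  apply/asboolP; exists (W + <[v]>)%VS; split => // w /memv_addP[w1 w1W [w2 /vlineP[c ->] ->]].
  by rewrite addrC; apply: Zlin => //; exact: WZ.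
move=> /kmax; rewrite -Wk => dimle.
have : (W == W + <[v]>)%VS by rewrite eqEdim addvSl dimle.
move=> /eqP E; case/negP: vW; rewrite E.
by rewrite (subvP (addvSr W <[v]>%VS))// memv_line.
Qed.

Lemma irreducible_linear_pred (S : set (GL R n)) (Z : cV -> Prop) :
  strongly_irreducible S -> linear_pred Z ->
  (forall g v, S g -> Z v -> Z (GLmx g *m v)) ->
  (forall v, Z v -> v = 0) \/ (forall v, Z v).
Proof.
move=> irr Zlin Zinv; have [W WZ] := linear_pred_vspace Zlin.
have [W0|W0] := eqVneq W 0%VS.
  by left=> v /WZ; rewrite W0 memv0 => /eqP.
have [Wf|Wf] := eqVneq W fullv.
  by right=> v; apply/WZ; rewrite Wf memvf.
exfalso; apply: (irr [:: W]) => // [W'|g v Sg [W' ]]; first by rewrite inE => /eqP ->.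
rewrite inE => /eqP -> vW; exists W; rewrite ?inE//.
by apply/WZ; apply: Zinv => //; exact/WZ.
Qed.

Context (mu : probability (GL R n) R).

(** The complement of S is open and null, so it contains no point of the support; S is then a closed
    semigroup containing the support. Almost sure properties of g are extended to Gamma_mu in this
    way. *)
Lemma Gamma_sub (S : set (GL R n)) :
  closed S -> (forall g h, S g -> S h -> S (GLM g h)) -> {ae mu, forall g, S g} ->
  Gamma mu `<=` S.
Proof.
move=> cS SM [B [mB B0 SB]]; apply: smallest_sub => // g gsupp.
apply: contrapT => Sg.
have oS : open (~` S) by exact: closed_openC.
have mS : measurable (~` S) by exact: sub_sigma_algebra.
have := gsupp (~` S) oS Sg.
have : (mu (~` S) <= mu B)%E by apply: le_measure; rewrite ?inE.
by rewrite B0 => S0 /lt_le_trans/(_ S0); rewrite ltxx.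
Qed.

(** The exceptional set may depend on v, but a finite basis of Z decides the matter, and a finite
    union of null sets is null. *)
Lemma ae_linear_pred (V : vectType R) (Z : V -> Prop) (act : GL R n -> V -> V) :
  linear_pred Z ->
  (forall g a u v, act g (a *: u + v) = a *: act g u + act g v) ->
  (forall v, Z v -> {ae mu, forall g, Z (act g v)}) ->
  {ae mu, forall g, forall v, Z v -> Z (act g v)}.
Proof.
move=> Zlin actD Zact; have [W WZ] := linear_pred_vspace Zlin; have [Z0 ZD] := Zlin.
have H : {ae mu, forall g, forall i : 'I_(\dim W), Z (act g (vbasis W)`_i)}.
  apply: filter_forall => i; apply: Zact; apply/WZ.
  by apply: vbasis_mem; apply: mem_nth; rewrite size_tuple.
apply: filterS H => g Hg v /WZ vW; rewrite (coord_vbasis vW).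
have act0 : act g 0 = 0.
  by have := actD g (-1) 0 0; rewrite scaler0 addr0 scaleN1r addNr.
elim/big_ind : _ => [|u w Zu Zw|i _]; first by rewrite act0.
  by rewrite -(scale1r u) actD; apply: ZD.
by rewrite -[_ *: _]addr0 actD act0; apply: ZD.
Qed.

Lemma ae_zero_integral d (T : measurableType d) (m : {measure set T -> \bar R})
    (f : T -> R) :
  measurable_fun setT f -> (forall x, 0 <= f x) -> (\int[m]_x (f x)%:E = 0)%E ->
  {ae m, forall x, f x = 0}.
Proof.
move=> mf f0 H; have mfE : measurable_fun setT (EFin \o f) by exact/measurable_EFinP.
have : (\int[m]_x `|(EFin \o f) x| = 0)%E.
  by rewrite -[RHS]H; apply: eq_integral => x _; rewrite gee0_abs// lee_fin.
move=> /(ae_eq_integral_abs m measurableT mfE); apply: filterS => x /(_ I).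
by move=> /= [].
Qed.

Lemma homogeneous_ge s m k (H : 'M[R]_(m.+1, k.+1) -> R) : 0 < s ->
  homogeneous_fun s H -> (forall v, H v = 0 -> v = 0) ->
  exists2 c : R, 0 < c & forall v, c * enorm v `^ s <= H v.
Proof.
move=> s0 hH Hpos; have [cH HZ H0] := hH.
have [c /set_mem/= c1 cmin] := compact_EVT_min (@enorm_sphere_neq0 R m k)
  (@compact_sphere R m.+1 k.+1) (continuous_subspaceT cH).
exists (H c).
  rewrite lt_neqAle H0 andbT eq_sym; apply/eqP => /Hpos c0.
  by move: c1; rewrite c0 enorm0 => /esym/eqP; rewrite oner_eq0.
move=> v; have [->|v0] := eqVneq v 0.
  by rewrite enorm0 powR0 ?gt_eqF// mulr0.
rewrite (homogeneous_normalize hH v0) mulrC ler_wpM2l ?powR_ge0//.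
apply: cmin; rewrite inE /=.
by rewrite enormZ normfV ger0_norm ?enorm_ge0// mulVf// enorm_eq0.
Qed.

Lemma powRD_le (s a b : R) : 0 < s -> 0 <= a -> 0 <= b ->
  (a + b) `^ s <= 2 `^ s * (a `^ s + b `^ s).
Proof.
move=> s0; wlog ab : a b / a <= b.
  move=> H a0 b0; have [ab|/ltW ba] := leP a b; first exact: H.
  by rewrite addrC [a `^ _ + _]addrC; exact: H.
move=> a0 b0; apply: (@le_trans _ _ ((2 * b) `^ s)).
  by apply: le_powR_ge0; rewrite ?(ltW s0) ?addr_ge0// mulr_natl mulr2n lerD2r.
by rewrite powRM// ler_wpM2l ?powR_ge0// lerDr powR_ge0.
Qed.

End Irreducibility.

Section Positivity.
Context {R : realType} {n : nat}.
Local Notation cV := 'cV[R]_n.+1.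
Local Notation MV := 'M[R]_n.+1.

Lemma ae_probability_False d (T : measurableType d) (P : probability T R) :
  {ae P, forall x, False} -> False.
Proof.
move=> [B [mB B0 TB]].
have BT : B = setT by apply/seteqP; split => // x _; apply: TB.
have := probability_setT P; rewrite -BT => H.
by move: B0; rewrite H => /eqP; rewrite onee_eq0.
Qed.

Lemma integral_lincomb_le d (T : measurableType d) (m : {measure set T -> \bar R})
    (c : R) (f g h : T -> R) : 0 <= c ->
  measurable_fun setT f -> measurable_fun setT g -> measurable_fun setT h ->
  (forall x, 0 <= f x) -> (forall x, 0 <= g x) ->
  (forall x, 0 <= h x <= c * (f x + g x)) ->
  (\int[m]_x (h x)%:E <= c%:E * (\int[m]_x (f x)%:E + \int[m]_x (g x)%:E))%E.
Proof.
move=> c0 mf mg mh f0 g0 hle.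
apply: (@le_trans _ _ (\int[m]_x (c * (f x + g x))%:E)%E).
  apply: le_integral_fin => //; apply: measurable_funM; first exact: measurable_cst.
  exact: measurable_funD.
under eq_integral do rewrite EFinM EFinD.
rewrite ge0_integralZl//; last 2 first.
- by apply: emeasurable_funD; exact/measurable_EFinP.
- by move=> x _; rewrite adde_ge0// lee_fin.
rewrite ge0_integralD//; last 4 first.
- by move=> x _; rewrite lee_fin.
- exact/measurable_EFinP.
- by move=> x _; rewrite lee_fin.
- exact/measurable_EFinP.
Qed.

Context (mu : probability (GL R n) R) (s : R) (s0 : 0 < s).
Hypothesis moment : (\int[mu]_g (enorm (GLmx g) `^ s)%:E < +oo)%E.
Context (nu : probability (projspace R n 0) R) (nustar : probability (projspace R 0 n) R).

Lemma potentialD v w : potential nustar s (v + w) <=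
  2 `^ s * (potential nustar s v + potential nustar s w).
Proof.
have m x : measurable_fun setT (fun y : projspace R 0 n => bracket (uvec y) x `^ s).
  by apply: measurable_bracket; [exact: mxmeasurable_uvec|exact: mxmeasurable_cst].
suff : ((potential nustar s (v + w))%:E <=
    (2 `^ s)%:E * ((potential nustar s v)%:E + (potential nustar s w)%:E))%E by [].
rewrite [leLHS]potential_ereal// [X in (_ * (X + _))%E]potential_ereal//
  [X in (_ * (_ + X))%E]potential_ereal//.
apply: integral_lincomb_le => // [y|y|y]; rewrite ?powR_ge0//=.
apply: (@le_trans _ _ ((bracket (uvec y) v + bracket (uvec y) w) `^ s)).
  apply: le_powR_ge0; rewrite ?(ltW s0) ?bracket_ge0//.
  by rewrite /bracket mulmxDr enormD.
by apply: powRD_le; rewrite ?bracket_ge0.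
Qed.

Lemma copotentialD v w : copotential nu s (v + w) <=
  2 `^ s * (copotential nu s v + copotential nu s w).
Proof.
have m x : measurable_fun setT (fun y : projspace R n 0 => bracket x (uvec y) `^ s).
  by apply: measurable_bracket; [exact: mxmeasurable_cst|exact: mxmeasurable_uvec].
suff : ((copotential nu s (v + w))%:E <=
    (2 `^ s)%:E * ((copotential nu s v)%:E + (copotential nu s w)%:E))%E by [].
rewrite [leLHS]copotential_ereal// [X in (_ * (X + _))%E]copotential_ereal//
  [X in (_ * (_ + X))%E]copotential_ereal//.
apply: integral_lincomb_le => // [y|y|y]; rewrite ?powR_ge0//=.
apply: (@le_trans _ _ ((bracket v (uvec y) + bracket w (uvec y)) `^ s)).
  apply: le_powR_ge0; rewrite ?(ltW s0) ?bracket_ge0//.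
  by rewrite /bracket mulmxDl enormD.
by apply: powRD_le; rewrite ?bracket_ge0.
Qed.

(** The triangle inequality up to the factor 2^s is enough for the zeros of H to form a subspace. *)
Lemma linear_pred_zero m k (H : 'M[R]_(m.+1, k.+1) -> R) : homogeneous_fun s H ->
  (forall v w, H (v + w) <= 2 `^ s * (H v + H w)) -> linear_pred (fun v => H v = 0).
Proof.
move=> [_ HZ H0] HD; split=> [|a u v Hu Hv].
  by rewrite -(scale0r (0 : 'M[R]_(m.+1, k.+1))) HZ normr0 powR0 ?gt_eqF// mul0r.
apply/le_anti; rewrite H0 andbT (le_trans (HD _ _))//.
by rewrite HZ Hu Hv !mulr0 addr0 mulr0.
Qed.

(** If N vanished on the standard basis, almost every unit form would be orthogonal to every basis
    vector, hence zero. *)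
Lemma potential_not0 : ~ forall v, potential nustar s v = 0.
Proof.
move=> N0; apply: (@ae_probability_False _ _ nustar).
have H : {ae nustar, forall y, forall i : 'I_n.+1,
    bracket (uvec y) (delta_mx i ord0) `^ s = 0}.
  apply: filter_forall => i; apply: ae_zero_integral => [|y|].
  - by apply: measurable_bracket; [exact: mxmeasurable_uvec|exact: mxmeasurable_cst].
  - exact: powR_ge0.
  - by rewrite -potential_ereal// N0.
apply: filterS H => y Hy.
have : uvec y = 0.
  apply/rowP => i; rewrite mxE; have /eqP := Hy i.
  rewrite powR_eq0 => /andP[+ _].
  by rewrite enorm_eq0 => /eqP/matrixP/(_ ord0 ord0); rewrite -colE !mxE.
by move=> y0; have := enorm_uvec y; rewrite y0 enorm0 => /esym/eqP; rewrite oner_eq0.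
Qed.

Lemma copotential_not0 : ~ forall f, copotential nu s f = 0.
Proof.
move=> N0; apply: (@ae_probability_False _ _ nu).
have H : {ae nu, forall y, forall i : 'I_n.+1,
    bracket (delta_mx ord0 i) (uvec y) `^ s = 0}.
  apply: filter_forall => i; apply: ae_zero_integral => [|y|].
  - by apply: measurable_bracket; [exact: mxmeasurable_cst|exact: mxmeasurable_uvec].
  - exact: powR_ge0.
  - by rewrite -copotential_ereal// N0.
apply: filterS H => y Hy.
have : uvec y = 0.
  apply/colP => i; rewrite mxE; have /eqP := Hy i.
  rewrite powR_eq0 => /andP[+ _].
  by rewrite enorm_eq0 => /eqP/matrixP/(_ ord0 ord0); rewrite -rowE !mxE.
by move=> y0; have := enorm_uvec y; rewrite y0 enorm0 => /esym/eqP; rewrite oner_eq0.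
Qed.

Context (K : R).
Hypothesis nuE : eigenmeasure (P_ mu s) K nu.
Hypothesis nustarE : eigenmeasure (Pstar_ mu s) K nustar.
Hypothesis irr : strongly_irreducible (Gamma mu).

Lemma closed_GL_zero (F : MV -> R) : continuous F -> closed [set g : GL R n | F (GLmx g) = 0].
Proof.
move=> cF; have c : continuous (fun g : GL R n => F (GLmx g)).
  by move=> g; exact: (@continuous_comp _ _ _ (@GLmx R n) F g (@continuous_GLmx R n g) (cF _)).
apply: (@closed_comp _ _ (fun g : GL R n => F (GLmx g)) [set 0]).
  by move=> g _; exact: c.
exact: closed_eq.
Qed.

(** When N(v) = 0 the eigenfunction equation says that the nonnegative function N(g v) of g has
    integral zero, so it vanishes almost surely; [Gamma_sub] passes to Gamma_mu. *)
Lemma Gamma_potential_zero g v : Gamma mu g -> potential nustar s v = 0 ->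
  potential nustar s (GLmx g *m v) = 0.
Proof.
have hN := homogeneous_potential s0 nustar; have [cN _ N0] := hN.
pose S := [set g : GL R n | forall v, potential nustar s v = 0 ->
  potential nustar s (GLmx g *m v) = 0].
have cFv w : continuous (fun A : MV => potential nustar s (A *m w)).
  have c : continuous (fun A : MV => A *m w).
    by apply: continuous_mulmx => [x|]; [exact: cvg_id|exact: cst_continuous].
  by move=> A; apply: (continuous_comp (c A)); exact: cN.
suff GS : Gamma mu `<=` S by move=> gG; exact: (GS g gG v).
apply: Gamma_sub.
- rewrite (_ : S = \bigcap_(w in [set w | potential nustar s w = 0])
      [set g | potential nustar s (GLmx g *m w) = 0]).
    apply: closed_bigI => w _.
    exact: (closed_GL_zero (cFv w)).
  by apply/seteqP; split=> h Hh w; exact: Hh.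
- by move=> h1 h2 H1 H2 w w0 /=; rewrite -mulmxA; apply: H1; exact: H2.
- apply: (@ae_linear_pred _ _ mu _ _ (fun g v => GLmx g *m v)).
  + by apply: linear_pred_zero => //; exact: potentialD.
  + by move=> h a u w; rewrite mulmxDr scalemxAr.
  + move=> w w0; apply: ae_zero_integral => // [|].
      by apply: (measurable_continuous_mx mxmeasurable_GLmx (cFv w)).
    by rewrite (potential_eigen s0 moment nustarE) w0 mulr0.
Qed.

Lemma Gamma_copotential_zero g v : Gamma mu g -> copotential nu s v = 0 ->
  copotential nu s (v *m GLmx g) = 0.
Proof.
have hN := homogeneous_copotential s0 nu; have [cN _ N0] := hN.
pose S := [set g : GL R n | forall v, copotential nu s v = 0 ->
  copotential nu s (v *m GLmx g) = 0].
have cFv w : continuous (fun A : MV => copotential nu s (w *m A)).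
  have c : continuous (fun A : MV => w *m A).
    by apply: continuous_mulmx => [|x]; [exact: cst_continuous|exact: cvg_id].
  by move=> A; apply: (continuous_comp (c A)); exact: cN.
suff GS : Gamma mu `<=` S by move=> gG; exact: (GS g gG v).
apply: Gamma_sub.
- rewrite (_ : S = \bigcap_(w in [set w | copotential nu s w = 0])
      [set g | copotential nu s (w *m GLmx g) = 0]).
    apply: closed_bigI => w _.
    exact: (closed_GL_zero (cFv w)).
  by apply/seteqP; split=> h Hh w; exact: Hh.
- by move=> h1 h2 H1 H2 w w0 /=; rewrite mulmxA; apply: H2; exact: H1.
- apply: (@ae_linear_pred _ _ mu _ _ (fun g v => v *m GLmx g)).
  + by apply: linear_pred_zero => //; exact: copotentialD.
  + by move=> h a u w; rewrite mulmxDl scalemxAl.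
  + move=> w w0; apply: ae_zero_integral => // [|].
      by apply: (measurable_continuous_mx mxmeasurable_GLmx (cFv w)).
    by rewrite (copotential_eigen s0 moment nuE) w0 mulr0.
Qed.

(** The zeros of N form a Gamma_mu-invariant subspace, which is not the whole space, hence is
    trivial. The minimum of N on the unit sphere is then positive. *)
Lemma potential_ge : exists2 c : R, 0 < c &
  forall v, c * enorm v `^ s <= potential nustar s v.
Proof.
apply: homogeneous_ge => //; first exact: homogeneous_potential.
have := @irreducible_linear_pred _ _ (Gamma mu) (fun v => potential nustar s v = 0) irr.
case=> //.
- apply: linear_pred_zero; first exact: homogeneous_potential.
  exact: potentialD.
- by move=> g v; exact: Gamma_potential_zero.
- by move=> H; case: potential_not0.
Qed.

(** Irreducibility concerns vectors, whereas the zeros of N' are forms. So it is applied to their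
    common kernel Z, which is invariant because f g is a zero whenever f is. If Z = 0 then every
    form is a zero of N', which is excluded; if Z is everything then only f = 0 is a zero. *)
Lemma copotential_ge : exists2 c : R, 0 < c &
  forall f, c * enorm f `^ s <= copotential nu s f.
Proof.
apply: homogeneous_ge => //; first exact: homogeneous_copotential.
have Zlin : linear_pred (fun f => copotential nu s f = 0).
  apply: linear_pred_zero; first exact: homogeneous_copotential.
  exact: copotentialD.
pose Z (v : cV) := forall f, copotential nu s f = 0 -> f *m v = 0.
have := @irreducible_linear_pred _ _ (Gamma mu) Z irr.
case.
- split=> [f _|a u v Zu Zv f f0]; first by rewrite mulmx0.
  by rewrite mulmxDr -scalemxAr Zu// Zv// scaler0 addr0.
- move=> g v gG Zv f f0; rewrite mulmxA; apply: Zv; exact: Gamma_copotential_zero.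
- move=> Z0; exfalso; apply: copotential_not0 => f.
  have [W WZ] := linear_pred_vspace Zlin.
  apply/WZ; apply: contraT => fW.
  (* The rows of B are a basis of the space W of zeros. A form outside W is not killed by the
     cokernel matrix of B, one column of which is then a nonzero vector of Z. *)
  pose B : 'M[R]_(\dim W, n.+1) := \matrix_(i, j) (vbasis W)`_i ord0 j.
  have fB : ~~ (f <= B)%MS.
    apply: contra fW => /submxP[D ->]; rewrite mulmx_sum_row memv_suml// => i _.
    apply: memvZ.
    have -> : row i B = (vbasis W)`_i by apply/rowP => j; rewrite !mxE.
    by apply: vbasis_mem; apply: mem_nth; rewrite size_tuple.
  have [j Hj] : exists j, (f *m cokermx B) ord0 j != 0.
    apply/existsP; apply: contraNT fB; rewrite negb_exists submxE => /forallP H.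
    by apply/eqP/rowP => j; rewrite [RHS]mxE; apply/eqP; move: (H j); rewrite negbK.
  have v0 : col j (cokermx B) != 0.
    apply: contraNneq Hj => v0; have := congr1 (mulmx f) v0.
    rewrite mulmx0 colE mulmxA -colE => /matrixP/(_ ord0 ord0).
    by rewrite mxE [X in _ = X]mxE => ->.
  case/eqP: v0; apply: Z0 => f' /WZ f'W.
  have -> : f' = (\row_i coord (vbasis W) i f') *m B.
    rewrite mulmx_sum_row {1}(coord_vbasis f'W); apply: eq_bigr => i _.
    by rewrite mxE; congr (_ *: _); apply/rowP => k; rewrite !mxE.
  by rewrite colE -mulmxA [B *m _]mulmxA mulmx_coker mul0mx mulmx0.
- move=> Zall f f0; apply/rowP => i.
  have := Zall (delta_mx i ord0) f f0.
  by rewrite -colE => /matrixP/(_ ord0 ord0); rewrite !mxE.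
Qed.

End Positivity.

(** * Convolution powers *)

Section Convolution.
Context {R : realType} {n : nat}.

(** A separate name for the product measure, on which the structure of a probability can be
    declared. *)
Definition product_law (P Q : probability (GL R n) R) :
  set (GL R n * GL R n) -> \bar R := (P \x Q)%E.

HB.instance Definition _ P Q := Measure.on (product_law P Q).

Let product_law_setT P Q : product_law P Q setT = 1%E.
Proof.
rewrite /product_law -setXTT product_measure1E//.
rewrite -[RHS]mule1; congr (_ * _)%E; exact: probability_setT.
Qed.

HB.instance Definition _ P Q :=
  Measure_isProbability.Build _ _ _ (product_law P Q) (@product_law_setT P Q).

Definition GLM_pair (z : GL R n * GL R n) : GL R n := GLM z.1 z.2.

Let measurable_GLM_pair : measurable_fun setT GLM_pair.
Proof.
apply: measurable_GL; apply: mxmeasurable_mul.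
  exact: (mxmeasurable_comp measurable_fst mxmeasurable_GLmx).
exact: (mxmeasurable_comp measurable_snd mxmeasurable_GLmx).
Qed.

HB.instance Definition _ := isMeasurableFun.Build _ _ _ _ GLM_pair measurable_GLM_pair.

Definition convolution (P Q : probability (GL R n) R) : probability (GL R n) R :=
  distribution (product_law P Q) GLM_pair.

Lemma integral_convolution P Q (F : GL R n -> \bar R) :
  measurable_fun setT F -> (forall g, 0 <= F g)%E ->
  (\int[convolution P Q]_g F g = \int[P]_g \int[Q]_h F (GLM g h))%E.
Proof.
move=> mF F0; rewrite ge0_integral_distribution//.
rewrite (fubini_tonelli1 (m1 := P) (m2 := Q) (F \o GLM_pair))// => [|z].
  exact: measurableT_comp.
exact: F0.
Qed.

Lemma convolution_tonelli (P Q : probability (GL R n) R) (F : GL R n -> \bar R) :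
  measurable_fun setT F -> (forall g, 0 <= F g)%E ->
  (\int[P]_g \int[Q]_h F (GLM g h) = \int[Q]_h \int[P]_g F (GLM g h))%E.
Proof.
move=> mF F0; apply: (fubini_tonelli (m1 := P) (m2 := Q) (F \o GLM_pair)) => [|z].
  exact: measurableT_comp.
exact: F0.
Qed.

Lemma measurable_convolution_inner (Q : probability (GL R n) R) (F : GL R n -> \bar R) :
  measurable_fun setT F -> (forall g, 0 <= F g)%E ->
  measurable_fun setT (fun g => \int[Q]_h F (GLM g h))%E.
Proof.
move=> mF F0; apply: (measurable_fun_fubini_tonelli_F (m2 := Q) (F \o GLM_pair)) => [|z].
  exact: measurableT_comp.
exact: F0.
Qed.

Variable mu : probability (GL R n) R.

(* The law of g_j ... g_1. *)
Fixpoint conv_power (j : nat) : probability (GL R n) R :=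
  if j is i.+1 then convolution mu (conv_power i) else dirac GL1.

Lemma GLmxM (g h : GL R n) : GLmx (GLM g h) = GLmx g *m GLmx h.
Proof. by []. Qed.

Lemma GLmx_inj : injective (@GLmx R n).
Proof. exact: val_inj. Qed.

Lemma GLM1 g : GLM g GL1 = g :> GL R n.
Proof. by apply: GLmx_inj; rewrite GLmxM mulmx1. Qed.

Lemma GL1M g : GLM GL1 g = g :> GL R n.
Proof. by apply: GLmx_inj; rewrite GLmxM mul1mx. Qed.

Lemma GLMA (g h k : GL R n) : GLM g (GLM h k) = GLM (GLM g h) k.
Proof. by apply: GLmx_inj; rewrite !GLmxM mulmxA. Qed.

Lemma integral_conv_power0 (F : GL R n -> \bar R) : measurable_fun setT F ->
  (\int[conv_power 0]_g F g = F GL1)%E.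
Proof. by move=> mF; rewrite integral_dirac// diracT mul1e. Qed.

Lemma integral_conv_powerD i j (F : GL R n -> \bar R) :
  measurable_fun setT F -> (forall g, 0 <= F g)%E ->
  (\int[conv_power (i + j)]_g F g =
   \int[conv_power i]_g \int[conv_power j]_h F (GLM g h))%E.
Proof.
elim: i F => [|i IH] F mF F0.
  rewrite integral_conv_power0; last exact: measurable_convolution_inner.
  by rewrite add0n; apply: eq_integral => h _; rewrite GL1M.
rewrite addSn /= integral_convolution// integral_convolution//; last 2 first.
- exact: measurable_convolution_inner.
- by move=> g; apply: integral_ge0.
apply: eq_integral => g _.
have mFg : measurable_fun setT (fun h => F (GLM g h)).
  apply: (measurableT_comp mF).
  exact: (measurableT_comp measurable_GLM_pair (pair1_measurable g)).
rewrite [LHS](IH (fun h => F (GLM g h)) mFg (fun h => F0 _)).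
by apply: eq_integral => h _; apply: eq_integral => k _; rewrite GLMA.
Qed.

End Convolution.

Lemma integral_indicT {R : realType} d (T : measurableType d)
    (m : {measure set T -> \bar R}) (U : set T) : measurable U ->
  (\int[m]_x (\1_U x)%:E = m U)%E.
Proof. by move=> mU; rewrite (integral_indic m measurableT mU) setIT. Qed.

Section ConvolutionPowers.
Context {R : realType} {n : nat}.
Local Notation MV := 'M[R]_n.+1.
Variable mu : probability (GL R n) R.
Local Notation mu_ := (conv_power mu).

Lemma measurable_GL_mx (F : MV -> R) : continuous F ->
  measurable_fun setT (fun g : GL R n => F (GLmx g)).
Proof. by move=> cF; apply: measurable_continuous_mx => //; exact: mxmeasurable_GLmx. Qed.

Lemma measurable_GLMl (g : GL R n) : measurable_fun setT (GLM g).
Proof.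
apply: measurable_GL; apply: mxmeasurable_mul; first exact: mxmeasurable_cst.
exact: mxmeasurable_GLmx.
Qed.

Lemma conv_power_indic i j (U : set (GL R n)) : measurable U ->
  (mu_ (i + j)%N U = \int[mu_ i]_g \int[mu_ j]_h (\1_U (GLM g h))%:E)%E.
Proof.
move=> mU; rewrite -[LHS](integral_indicT (mu_ (i + j)%N) mU).
apply: (@integral_conv_powerD _ _ mu i j (EFin \o \1_U)) => [|g].
  by apply/measurable_EFinP; exact: measurable_indic.
by rewrite lee_fin.
Qed.

Lemma conv_power_open_gt0 i j (U1 U2 U : set (GL R n)) :
  measurable U1 -> measurable U2 -> measurable U ->
  (forall g h, U1 g -> U2 h -> U (GLM g h)) ->
  (0 < mu_ i U1)%E -> (0 < mu_ j U2)%E -> (0 < mu_ (i + j)%N U)%E.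
Proof.
move=> mU1 mU2 mU U12 i0 j0; rewrite conv_power_indic//.
have mI (V : set (GL R n)) : measurable V -> measurable_fun setT (EFin \o \1_V : GL R n -> \bar R).
  by move=> mV; apply/measurable_EFinP; exact: measurable_indic.
have E g : (\int[mu_ j]_h (\1_U1 g * \1_U2 h)%:E = (\1_U1 g)%:E * mu_ j U2)%E.
  under eq_integral do rewrite EFinM.
  rewrite ge0_integralZl//; last exact: mI.
  by rewrite (integral_indicT (mu_ j) mU2).
apply: (@lt_le_trans _ _ (\int[mu_ i]_g \int[mu_ j]_h (\1_U1 g * \1_U2 h)%:E)%E).
  under eq_integral do rewrite E.
  rewrite ge0_integralZr//; last exact: mI.
  by rewrite (integral_indicT (mu_ i) mU1) mule_gt0.
apply: ge0_le_integral => //.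
- by move=> g _; apply: integral_ge0 => h _; rewrite lee_fin mulr_ge0.
- under eq_fun do rewrite E.
  by apply: emeasurable_funM; [exact: mI | exact: measurable_cst].
- apply: (@measurable_convolution_inner _ _ _ (EFin \o \1_U)) => [|g]; first exact: mI.
  by rewrite lee_fin.
- move=> g _; apply: le_integral_fin.
  + apply: measurable_funM; first exact: measurable_cst.
    exact: measurable_indic.
  + apply: (measurableT_comp _ (measurable_GLMl g)); exact: measurable_indic.
  + move=> h; rewrite mulr_ge0//=.
    have [gU1|gU1] := pselect (U1 g); last first.
      by rewrite [\1_U1 _]indicE memNset// mul0r.
    have [hU2|hU2] := pselect (U2 h); last first.
      by rewrite [\1_U2 _]indicE memNset// mulr0.
    by rewrite !indicE !mem_set ?mulr1//; exact: U12.
Qed.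

Lemma open_GL_measurable (U : set (GL R n)) : open U -> measurable U.
Proof. by move=> oU; exact: sub_sigma_algebra. Qed.

Lemma GLM_open_split (g h : GL R n) (U : set (GL R n)) : open U -> U (GLM g h) ->
  exists U1 U2 : set (GL R n), [/\ open U1, open U2, U1 g, U2 h &
    forall g' h', U1 g' -> U2 h' -> U (GLM g' h')].
Proof.
move=> oU Ugh.
have c : {for (g, h), continuous (fun z : GL R n * GL R n => GLM z.1 z.2)}.
  apply: (@continuous_comp_initial _ _ _ (@GLmx R n)
    (fun z : GL R n * GL R n => GLM z.1 z.2)).
  apply: continuous_mulmx => z.
    exact: (@continuous_comp _ _ _ fst (@GLmx R n) z (cvg_fst) (@continuous_GLmx R n z.1)).
  exact: (@continuous_comp _ _ _ snd (@GLmx R n) z (cvg_snd) (@continuous_GLmx R n z.2)).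
have /c[[V1 V2] [/= V1g V2h] V12] := open_nbhs_nbhs (conj oU Ugh).
move: V1g V2h; rewrite !nbhsE => -[U1 [oU1 U1g] UV1] [U2 [oU2 U2h] UV2].
exists U1, U2; split => // g' h' g1 h2; apply: (V12 (g', h')).
by split; [exact: UV1 | exact: UV2].
Qed.

Lemma conv_power1 (U : set (GL R n)) : measurable U -> mu_ 1 U = mu U.
Proof.
move=> mU; rewrite -(integral_indicT (mu_ 1) mU) -(integral_indicT mu mU).
have mI : measurable_fun setT (EFin \o \1_U : GL R n -> \bar R).
  by apply/measurable_EFinP; exact: measurable_indic.
rewrite [LHS](@integral_convolution _ _ mu (conv_power mu 0) (EFin \o \1_U))//.
- apply: eq_integral => g _; rewrite [LHS](@integral_conv_power0 _ _ mu (fun h => (\1_U (GLM g h))%:E)).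
    by rewrite GLM1.
  exact: (measurableT_comp mI (measurable_GLMl g)).
- by move=> g; rewrite lee_fin.
Qed.

(** The elements all of whose neighbourhoods are charged by some convolution power form a closed
    semigroup containing the support. Identities that hold almost surely for every power thereby
    reach every element of Gamma_mu, by continuity. *)
Lemma Gamma_conv_power (g : GL R n) (U : set (GL R n)) : Gamma mu g -> open U -> U g ->
  exists j, (0 < mu_ j U)%E.
Proof.
pose S := [set g : GL R n | forall U, open U -> U g -> exists j, (0 < mu_ j U)%E].
suff GS : Gamma mu `<=` S by move=> gG oU Ug; exact: (GS g gG U oU Ug).
apply: smallest_sub.
- split.
    move=> h hS V oV Vh.
    have [k [Sk Vk]] := hS V (open_nbhs_nbhs (conj oV Vh)).
    exact: Sk.
  move=> h1 h2 S1 S2 V oV Vh.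
  have [U1 [U2 [oU1 oU2 U1h U2h U12]]] := GLM_open_split oV Vh.
  have [i i0] := S1 U1 oU1 U1h; have [j j0] := S2 U2 oU2 U2h.
  exists (i + j)%N; apply: (@conv_power_open_gt0 i j U1 U2) => //; exact: open_GL_measurable.
- move=> h hs V oV Vh; exists 1%N.
  by rewrite conv_power1; [exact: hs | exact: open_GL_measurable].
Qed.

End ConvolutionPowers.

(** * Eigenfunction equations and growth of the convolution powers *)

Section PowerEigen.
Context {R : realType} {n : nat}.
Local Notation cV := 'cV[R]_n.+1.
Local Notation rV := 'rV[R]_n.+1.
Local Notation MV := 'M[R]_n.+1.

Context (mu : probability (GL R n) R) (s : R) (s0 : 0 < s).
Hypothesis moment : (\int[mu]_g (enorm (GLmx g) `^ s)%:E < +oo)%E.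
Context (nu : probability (projspace R n 0) R) (nustar : probability (projspace R 0 n) R).
Context (K : R).
Hypothesis nuE : eigenmeasure (P_ mu s) K nu.
Hypothesis nustarE : eigenmeasure (Pstar_ mu s) K nustar.
Hypothesis irr : strongly_irreducible (Gamma mu).
Local Notation mu_ := (conv_power mu).
Local Notation N := (potential nustar s).
Local Notation N' := (copotential nu s).

Lemma potential_ge0 v : 0 <= N v.
Proof. by have [] := homogeneous_potential s0 nustar. Qed.

Lemma copotential_ge0 f : 0 <= N' f.
Proof. by have [] := homogeneous_copotential s0 nu. Qed.

Lemma continuous_mulmx_potential (X : 'M[R]_n.+1) (v : cV) :
  continuous (fun A : MV => N (A *m X *m v)).
Proof.
have c : continuous (fun A : MV => A *m X *m v).
  apply: continuous_mulmx; last exact: cst_continuous.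
  by apply: continuous_mulmx => [A|]; [exact: cvg_id|exact: cst_continuous].
have [cN _ _] := homogeneous_potential s0 nustar.
by move=> A; exact: (@continuous_comp _ _ _ (fun A : MV => A *m X *m v) N A (@c A) (cN _)).
Qed.

Lemma continuous_potential_mulmx (v : cV) : continuous (fun A : MV => N (A *m v)).
Proof.
by have := @continuous_mulmx_potential 1%:M v; under eq_fun do rewrite mulmx1.
Qed.

Lemma continuous_copotential_mulmx (f : rV) : continuous (fun A : MV => N' (f *m A)).
Proof.
have c : continuous (fun A : MV => f *m A).
  by apply: continuous_mulmx => [|A]; [exact: cst_continuous|exact: cvg_id].
have [cN _ _] := homogeneous_copotential s0 nu.
by move=> A; exact: (@continuous_comp _ _ _ (fun A : MV => f *m A) N' A (@c A) (cN _)).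
Qed.

Lemma measurable_potential_GL (v : cV) :
  measurable_fun setT (fun g : GL R n => N (GLmx g *m v)).
Proof. exact: (measurable_GL_mx (@continuous_potential_mulmx v)). Qed.

Lemma measurable_copotential_GL (f : rV) :
  measurable_fun setT (fun g : GL R n => N' (f *m GLmx g)).
Proof. exact: (measurable_GL_mx (@continuous_copotential_mulmx f)). Qed.

Lemma enorm_unitmx_gt0 (g : GL R n) : 0 < enorm (GLmx g).
Proof.
rewrite enorm_gt0; apply/eqP => g0; have := GLmx_unit g.
by rewrite g0 unitmxE det0 unitr0.
Qed.

(** K N'(f) is an integral of a nonnegative function. If K were 0, then N'(f g) would vanish almost
    surely, although f g is nonzero and N' is positive there. *)
Lemma K_gt0 : 0 < K.
Proof.
have [c c0 Nc] := copotential_ge s0 moment nuE irr.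
pose f : rV := delta_mx ord0 ord0.
have f0 : f != 0.
  by apply/eqP => /matrixP/(_ ord0 ord0); rewrite !mxE !eqxx => /eqP; rewrite oner_eq0.
have Npos (w : rV) : w != 0 -> 0 < N' w.
  move=> w0; apply: lt_le_trans (Nc w).
  by rewrite mulr_gt0// powR_gt0// enorm_gt0.
have KE := copotential_eigen s0 moment nuE f.
have : (0 <= (K * N' f)%:E)%E.
  by rewrite -KE integral_ge0// => g _; rewrite lee_fin copotential_ge0.
rewrite lee_fin pmulr_lge0; last exact: Npos.
rewrite le_eqVlt => /orP[/eqP K0|//]; exfalso.
move: KE; rewrite -K0 mul0r => H.
apply: (@ae_probability_False _ _ _ mu).
have : {ae mu, forall g, N' (f *m GLmx g) = 0}.
  apply: ae_zero_integral => // [|g]; last exact: copotential_ge0.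
  exact: measurable_copotential_GL.
apply: filterS => g /eqP.
rewrite gt_eqF// Npos//.
by have := act_neq0 linear_action_adjact g f0.
Qed.

Lemma conv_power_potential j v :
  (\int[mu_ j]_g (N (GLmx g *m v))%:E = (K ^+ j * N v)%:E)%E.
Proof.
have m w : measurable_fun setT (fun g : GL R n => (N (GLmx g *m w))%:E).
  by apply/measurable_EFinP; exact: measurable_potential_GL.
have p w (g : GL R n) : (0 <= (N (GLmx g *m w))%:E)%E by rewrite lee_fin potential_ge0.
elim: j v => [|j IH] v.
  by rewrite integral_conv_power0// mul1mx expr0 mul1r.
rewrite /= (@integral_convolution _ _ _ _ (fun g => (N (GLmx g *m v))%:E))//.
rewrite (@convolution_tonelli _ _ _ _ (fun g => (N (GLmx g *m v))%:E))//.
transitivity (\int[mu_ j]_h (K%:E * (N (GLmx h *m v))%:E))%E.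
  apply: eq_integral => h _; under eq_integral do rewrite GLmxM -mulmxA.
  by rewrite [LHS](potential_eigen s0 moment nustarE) EFinM.
by rewrite ge0_integralZl ?lee_fin ?(ltW K_gt0)// IH -EFinM mulrA -exprS.
Qed.

(** The sum H(A) of N over the columns of A dominates a multiple of |A|^s, and its average over
    [mu_ j] is exactly K^j H(1). *)
Lemma conv_power_moment : exists2 C : R, 0 < C &
  forall j, (\int[mu_ j]_g (enorm (GLmx g) `^ s)%:E <= (C * K ^+ j)%:E)%E.
Proof.
have [c0 c00 N0] := potential_ge s0 moment nustarE irr.
pose H (A : MV) := \sum_(i < n.+1) N (A *m delta_mx i (ord0 : 'I_1)).
have hH : homogeneous_fun s H.
  split.
  - by apply: continuous_sumr => i; exact: continuous_potential_mulmx.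
  - move=> a v; rewrite /H mulr_sumr; apply: eq_bigr => i _.
    by have [_ NZ _] := homogeneous_potential s0 nustar; rewrite -scalemxAl NZ.
  - by move=> v; apply: sumr_ge0 => i _; exact: potential_ge0.
have [c cpos Hc] : exists2 c : R, 0 < c & forall A, c * enorm A `^ s <= H A.
  apply: homogeneous_ge => // A /eqP; rewrite /H psumr_eq0; last first.
    by move=> i _; exact: potential_ge0.
  move=> /allP HA; apply/matrixP => i j; rewrite mxE.
  have /HA /eqP NA : j \in index_enum 'I_n.+1 by rewrite mem_index_enum.
  have : A *m delta_mx j (ord0 : 'I_1) = 0.
    apply/eqP; apply: contraT => w0; have := N0 (A *m delta_mx j ord0).
    by rewrite NA leNgt mulr_gt0// powR_gt0// enorm_gt0.
  by rewrite -colE => /matrixP/(_ i ord0); rewrite !mxE.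
(* The summand 1 makes the constant visibly positive. *)
exists (c^-1 * H 1%:M + 1).
  by rewrite ltr_wpDl// mulr_ge0 ?invr_ge0 ?(ltW cpos)//; have [] := hH.
move=> j.
apply: (@le_trans _ _ (\int[mu_ j]_g (c^-1 * H (GLmx g))%:E)%E).
  apply: le_integral_fin.
  - by apply: measurable_enorm_powR; exact: mxmeasurable_GLmx.
  - apply: measurable_funM; first exact: measurable_cst.
    by apply: measurable_GL_mx; have [] := hH.
  - by move=> g; rewrite powR_ge0 mulrC ler_pdivlMr //= mulrC Hc.
under eq_integral do rewrite EFinM /H -sumEFin.
rewrite ge0_integralZl ?lee_fin ?invr_ge0 ?(ltW cpos)//; last 2 first.
- apply: emeasurable_sum => i; apply/measurable_EFinP.
  exact: measurable_potential_GL.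
- by move=> g _; apply: sume_ge0 => i _; rewrite lee_fin potential_ge0.
rewrite ge0_integral_sum//; last 2 first.
- by move=> i; apply/measurable_EFinP; exact: measurable_potential_GL.
- by move=> i g _; rewrite lee_fin potential_ge0.
under eq_bigr do rewrite conv_power_potential.
rewrite sumEFin -EFinM lee_fin -mulr_sumr mulrCA mulrC ler_wpM2r ?exprn_ge0 ?(ltW K_gt0)//.
rewrite (_ : \sum_(i < n.+1) _ = H 1%:M) ?lerDl//.
by apply: eq_bigr => i _; rewrite mul1mx.
Qed.

(** In the induction H is replaced by H(g .), which is again homogeneous of degree s. *)
Lemma conv_power_eigenmeasure j H : homogeneous_fun s H ->
  (\int[mu_ j]_g \int[nu]_x (H (GLmx g *m uvec x))%:E =
    (K ^+ j)%:E * \int[nu]_x (H (uvec x))%:E)%E.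
Proof.
have m H' : homogeneous_fun s H' -> measurable_fun setT
    (fun g : GL R n => \int[nu]_x (H' (GLmx g *m uvec x))%:E)%E.
  move=> [cH _ H0].
  apply: (measurable_fun_fubini_tonelli_F (m2 := nu)
    (fun z : GL R n * projspace R n 0 => (H' (GLmx z.1 *m uvec z.2))%:E)) => [|z]; last by rewrite lee_fin.
  apply/measurable_EFinP/measurable_continuous_mx => //.
  exact: act_measurable linear_action_lact.
elim: j H => [|j IH] H hH; have [cH HZ H0] := hH.
  rewrite integral_conv_power0; last exact: m.
  by rewrite expr0 mul1e; under eq_integral do rewrite mul1mx.
rewrite /= (@integral_convolution _ _ _ _
  (fun g => \int[nu]_x (H (GLmx g *m uvec x))%:E)%E); last 2 first.
- exact: m.
- by move=> g; apply: integral_ge0 => x _; rewrite lee_fin.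
transitivity (\int[mu]_g ((K ^+ j)%:E * \int[nu]_x (H (GLmx g *m uvec x))%:E))%E.
  apply: eq_integral => g _; under eq_integral do under eq_integral do rewrite GLmxM -mulmxA.
  apply: (IH (fun v => H (GLmx g *m v))); split.
  - have c : continuous (fun v : cV => GLmx g *m v).
      by apply: continuous_mulmx => [|v]; [exact: cst_continuous|exact: cvg_id].
    by move=> v; exact: (@continuous_comp _ _ _ (fun v : cV => GLmx g *m v) H v (@c v) (cH _)).
  - by move=> a v; rewrite -scalemxAr HZ.
  - by move=> v; exact: H0.
rewrite ge0_integralZl ?lee_fin ?exprn_ge0 ?(ltW K_gt0)//; last 2 first.
- exact: m.
- by move=> g _; apply: integral_ge0 => x _; rewrite lee_fin.
by rewrite (eigenmeasure_tonelli s0 moment linear_action_lact nuE hH) muleA -EFinM -exprSr.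
Qed.

End PowerEigen.

(** * The eigenmeasure does not charge hyperplanes *)

Section ConeCutoff.
Context {R : realType} {m k : nat}.
Local Notation V := 'M[R]_(m.+1, k.+1).
Implicit Types (p q : V -> R) (t : R).

(** The positive part of p - t q. As t grows it decreases to p where q = 0 and to 0 where q > 0: a
    continuous homogeneous approximation of p restricted to the cone q = 0. *)
Definition cone_cutoff p q t (v : V) : R := ((p v - t * q v) + `|p v - t * q v|) / 2.

Lemma cone_cutoff_ge0 p q t v : 0 <= cone_cutoff p q t v.
Proof.
rewrite /cone_cutoff divr_ge0// -[X in X + _]opprK addrC subr_ge0.
by rewrite -normrN ler_norm.
Qed.

Lemma cone_cutoff_ge p q t v : p v - t * q v <= cone_cutoff p q t v.
Proof. by rewrite /cone_cutoff; have := ler_norm (p v - t * q v); lra. Qed.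

Lemma cone_cutoff_le p q t v : 0 <= t -> 0 <= p v -> 0 <= q v ->
  cone_cutoff p q t v <= p v.
Proof.
move=> t0 p0 q0; have tq0 := mulr_ge0 t0 q0; rewrite /cone_cutoff.
by case: (lerP 0 (p v - t * q v)) => H; [rewrite ger0_norm//|rewrite ltr0_norm//]; lra.
Qed.

Lemma cone_cutoff_nonincreasing p q t t' v : t <= t' -> 0 <= q v ->
  cone_cutoff p q t' v <= cone_cutoff p q t v.
Proof.
move=> tt q0; have := ler_wpM2r q0 tt; rewrite /cone_cutoff.
by case: (lerP 0 (p v - t' * q v)) => H; [rewrite ger0_norm//|rewrite ltr0_norm//];
  have := ler_norm (p v - t * q v); have := normr_ge0 (p v - t * q v);
  case: (lerP 0 (p v - t * q v)) => H'; [rewrite ger0_norm//|rewrite ltr0_norm//|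
    rewrite ger0_norm//|rewrite ltr0_norm//]; lra.
Qed.

Lemma continuous_cone_cutoff p q t :
  continuous p -> continuous q -> continuous (cone_cutoff p q t).
Proof.
move=> cp cq.
have cb : continuous (fun v => p v - t * q v).
  move=> v; apply: (@continuousB _ _ _ p (fun v => t * q v)); first exact: cp.
  by apply: (@continuousM _ _ (fun=> t) q); [exact: cst_continuous | exact: cq].
have cr : continuous (fun t : R => (t + `|t|) / 2).
  move=> u; apply: cvgMl; apply: cvgD; first exact: cvg_id.
  by apply: cvg_norm; exact: cvg_id.
by move=> v; exact: (@continuous_comp _ _ _ _ _ v (@cb v) (@cr _)).
Qed.

Lemma homogeneous_cone_cutoff s p q t : 0 < s -> continuous p -> continuous q ->
  (forall (c : R) v, p (c *: v) = `|c| * p v) ->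
  (forall (c : R) v, q (c *: v) = `|c| * q v) ->
  homogeneous_fun s (fun v => cone_cutoff p q t v `^ s).
Proof.
move=> s0 cp cq pZ qZ; apply: homogeneous_powR_enorm => //; last exact: cone_cutoff_ge0.
  exact: continuous_cone_cutoff.
move=> c v; rewrite /cone_cutoff pZ qZ.
rewrite (_ : _ - _ = `|c| * (p v - t * q v)); last by ring.
by rewrite normrM normr_id; ring.
Qed.

End ConeCutoff.

(** A subspace is represented as the kernel of a matrix C, because its preimage under g is then the
    kernel of C g, which depends measurably on g. *)
HB.lock Definition kernel_mass (R : realType) (n : nat)
  (nu : probability (projspace R n 0) R) (s : R) (C : 'M[R]_n.+1) (f : 'rV[R]_n.+1) : R :=
  \int[nu]_x (bracket f (uvec x) `^ s * (C *m uvec x == 0)%:R).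

Section KernelMass.
Context {R : realType} {n : nat}.
Local Notation cV := 'cV[R]_n.+1.
Local Notation rV := 'rV[R]_n.+1.
Local Notation MV := 'M[R]_n.+1.

Context (mu : probability (GL R n) R) (s : R) (s0 : 0 < s).
Hypothesis moment : (\int[mu]_g (enorm (GLmx g) `^ s)%:E < +oo)%E.
Context (nu : probability (projspace R n 0) R).
Context (K : R).
Hypothesis nuE : eigenmeasure (P_ mu s) K nu.
Local Notation om := (kernel_mass nu s).

Lemma measurable_kernel d (T : measurableType d) m k (A : T -> 'M[R]_(m, k)) :
  mxmeasurable A -> measurable_fun setT (fun t => (A t == 0)%:R : R).
Proof.
move=> mA; have mE : measurable_fun setT (fun t => enorm (A t)).
  by apply: measurable_continuous_mx => //; exact: continuous_enorm.
rewrite (_ : (fun t => _) = (fun t => if enorm (A t) == 0 then 1 else 0 : R)); last first.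
  by apply/funext => t; rewrite enorm_eq0; case: (_ == _).
apply: measurable_fun_ifT; [|exact: measurable_cst|exact: measurable_cst].
by apply: measurable_fun_eqr => //; exact: measurable_cst.
Qed.

Lemma measurable_kernel_integrand d (T : measurableType d) (f : T -> rV) (C : T -> MV)
    (v : T -> cV) : mxmeasurable f -> mxmeasurable C -> mxmeasurable v ->
  measurable_fun setT (fun t => bracket (f t) (v t) `^ s * (C t *m v t == 0)%:R).
Proof.
move=> mf mC mv; apply: measurable_funM; first exact: measurable_bracket.
by apply: measurable_kernel; exact: mxmeasurable_mul.
Qed.

Lemma kernel_mass_ereal C f :
  (om C f)%:E = (\int[nu]_x (bracket f (uvec x) `^ s * (C *m uvec x == 0)%:R)%:E)%E.
Proof.
rewrite unlock; apply: EFin_Rintegral_ge0 => [y|]; first by rewrite mulr_ge0 ?powR_ge0.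
apply: (@le_lt_trans _ _ (enorm f `^ s)%:E); last exact: ltry.
apply: integral_probability_le => [|x].
  apply: measurable_kernel_integrand; last exact: mxmeasurable_uvec.
    exact: mxmeasurable_cst.
  exact: mxmeasurable_cst.
rewrite mulr_ge0 ?powR_ge0//= (@le_trans _ _ (bracket f (uvec x) `^ s))//.
  by rewrite ler_piMr ?powR_ge0// lern1 leq_b1.
rewrite le_powR_ge0 ?bracket_ge0 ?(ltW s0)//.
by rewrite (le_trans (bracket_le _ _))// enorm_uvec mulr1.
Qed.

(* Continuous homogeneous functions decreasing to |<f, .>|^s on the kernel of C. *)
Definition kernel_approx (C : MV) (f : rV) (m : nat) : cV -> R :=
  cone_cutoff (bracket f) (fun v => enorm (C *m v)) m%:R.

Lemma kernel_approx_ge0 C f m v : 0 <= kernel_approx C f m v.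
Proof. exact: cone_cutoff_ge0. Qed.

Lemma kernel_approx_le C f m v : kernel_approx C f m v <= bracket f v.
Proof. by apply: cone_cutoff_le => //; [exact: bracket_ge0 | exact: enorm_ge0]. Qed.

Lemma homogeneous_kernel_approx C f m :
  homogeneous_fun s (fun v => kernel_approx C f m v `^ s).
Proof.
apply: homogeneous_cone_cutoff => //.
- exact: continuous_bracketr.
- have c : continuous (fun v : cV => C *m v).
    by apply: continuous_mulmx => [|w]; [exact: cst_continuous | exact: cvg_id].
  by move=> v; exact: (@continuous_comp _ _ _ (fun v : cV => C *m v) enorm v (@c v) (@continuous_enorm _ _ _ _)).
- by move=> c v; exact: bracketZr.
- by move=> c v; rewrite -scalemxAr enormZ.
Qed.

Lemma kernel_approx_cvg C f v :
  kernel_approx C f m v `^ s @[m --> \oo] --> bracket f v `^ s * (C *m v == 0)%:R.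
Proof.
have [Cv|Cv] := eqVneq (C *m v) 0.
  rewrite mulr1 (_ : (fun m => _) = fun=> bracket f v `^ s); first exact: cvg_cst.
  apply/funext => m; rewrite /kernel_approx /cone_cutoff Cv enorm0 mulr0 subr0 ger0_norm ?bracket_ge0//.
  by congr (_ `^ s); lra.
rewrite mulr0; apply: cvg_near_cst; near=> m.
rewrite /kernel_approx /cone_cutoff ler0_norm ?subrr ?mul0r ?powR0 ?gt_eqF//.
rewrite subr_le0 -ler_pdivrMr ?enorm_gt0//.
by apply/ltW; near: m; exact: nbhs_infty_gtr.
Unshelve. all: by end_near. Qed.

Lemma kernel_approx_integral_cvg C f (A : MV) :
  (\int[nu]_x (kernel_approx C f m (A *m uvec x) `^ s)%:E)%E @[m --> \oo] -->
  (om (C *m A) (f *m A))%:E.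
Proof.
rewrite kernel_mass_ereal.
apply: (@dominated_cvg _ _ _ nu setT measurableT _ _
  (EFin \o (fun=> (enorm f * enorm A) `^ s))) => //.
- move=> m; apply/measurable_EFinP.
  have [c _ _] := homogeneous_kernel_approx C f m.
  apply: (measurable_continuous_mx _ c); apply: mxmeasurable_mul.
    exact: mxmeasurable_cst.
  exact: mxmeasurable_uvec.
- move=> x _; apply: cvg_EFin; first exact: nearW.
  by rewrite bracketA -mulmxA; exact: kernel_approx_cvg.
- exact: finite_measure_integrable_cst.
- move=> m x _; rewrite /= lee_fin ger0_norm ?powR_ge0// le_powR_ge0 ?(ltW s0) ?kernel_approx_ge0//.
  rewrite (le_trans (kernel_approx_le _ _ _ _))// (le_trans (bracket_le _ _))//.
  by rewrite ler_wpM2l ?enorm_ge0// (le_trans (enormM _ _))// enorm_uvec mulr1.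
Qed.

(** The restriction to a kernel is not continuous, so the eigenmeasure equation does not apply
    directly. It applies to the functions [kernel_approx], and dominated convergence is used twice,
    over nu and then over mu with the bound |f|^s |g|^s. *)
Lemma kernel_mass_eigen C f :
  (\int[mu]_g (om (C *m GLmx g) (f *m GLmx g))%:E = (K * om C f)%:E)%E.
Proof.
apply: (@cvg_unique _ _ ((fun m => \int[mu]_g \int[nu]_x
  (kernel_approx C f m (GLmx g *m uvec x) `^ s)%:E)%E @ \oo)).
- exact: ereal_hausdorff.
- have m m' : measurable_fun setT (fun g : GL R n => \int[nu]_x
      (kernel_approx C f m' (GLmx g *m uvec x) `^ s)%:E)%E.
    have [c _ H0] := homogeneous_kernel_approx C f m'.
    apply: (measurable_fun_fubini_tonelli_F (m2 := nu) (fun z : GL R n * projspace R n 0 =>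
      (kernel_approx C f m' (GLmx z.1 *m uvec z.2) `^ s)%:E)) => [|z]; last by rewrite lee_fin.
    apply/measurable_EFinP/(measurable_continuous_mx _ c).
    exact: act_measurable linear_action_lact.
  apply: (@dominated_cvg _ _ _ mu setT measurableT _ _
    (EFin \o (fun g => enorm f `^ s * enorm (GLmx g) `^ s))) => //.
  + by move=> g _; exact: kernel_approx_integral_cvg.
  + apply/integrableP; split.
      apply/measurable_EFinP; apply: measurable_funM; first exact: measurable_cst.
      by apply: measurable_enorm_powR; exact: mxmeasurable_GLmx.
    under eq_integral do rewrite /= ger0_norm ?mulr_ge0 ?powR_ge0// EFinM.
    rewrite ge0_integralZl ?lee_fin ?powR_ge0//; last 2 first.
    * by apply/measurable_EFinP; apply: measurable_enorm_powR; exact: mxmeasurable_GLmx.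
    * by move=> g _; rewrite lee_fin powR_ge0.
    by rewrite lte_mul_pinfty// lee_fin powR_ge0.
  + move=> m' g _; rewrite gee0_abs; last by apply: integral_ge0 => x _; rewrite lee_fin powR_ge0.
    apply: integral_probability_le => [|x].
      have [c _ _] := homogeneous_kernel_approx C f m'.
      apply: (measurable_continuous_mx _ c); apply: mxmeasurable_mul.
        exact: mxmeasurable_cst.
      exact: mxmeasurable_uvec.
    rewrite powR_ge0/= -powRM ?enorm_ge0//.
    rewrite le_powR_ge0 ?(ltW s0) ?kernel_approx_ge0//.
    rewrite (le_trans (kernel_approx_le _ _ _ _))// (le_trans (bracket_le _ _))//.
    by rewrite ler_wpM2l ?enorm_ge0// (le_trans (enormM _ _))// enorm_uvec mulr1.
- have E m : (\int[mu]_g \int[nu]_x (kernel_approx C f m (GLmx g *m uvec x) `^ s)%:E =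
      K%:E * \int[nu]_x (kernel_approx C f m (1%:M *m uvec x) `^ s)%:E)%E.
    have := eigenmeasure_tonelli s0 moment linear_action_lact nuE (homogeneous_kernel_approx C f m).
    by move=> ->; under [in RHS]eq_integral do rewrite mul1mx.
  rewrite /= (_ : (fun m => _) = (fun m => K%:E *
      \int[nu]_x (kernel_approx C f m (1%:M *m uvec x) `^ s)%:E)%E); last first.
    by apply/funext => m; exact: E.
  rewrite EFinM -[C in om C f]mulmx1 -[f in om _ f]mulmx1.
  by apply: cvgeZl => //; exact: kernel_approx_integral_cvg.
Qed.

End KernelMass.

HB.lock Definition subspace_mass (R : realType) (n : nat)
  (nu : probability (projspace R n 0) R) (s : R) (W : {vspace 'cV[R]_n.+1})
  (f : 'rV[R]_n.+1) : R :=
  \int[nu]_x (bracket f (uvec x) `^ s * (uvec x \in W)%:R).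

Section NullSubspaces.
Context {R : realType} {n : nat}.
Local Notation cV := 'cV[R]_n.+1.
Local Notation rV := 'rV[R]_n.+1.
Local Notation MV := 'M[R]_n.+1.
Local Notation VS := {vspace cV}.

(** C is the matrix of the identity minus a projection onto W. *)
Lemma vspace_kernel (W : VS) : exists C : MV, forall v : cV, (C *m v == 0) = (v \in W).
Proof.
pose C : MV := \matrix_(i, j) (delta_mx j 0 - projv W (delta_mx j (0 : 'I_1))) i 0.
exists C => v.
have -> : C *m v = v - projv W v.
  have E : v = \sum_j v j 0 *: delta_mx j (0 : 'I_1).
    rewrite {1}(matrix_sum_delta v); apply: eq_bigr => j _.
    by rewrite big_ord1.
  rewrite {2 3}E linear_sum /= -sumrB; apply/colP => i; rewrite mxE summxE.
  apply: eq_bigr => j _; rewrite linearZ /= -scalerBr mulrC.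
  by rewrite [RHS]mxE; congr (_ * _); rewrite mxE.
apply/eqP/idP => [/eqP|vW]; last by rewrite projv_id// subrr.
by rewrite subr_eq0 => /eqP ->; exact: memv_proj.
Qed.

Definition preim_GL (g : GL R n) (W : VS) : VS :=
  (linfun (mulmx (invmx (GLmx g)) : cV -> cV) @: W)%VS.

Lemma mem_preim_GL g W v : (v \in preim_GL g W) = (GLmx g *m v \in W).
Proof.
apply/memv_imgP/idP => [[w wW ->]|gvW].
  by rewrite lfunE /= mulKVmx// GLmx_unit.
by exists (GLmx g *m v) => //; rewrite lfunE /= mulKmx// GLmx_unit.
Qed.

Lemma dim_preim_GL g W : \dim (preim_GL g W) = \dim W.
Proof.
apply: limg_dim_eq; apply/eqP; rewrite -subv0; apply/subvP => w.
rewrite memv_cap memv_ker lfunE /= memv0 => /andP[_ /eqP w0].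
by rewrite -(mulKVmx (GLmx_unit g) w) w0 mulmx0.
Qed.

Lemma sub_preim_GL g (V W : VS) : \dim V = \dim W ->
  (forall v, v \in V -> GLmx g *m v \in W) -> V = preim_GL g W.
Proof.
move=> VW gVW; apply/eqP; rewrite eqEdim dim_preim_GL VW leqnn andbT.
by apply/subvP => v vV; rewrite mem_preim_GL gVW.
Qed.

Context (mu : probability (GL R n) R) (s : R) (s0 : 0 < s).
Hypothesis moment : (\int[mu]_g (enorm (GLmx g) `^ s)%:E < +oo)%E.
Context (nu : probability (projspace R n 0) R).
Context (K : R).
Hypothesis nuE : eigenmeasure (P_ mu s) K nu.
Hypothesis irr : strongly_irreducible (Gamma mu).

Definition trace_set (W : VS) : set (projspace R n 0) := [set x | uvec x \in W].
Local Notation A := trace_set.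

Lemma measurable_trace_set W : measurable (A W).
Proof.
have [C CW] := vspace_kernel W.
have mC : measurable_fun setT (fun x : projspace R n 0 => (C *m uvec x == 0)%:R : R).
  apply: measurable_kernel; apply: mxmeasurable_mul; first exact: mxmeasurable_cst.
  exact: mxmeasurable_uvec.
have := mC measurableT [set 1] (measurable_set1 _); rewrite setTI.
congr measurable; apply/seteqP; split => x /=; rewrite CW /A/=.
  by case: (_ \in _) => // /eqP; rewrite eq_sym oner_eq0.
by move=> ->.
Qed.

Lemma trace_setI W V : A W `&` A V = A (W :&: V)%VS.
Proof. by apply/seteqP; split => x; rewrite /A /= memv_cap => /andP. Qed.

Local Notation om := (subspace_mass nu s).

Lemma subspace_mass_kernel (C : MV) (W : VS) (f : rV) : (forall v, (C *m v == 0) = (v \in W)) ->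
  om W f = kernel_mass nu s C f.
Proof. by move=> CW; rewrite !unlock; apply: eq_Rintegral => x _; rewrite CW. Qed.

Lemma subspace_mass_ereal W f :
  (om W f)%:E = (\int[nu]_x (bracket f (uvec x) `^ s * (uvec x \in W)%:R)%:E)%E.
Proof.
have [C CW] := vspace_kernel W.
rewrite (subspace_mass_kernel _ CW) kernel_mass_ereal//.
by apply: eq_integral => x _; rewrite CW.
Qed.

Lemma subspace_mass_eigen W f :
  (\int[mu]_g (om (preim_GL g W) (f *m GLmx g))%:E = (K * om W f)%:E)%E.
Proof.
have [C CW] := vspace_kernel W; rewrite (subspace_mass_kernel _ CW).
rewrite -(kernel_mass_eigen s0 moment nuE); apply: eq_integral => g _.
congr EFin; apply: subspace_mass_kernel => v.
by rewrite -mulmxA CW mem_preim_GL.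
Qed.

Lemma subspace_mass_ge0 W f : 0 <= om W f.
Proof. by rewrite unlock; apply: Rintegral_ge0 => x _; rewrite mulr_ge0 ?powR_ge0. Qed.

Lemma measurable_mem_uvec (W : VS) : measurable_fun setT
  (fun x : projspace R n 0 => (uvec x \in W)%:R : R).
Proof.
have [C CW] := vspace_kernel W; under eq_fun do rewrite -CW.
apply: measurable_kernel; apply: mxmeasurable_mul; first exact: mxmeasurable_cst.
exact: mxmeasurable_uvec.
Qed.

Lemma measurable_subspace_integrand (W : VS) (f : rV) : measurable_fun setT
  (fun x : projspace R n 0 => bracket f (uvec x) `^ s * (uvec x \in W)%:R).
Proof.
apply: measurable_funM; last exact: measurable_mem_uvec.
by apply: measurable_bracket; [exact: mxmeasurable_cst | exact: mxmeasurable_uvec].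
Qed.

Lemma subspace_mass_le_measure W f : ((om W f)%:E <= (enorm f `^ s)%:E * nu (A W))%E.
Proof.
rewrite subspace_mass_ereal -(integral_indicT nu (measurable_trace_set W)).
rewrite -ge0_integralZl ?lee_fin ?powR_ge0//; last first.
  by apply/measurable_EFinP; apply: measurable_indic; exact: measurable_trace_set.
apply: (@le_integral_fin _ _ _ nu _ (fun x => enorm f `^ s * \1_(A W) x)).
- exact: measurable_subspace_integrand.
- apply: measurable_funM; first exact: measurable_cst.
  by apply: measurable_indic; exact: measurable_trace_set.
- move=> x; rewrite mulr_ge0 ?powR_ge0//=.
  rewrite indicE (_ : (x \in A W) = (uvec x \in W)); last by apply/idP/idP; rewrite inE.
  rewrite ler_wpM2r// le_powR_ge0 ?(ltW s0) ?bracket_ge0//.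
  by rewrite (le_trans (bracket_le _ _))// enorm_uvec mulr1.
Qed.

Lemma homogeneous_subspace_mass W : homogeneous_fun s (om W).
Proof.
split.
- rewrite unlock; apply: continuous_param_integral => [f|x|M].
  + exact: measurable_subspace_integrand.
  + have [c _ _] := @homogeneous_powR_enorm R s 0 n (bracket ^~ (uvec x)) s0
      (@continuous_bracketl _ _ (uvec x)) (fun c f => bracketZl c f (uvec x))
      (fun f => bracket_ge0 f (uvec x)).
    have cm : continuous (fun t : R => t * (uvec x \in W)%:R).
      by move=> t; apply: cvgMl; exact: cvg_id.
    by move=> f; exact: (@continuous_comp _ _ _ _ _ f (@c f) (@cm _)).
  + exists (fun=> `|M| `^ s); first exact: finite_measure_integrable_cst.
    move=> f x fM; rewrite ger0_norm ?mulr_ge0 ?powR_ge0//.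
    apply: (@le_trans _ _ (bracket f (uvec x) `^ s)).
      by rewrite ler_piMr ?powR_ge0//; case: (_ \in _).
    rewrite le_powR_ge0 ?bracket_ge0 ?(ltW s0)//.
    rewrite (le_trans (bracket_le _ _))// enorm_uvec mulr1 (le_trans fM)//.
    exact: ler_norm.
- move=> c f; apply: EFin_inj; rewrite EFinM !subspace_mass_ereal.
  rewrite -ge0_integralZl ?lee_fin ?powR_ge0//; last 2 first.
  + by apply/measurable_EFinP; exact: measurable_subspace_integrand.
  + by move=> x _; rewrite lee_fin mulr_ge0 ?powR_ge0.
  apply: eq_integral => x _.
  by rewrite bracketZl powRM ?bracket_ge0// -EFinM mulrA.
- exact: subspace_mass_ge0.
Qed.

End NullSubspaces.

Lemma homogeneous0 {R : realType} {m k : nat} (s : R) (H : 'M[R]_(m.+1, k.+1) -> R) :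
  0 < s -> homogeneous_fun s H -> H 0 = 0.
Proof.
move=> s0 [_ HZ _]; have := HZ 0 0.
by rewrite scale0r normr0 powR0 ?gt_eqF// mul0r.
Qed.

Section NullHyperplanes.
Context {R : realType} {n : nat}.
Local Notation cV := 'cV[R]_n.+1.
Local Notation rV := 'rV[R]_n.+1.
Local Notation VS := {vspace cV}.
Context (mu : probability (GL R n) R) (s : R) (s0 : 0 < s).
Hypothesis moment : (\int[mu]_g (enorm (GLmx g) `^ s)%:E < +oo)%E.
Context (nu : probability (projspace R n 0) R).
Context (K : R).
Hypothesis nuE : eigenmeasure (P_ mu s) K nu.
Hypothesis irr : strongly_irreducible (Gamma mu).
Local Notation N' := (copotential nu s).
Local Notation om := (subspace_mass nu s).
Local Notation A := (@trace_set R n).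

Section MinimalDimension.
Variable j : nat.
Hypothesis jnull : forall W : VS, (\dim W < j)%N -> nu (A W) = 0%E.

Lemma trace_set_null_bigU (W : VS) (Ws : seq VS) : \dim W = j -> W \notin Ws ->
  all (fun V => \dim V == j) Ws ->
  nu (A W `&` \big[setU/set0]_(V <- Ws) A V) = 0%E.
Proof.
move=> Wj; elim: Ws => [|V Ws IH]; first by rewrite big_nil setI0 measure0.
rewrite inE negb_or => /andP[WV WWs] /= /andP[/eqP Vj Wsj].
rewrite big_cons setIUr; apply/eqP; rewrite -measure_le0.
have mU : measurable (\big[setU/set0]_(V <- Ws) A V).
  by apply: bigsetU_measurable => U _; exact: measurable_trace_set.
apply: (le_trans (measureU2 _ _ _)).
- by apply: measurableI; exact: measurable_trace_set.
- by apply: measurableI => //; exact: measurable_trace_set.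
have IH0 : nu (A W `&` \big[setU/set0]_(V <- Ws) A V) = 0%E by exact: IH.
have WV0 : nu (A W `&` A V) = 0%E.
  rewrite trace_setI; apply: jnull; rewrite ltn_neqAle -Wj dimvS ?capvSl// andbT.
  apply: contra WV => /eqP dimE.
  have /eqP E : (W :&: V == W)%VS by rewrite eqEdim capvSl dimE leqnn.
  by rewrite eqEdim -E capvSr E Vj Wj leqnn.
have -> : (nu (A W `&` A V) + nu (A W `&` \big[setU/set0]_(V <- Ws) A V) = 0)%E.
  by rewrite [X in (X + _)%E]WV0 [X in (_ + X)%E]IH0 adde0.
by [].
Qed.

Lemma sum_trace_mass_le1 (Ws : seq VS) : uniq Ws -> all (fun V => \dim V == j) Ws ->
  (\sum_(W <- Ws) nu (A W) <= 1)%E.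
Proof.
move=> uWs jWs; apply: (@le_trans _ _ (nu (\big[setU/set0]_(V <- Ws) A V))); last first.
  by apply: probability_le1; apply: bigsetU_measurable => U _; exact: measurable_trace_set.
elim: Ws uWs jWs => [|W Ws IH]; first by rewrite !big_nil.
move=> /= /andP[WWs uWs] /andP[/eqP Wj Wsj]; rewrite !big_cons.
have mU : measurable (\big[setU/set0]_(V <- Ws) A V).
  by apply: bigsetU_measurable => U _; exact: measurable_trace_set.
have -> : A W `|` \big[setU/set0]_(V <- Ws) A V =
    (A W `\` \big[setU/set0]_(V <- Ws) A V) `|` \big[setU/set0]_(V <- Ws) A V.
  by rewrite setDE setUIl [X in _ `&` X]setUC setUCr setIT.
rewrite measureU; last 3 first.
- by apply: measurableD => //; exact: measurable_trace_set.
- by [].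
- by rewrite setDE -setIA setICl setI0.
apply: leeD; last exact: IH.
rewrite (measureDI nu (measurable_trace_set W) mU).
rewrite [X in (_ + X)%E](trace_set_null_bigU Wj WWs Wsj).
by rewrite adde0.
Qed.

(* In minimal charged dimension, distinct subspaces meet in a null set. *)
Lemma finite_heavy_subspaces (t : R) : 0 < t ->
  finite_set [set W : VS | \dim W = j /\ (t%:E <= nu (A W))%E].
Proof.
move=> t0; apply: contrapT.
have HN : t^-1 < (Num.bound t^-1)%:R by apply: archi_boundP; rewrite invr_ge0 ltW.
move=> /(infinite_set_fset (Num.bound t^-1))[B BF].
rewrite -[(_ <= _)%N]negbK -ltnNge; apply/negP; rewrite negbK.
have jB : all (fun V => \dim V == j) (finmap.enum_fset B).
  by apply/allP => V /BF[-> _].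
have := sum_trace_mass_le1 (finmap.fset_uniq B) jB; apply: contraTT.
rewrite -leqNgt -ltNge => Bsize.
apply: (@lt_le_trans _ _ (\sum_(W <- finmap.enum_fset B) t%:E)%E).
  rewrite sumEFin lte_fin big_const_seq count_predT iter_addr_0.
  rewrite -[t *+ _]mulr_natl -ltr_pdivrMr//.
  by rewrite div1r; apply: (lt_le_trans HN); rewrite ler_nat.
by rewrite big_seq [leRHS]big_seq; apply: lee_sum => W /BF[].
Qed.

Lemma subspace_mass_eq0 (W : VS) : (forall f, om W f = 0) -> nu (A W) = 0%E.
Proof.
move=> W0.
have H : {ae nu, forall x, forall i : 'I_n.+1,
    bracket (delta_mx ord0 i) (uvec x) `^ s * (uvec x \in W)%:R = 0}.
  apply: filter_forall => i; apply: ae_zero_integral => [|x|].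
  - exact: measurable_subspace_integrand.
  - by rewrite mulr_ge0 ?powR_ge0.
  - by rewrite -subspace_mass_ereal// W0.
have {}H : {ae nu, forall x, ~ A W x}.
  apply: filterS H => x Hx xW.
  have : uvec x = 0.
    apply/colP => i; rewrite mxE; have /eqP := Hx i.
    rewrite (_ : uvec x \in W)// mulr1 powR_eq0 => /andP[+ _].
    by rewrite enorm_eq0 => /eqP/matrixP/(_ ord0 ord0); rewrite -rowE !mxE.
  by move=> x0; have := enorm_uvec x; rewrite x0 enorm0 => /esym/eqP; rewrite oner_eq0.
case: H => B [mB B0 WB]; apply/eqP; rewrite -measure_le0 -B0.
apply: le_measure; rewrite ?inE//; first exact: measurable_trace_set.
by move=> x Wx; apply: WB => /=; apply.
Qed.

Lemma seq_argmax (T : eqType) (r : T -> R) (l : seq T) (x : T) : x \in l ->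
  exists2 y, y \in l & forall z, z \in l -> r z <= r y.
Proof.
elim: l x => // y l IH x _; case: l IH => [_|z l IH].
  by exists y => [|z]; rewrite inE// => /eqP ->.
have [w wl wmax] := IH z (mem_head _ _).
have [yw|/ltW wy] := leP (r y) (r w).
  exists w => [|u]; first by rewrite inE wl orbT.
  by rewrite inE => /orP[/eqP ->//|]; exact: wmax.
exists y => [|u]; first exact: mem_head.
by rewrite inE => /orP[/eqP ->//|/wmax/le_trans]; exact.
Qed.

Lemma copotential_gt0 (f : rV) : f != 0 -> 0 < N' f.
Proof.
move=> f0; have [c c0 Nc] := copotential_ge s0 moment nuE irr.
by apply: lt_le_trans (Nc f); rewrite mulr_gt0// powR_gt0// enorm_gt0.
Qed.

(** The quotient is continuous off 0 and of degree 0, so its maximum on the compact unit sphere is a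
    global one. *)
Lemma subspace_ratio_max (W : VS) : exists2 g : rV, g != 0 &
  forall f, f != 0 -> om W f / N' f <= om W g / N' g.
Proof.
have [cN NZ N0] := homogeneous_copotential s0 nu.
have [co oZ o0] := homogeneous_subspace_mass s0 nu W.
have cr (f : rV) : f != 0 -> {for f, continuous (fun f => om W f / N' f)}.
  move=> f0; apply: continuousM; first exact: co.
  apply: continuousV; last exact: cN.
  by rewrite gt_eqF// copotential_gt0.
have c : {within [set f : rV | enorm f = 1], continuous (fun f => om W f / N' f)}.
  apply: continuous_in_subspaceT => f; rewrite inE /= => f1.
  by apply: cr; rewrite -enorm_gt0 f1.
have [g /set_mem/= g1 gmax] := compact_EVT_max (@enorm_sphere_neq0 R 0 n)
  (@compact_sphere R 1 n.+1) c.
exists g; first by rewrite -enorm_gt0 g1.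
move=> f f0.
have := gmax ((enorm f)^-1 *: f).
rewrite inE /= enormZ normfV ger0_norm ?enorm_ge0// mulVf ?enorm_eq0// => /(_ erefl).
rewrite oZ NZ; set e := _ `^ s.
have e0 : e != 0 by rewrite powR_eq0 negb_and normr_eq0 invr_eq0 enorm_eq0 f0.
by rewrite invfM mulrACA divff// mul1r.
Qed.

Variable W1 : VS.
Hypotheses (W1j : \dim W1 = j) (W1pos : nu (A W1) != 0%E).

(** The quotient of [om W f] by [N' f] attains a positive maximum over all f and all W of dimension
    j. For a single W this is compactness; and only finitely many W compete, since a quotient at
    least a1 forces nu to give W a mass at least c a1. *)
Lemma subspace_mass_max : exists W0 f0 a, [/\ \dim W0 = j, f0 != 0, 0 < a,
  om W0 f0 = a * N' f0 & forall W f, \dim W = j -> om W f <= a * N' f].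
Proof.
have [c c0 Nc] := copotential_ge s0 moment nuE irr.
have [f1 f1W] : exists f, om W1 f != 0.
  apply: contrapT => /forallNP H; case/eqP: W1pos; apply: subspace_mass_eq0 => f.
  by apply/eqP; apply: contraT => /H.
have [_ oZ o0] := homogeneous_subspace_mass s0 nu W1.
have f10 : f1 != 0.
  apply: contra f1W => /eqP ->.
  by rewrite (homogeneous0 s0 (homogeneous_subspace_mass s0 nu W1)).
pose a1 := om W1 f1 / N' f1.
have a10 : 0 < a1 by rewrite divr_gt0 ?copotential_gt0// lt_neqAle eq_sym f1W o0.
have [L HL] := (finite_seqP _).1 (finite_heavy_subspaces (mulr_gt0 c0 a10)).
(* The mass of W times |f|^s bounds [om W f], which is at least a1 N'(f), hence at least a1 c
   |f|^s. *)
have heavy W f : \dim W = j -> f != 0 -> a1 <= om W f / N' f -> W \in L.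
  move=> Wj f0 aW; suff : [set` L] W by []. 
  rewrite -HL /=; split => //.
  have ef : 0 < enorm f `^ s by rewrite powR_gt0// enorm_gt0.
  have : ((c * a1 * enorm f `^ s)%:E <= (enorm f `^ s)%:E * nu (A W))%E.
    apply: le_trans (subspace_mass_le_measure s0 nu W f); rewrite lee_fin.
    rewrite (le_trans (y := a1 * N' f))//; last by rewrite -ler_pdivlMr ?copotential_gt0.
    by have := ler_wpM2l (ltW a10) (Nc f); rewrite mulrA [a1 * c]mulrC.
  rewrite EFinM muleC lee_pmul2l// ?lte_fin//.
have [rep Hrep] : exists rep : VS -> rV, forall W, rep W != 0 /\
    forall f, f != 0 -> om W f / N' f <= om W (rep W) / N' (rep W).
  have /choice[rep Hrep] : forall W, exists g : rV, g != 0 /\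
      forall f, f != 0 -> om W f / N' f <= om W g / N' g.
    by move=> W; have [g g0 gmax] := subspace_ratio_max W; exists g.
  by exists rep.
have W1L : W1 \in L by apply: (heavy W1 f1).
have [W0 W0L W0max] := seq_argmax (fun W => om W (rep W) / N' (rep W)) W1L.
have W0j : \dim W0 = j by have : [set` L] W0 by []; rewrite -HL => -[].
have a1le : a1 <= om W0 (rep W0) / N' (rep W0).
  by apply: le_trans (W0max _ W1L); have [_] := Hrep W1; exact.
exists W0, (rep W0), (om W0 (rep W0) / N' (rep W0)); split => //.
- by have [] := Hrep W0.
- exact: lt_le_trans a1le.
- by rewrite divfK// gt_eqF// copotential_gt0//; have [] := Hrep W0.
- move=> W f Wj; have [->|f0] := eqVneq f 0.
    rewrite (homogeneous0 s0 (homogeneous_subspace_mass s0 nu W)).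
    by rewrite (homogeneous0 s0 (homogeneous_copotential s0 nu)) mulr0.
  rewrite -ler_pdivrMr ?copotential_gt0//.
  have [aW|/ltW Wa] := leP a1 (om W f / N' f); last exact: le_trans a1le.
  apply: le_trans (W0max _ (heavy _ _ Wj f0 aW)); by have [_] := Hrep W; exact.
Qed.

End MinimalDimension.

End NullHyperplanes.

Section NullHyperplane.
Context {R : realType} {n : nat}.
Local Notation cV := 'cV[R]_n.+1.
Local Notation rV := 'rV[R]_n.+1.
Local Notation MV := 'M[R]_n.+1.
Local Notation VS := {vspace cV}.
Context (mu : probability (GL R n) R) (s : R) (s0 : 0 < s).
Hypothesis moment : (\int[mu]_g (enorm (GLmx g) `^ s)%:E < +oo)%E.
Context (nu : probability (projspace R n 0) R).
Context (K : R).
Hypothesis nuE : eigenmeasure (P_ mu s) K nu.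
Hypothesis irr : strongly_irreducible (Gamma mu).
Local Notation N' := (copotential nu s).
Local Notation om := (subspace_mass nu s).
Local Notation A := (@trace_set R n).

Lemma closed_vspace_action (v : cV) (W : VS) : closed [set g : GL R n | GLmx g *m v \in W].
Proof.
have [C CW] := vspace_kernel W.
rewrite (_ : [set g | _] = [set g | (fun M : MV => enorm (C *m (M *m v))) (GLmx g) = 0]).
  apply: (@closed_GL_zero _ _ (fun M : MV => enorm (C *m (M *m v)))).
  have c : continuous (fun M : MV => C *m (M *m v)).
    apply: continuous_mulmx; first exact: cst_continuous.
    by apply: continuous_mulmx => [M|]; [exact: cvg_id|exact: cst_continuous].
  by move=> M; exact: (@continuous_comp _ _ _ _ _ M (@c M) (@continuous_enorm _ _ _ _)).
apply/seteqP; split => g /=; rewrite -CW.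
  by move/eqP => ->; rewrite enorm0.
by move/eqP; rewrite enorm_eq0.
Qed.

(** The elements g such that each W in L contains g V for some V in L form a closed semigroup of
    full measure, so all of Gamma_mu has this property. Equal dimensions give V = g^-1 W. Hence g^-1
    permutes L, so does g, and the union of L contradicts strong irreducibility. *)
Lemma finite_orbit_contradiction (L : seq VS) : L != [::] ->
  (forall W, W \in L -> W != 0%VS /\ W != fullv) ->
  (forall V W, V \in L -> W \in L -> \dim V = \dim W) ->
  (forall W, W \in L -> {ae mu, forall g, preim_GL g W \in L}) -> False.
Proof.
move=> L0 Lproper Ldim Lae.
pose S := [set g : GL R n | forall W, W \in L ->
  exists2 V, V \in L & forall v, v \in V -> GLmx g *m v \in W].
have GS : Gamma mu `<=` S.
  apply: Gamma_sub.
  - rewrite (_ : S = \bigcap_(W in [set` L]) \bigcup_(V in [set` L])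
        \bigcap_(v in [set v | v \in V]) [set g : GL R n | GLmx g *m v \in W]); last first.
      apply/seteqP; split => g Hg W WL.
        by have [V VL HV] := Hg W WL; exists V.
      by have [V VL HV] := Hg W WL; exists V.
    apply: closed_bigI => W _; apply: closed_bigcup; first exact: finite_seq.
    by move=> V _; apply: closed_bigI => v _; exact: closed_vspace_action.
  - move=> g h Sg Sh W WL; have [V VL HV] := Sg W WL; have [U UL HU] := Sh V VL.
    by exists U => // v vU; rewrite GLmxM -mulmxA; apply: HV; exact: HU.
  - have H : {ae mu, forall g, forall i : 'I_(size L), preim_GL g (nth 0%VS L i) \in L}.
      by apply: filter_forall => i; apply: Lae; exact: mem_nth.
    apply: filterS H => g Hg W WL.
    have iW : (index W L < size L)%N by rewrite index_mem.
    exists (preim_GL g W) => [|v]; last by rewrite mem_preim_GL.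
    by have := Hg (Ordinal iW); rewrite /= nth_index.
apply: (irr L0 Lproper) => g v gG [V0 V0L vV0].
have preL W : W \in L -> preim_GL g W \in L.
  move=> WL; have [V VL HV] := GS g gG W WL.
  by rewrite -(sub_preim_GL (Ldim _ _ VL WL) HV).
have inj : injective (preim_GL g).
  move=> W W' E; apply/vspaceP => w.
  by rewrite -(mulKVmx (GLmx_unit g) w) -!mem_preim_GL E.
(* An injective map of a finite set to itself is onto; [undup] removes the repetitions of L. *)
have [W WL WV0] : exists2 W, W \in L & preim_GL g W = V0.
  have u : uniq (map (preim_GL g) (undup L)) by rewrite map_inj_uniq ?undup_uniq.
  have sub : {subset map (preim_GL g) (undup L) <= undup L}.
    by move=> V /mapP[W]; rewrite mem_undup => WL ->; rewrite mem_undup; exact: preL.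
  have [|_ E] := uniq_min_size u sub; first by rewrite size_map.
  have : V0 \in undup L by rewrite mem_undup.
  by rewrite -E => /mapP[W]; rewrite mem_undup => WL ->; exists W.
by exists W => //; rewrite -mem_preim_GL WV0.
Qed.

Lemma measurable_subspace_mass_preim (V : VS) (f : rV) :
  measurable_fun setT (fun g => om (preim_GL g V) (f *m GLmx g)).
Proof.
have [C CV] := vspace_kernel V.
apply/measurable_EFinP.
rewrite (_ : EFin \o _ = (fun g => \int[nu]_x (bracket (f *m GLmx g) (uvec x) `^ s *
    (C *m GLmx g *m uvec x == 0)%:R)%:E)%E); last first.
  apply/funext => g /=; rewrite subspace_mass_ereal//.
  by apply: eq_integral => x _; rewrite -mulmxA CV mem_preim_GL.
apply: (measurable_fun_fubini_tonelli_F (m2 := nu) (fun z : GL R n * projspace R n 0 =>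
  (bracket (f *m GLmx z.1) (uvec z.2) `^ s * (C *m GLmx z.1 *m uvec z.2 == 0)%:R)%:E)).
  have mg : mxmeasurable (fun z : GL R n * projspace R n 0 => GLmx z.1).
    exact: (mxmeasurable_comp measurable_fst mxmeasurable_GLmx).
  apply/measurable_EFinP; apply: measurable_kernel_integrand.
  - by apply: mxmeasurable_mul => //; exact: mxmeasurable_cst.
  - by apply: mxmeasurable_mul => //; exact: mxmeasurable_cst.
  - exact: (mxmeasurable_comp measurable_snd mxmeasurable_uvec).
by move=> z; rewrite lee_fin mulr_ge0 ?powR_ge0.
Qed.

Lemma integral_sub_eq0 d (T : measurableType d) (m : {measure set T -> \bar R})
    (h1 h2 : T -> R) (t : R) :
  measurable_fun setT h1 -> measurable_fun setT h2 -> (forall x, 0 <= h2 x <= h1 x) ->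
  (\int[m]_x (h1 x)%:E = t%:E)%E -> (\int[m]_x (h2 x)%:E = t%:E)%E ->
  (\int[m]_x (h1 x - h2 x)%:E = 0)%E.
Proof.
move=> m1 m2 h12 i1 i2.
have : (\int[m]_x (h1 x - h2 x)%:E + t%:E = t%:E)%E.
  rewrite -[X in (_ + X)%E]i2 -ge0_integralD//.
  - by rewrite -[RHS]i1; apply: eq_integral => x _; rewrite -EFinD subrK.
  - by move=> x _; rewrite lee_fin subr_ge0; have /andP[] := h12 x.
  - by apply/measurable_EFinP; exact: measurable_funB.
  - by move=> x _; rewrite lee_fin; have /andP[] := h12 x.
  - exact/measurable_EFinP.
move=> /eqP; rewrite addeC.
by case: (\int[m]_x _)%E => //= r; rewrite -EFinD eqe addrC -subr_eq0 addrK => /eqP ->.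
Qed.

(** A maximum principle. In the minimal charged dimension let [om V f = a * N' f] attain the maximal
    quotient a. Both sides are multiplied by K when averaged along (g^-1 V, f g), and the right side
    dominates for every g, so equality holds for almost every g. The maximal subspaces are thus
    finitely many and almost surely stable under g^-1, which [finite_orbit_contradiction]
    excludes. *)
Lemma null_subspace (W : VS) : W != fullv -> nu (A W) = 0%E.
Proof.
move=> Wfull; apply/eqP; apply: contraT => Wpos.
pose P k := `[< exists V : VS, \dim V = k /\ nu (A V) != 0%E >].
have P0 : exists k, P k by exists (\dim W); apply/asboolP; exists W.
case: (ex_minnP P0) => j /asboolP[W1 [W1j W1pos]] jmin.
have jnull V : (\dim V < j)%N -> nu (A V) = 0%E.
  move=> Vj; apply/eqP; apply: contraTT Vj => V0; rewrite -leqNgt.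
  by apply: jmin; apply/asboolP; exists V.
have jlt : (j < n.+1)%N.
  apply: (@leq_ltn_trans (\dim W)); first by apply: jmin; apply/asboolP; exists W.
  have dimf : \dim (fullv : VS) = n.+1 by rewrite dimvf /dim /= muln1.
  rewrite -[X in (_ < X)%N]dimf ltn_neqAle dimvS ?subvf// andbT.
  by apply: contra Wfull => /eqP E; rewrite eqEdim subvf E leqnn.
have [W0 [f0 [a [W0j f00 a0 W0E amax]]]] :=
  subspace_mass_max s0 moment nuE irr jnull W1j W1pos.
have [c c0 Nc] := copotential_ge s0 moment nuE irr.
(* The form is quantified existentially because it changes from f to f g along with V. *)
pose O := [set V : VS | \dim V = j /\ exists2 f, f != 0 & om V f = a * N' f].
have Ofin : finite_set O.
  apply: (sub_finite_set _ (finite_heavy_subspaces jnull (mulr_gt0 a0 c0))).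
  move=> V [Vj [f fn0 VE]]; split => //.
  have ef : 0 < enorm f `^ s by rewrite powR_gt0// enorm_gt0.
  have : ((a * c * enorm f `^ s)%:E <= (enorm f `^ s)%:E * nu (A V))%E.
    apply: le_trans (subspace_mass_le_measure s0 nu V f).
    by rewrite lee_fin VE -mulrA ler_wpM2l// ltW.
  by rewrite EFinM muleC lee_pmul2l// ?lte_fin.
have [L OL] := (finite_seqP _).1 Ofin.
have memL V : V \in L <-> O V by rewrite OL.
exfalso; apply: (@finite_orbit_contradiction L).
- apply/eqP => L0; have : W0 \in L by apply/memL; split => //; exists f0.
  by rewrite L0.
- move=> V /memL[Vj [f fn0 VE]]; split.
    apply/eqP => V0; have : 0 < om V f.
      rewrite VE mulr_gt0// (lt_le_trans _ (Nc f))// mulr_gt0// powR_gt0// enorm_gt0//.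
    suff -> : om V f = 0 by rewrite ltxx.
    apply/le_anti; rewrite subspace_mass_ge0 andbT -lee_fin.
    apply: le_trans (subspace_mass_le_measure s0 nu V f) _.
    have -> : A V = set0.
      apply/seteqP; split => // x; rewrite /trace_set /= V0 memv0 => /eqP x0.
      by have := enorm_uvec x; rewrite x0 enorm0 => /esym/eqP; rewrite oner_eq0.
    by rewrite measure0 mule0.
  apply/eqP => Vf; move: Vj; rewrite Vf dimvf /dim /= muln1 => jn.
  by rewrite -jn ltnn in jlt.
- by move=> V V' /memL[-> _] /memL[-> _].
- move=> V /memL[Vj [f fn0 VE]].
  have m1 : measurable_fun setT (fun g => om (preim_GL g V) (f *m GLmx g)).
    exact: measurable_subspace_mass_preim.
  have m2 := measurable_copotential_GL s0 nu f.
  have m3 : measurable_fun setT (fun g => a * N' (f *m GLmx g)).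
    by apply: measurable_funM => //; exact: measurable_cst.
  have H : {ae mu, forall g, a * N' (f *m GLmx g) - om (preim_GL g V) (f *m GLmx g) = 0}.
    apply: ae_zero_integral.
    - exact: measurable_funB.
    - by move=> g; rewrite subr_ge0; apply: amax; rewrite dim_preim_GL.
    apply: (@integral_sub_eq0 _ _ _ _ _ (K * om V f)) => //.
    + by move=> g; rewrite subspace_mass_ge0/=; apply: amax; rewrite dim_preim_GL.
    + under eq_integral do rewrite EFinM.
      rewrite ge0_integralZl ?lee_fin ?(ltW a0)//.
      * by rewrite (copotential_eigen s0 moment nuE) -EFinM VE mulrCA.
      * exact/measurable_EFinP.
      * by move=> g _; rewrite lee_fin copotential_ge0.
    + exact: (subspace_mass_eigen s0 moment nuE).
  apply: filterS H => g /eqP; rewrite subr_eq0 => /eqP E.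
  apply/memL; split; first by rewrite dim_preim_GL.
  exists (f *m GLmx g); last by rewrite E.
  by have := act_neq0 linear_action_adjact g fn0.
Qed.

Lemma null_hyperplane (f : rV) : f != 0 -> nu [set x | f *m uvec x = 0] = 0%E.
Proof.
move=> f0; have lin : linear_pred (fun v : cV => f *m v = 0).
  split=> [|a u v fu fv]; first exact: mulmx0.
  by rewrite mulmxDr -scalemxAr fu fv scaler0 addr0.
have [W HW] := linear_pred_vspace lin.
have -> : [set x | f *m uvec x = 0] = A W.
  by apply/seteqP; split => x /HW.
apply: null_subspace; apply: contra f0 => /eqP Wf.
apply/eqP/rowP => i; rewrite mxE.
have /HW : delta_mx i (ord0 : 'I_1) \in W by rewrite Wf memvf.
by rewrite -colE => /matrixP/(_ ord0 ord0); rewrite !mxE.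
Qed.

End NullHyperplane.

(** * Small coefficients *)

Lemma powR_le1 (R : realType) (s a : R) : 0 <= s -> 0 <= a -> a <= 1 -> a `^ s <= 1.
Proof.
by move=> s0 a0 a1; apply: (@le_trans _ _ (1 `^ s)); [rewrite le_powR_ge0 | rewrite powR1].
Qed.

(* Equal to 1 on the hyperplane f = 0 and to 0 where |<f, v>| >= |v| / t. *)
Definition hyperplane_bump (R : realType) (n : nat) (f : 'rV[R]_n.+1) (t : R) : 'cV[R]_n.+1 -> R :=
  cone_cutoff (@enorm R n.+1 1) (bracket f) t.

HB.lock Definition bump_mass (R : realType) (n : nat)
  (nu : probability (projspace R n 0) R) (s t : R) (f : 'rV[R]_n.+1) : R :=
  \int[nu]_x (hyperplane_bump f t (uvec x) `^ s).

Section SmallNeighbourhoods.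
Context {R : realType} {n : nat}.
Local Notation cV := 'cV[R]_n.+1.
Local Notation rV := 'rV[R]_n.+1.
Context (mu : probability (GL R n) R) (s : R) (s0 : 0 < s).
Hypothesis moment : (\int[mu]_g (enorm (GLmx g) `^ s)%:E < +oo)%E.
Context (nu : probability (projspace R n 0) R) (nustar : probability (projspace R 0 n) R).
Context (K : R).
Hypothesis nuE : eigenmeasure (P_ mu s) K nu.
Hypothesis nustarE : eigenmeasure (Pstar_ mu s) K nustar.
Hypothesis irr : strongly_irreducible (Gamma mu).
Local Notation bump_mass := (bump_mass nu s).

Lemma hyperplane_bump_ge0 (f : rV) t v : 0 <= hyperplane_bump f t v.
Proof. exact: cone_cutoff_ge0. Qed.

Lemma hyperplane_bump_le (f : rV) t v : 0 <= t -> hyperplane_bump f t v <= enorm v.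
Proof.
by move=> t0; apply: cone_cutoff_le => //; [exact: enorm_ge0 | exact: bracket_ge0].
Qed.

Lemma homogeneous_hyperplane_bump (f : rV) t :
  homogeneous_fun s (fun v => hyperplane_bump f t v `^ s).
Proof.
apply: homogeneous_cone_cutoff => //.
- exact: continuous_enorm.
- exact: continuous_bracketr.
- by move=> c v; rewrite enormZ.
- by move=> c v; exact: bracketZr.
Qed.

Lemma measurable_bump (f : rV) t d (T : measurableType d) (v : T -> cV) : mxmeasurable v ->
  measurable_fun setT (fun x => hyperplane_bump f t (v x) `^ s).
Proof.
move=> mv; have [c _ _] := homogeneous_hyperplane_bump f t.
exact: (measurable_continuous_mx mv c).
Qed.

Lemma bump_mass_ereal t f : 0 <= t ->
  (bump_mass t f)%:E = (\int[nu]_x (hyperplane_bump f t (uvec x) `^ s)%:E)%E.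
Proof.
move=> t0; rewrite unlock; apply: EFin_Rintegral_ge0 => [x|]; first exact: powR_ge0.
apply: (@le_lt_trans _ _ 1%:E); last exact: ltry.
apply: integral_probability_le => [|x].
  by apply: measurable_bump; exact: mxmeasurable_uvec.
rewrite powR_ge0/= powR_le1 ?(ltW s0) ?hyperplane_bump_ge0//.
by rewrite (le_trans (hyperplane_bump_le _ _ t0))// enorm_uvec.
Qed.

Lemma bump_mass_nonincreasing t t' f : 0 <= t -> t <= t' ->
  bump_mass t' f <= bump_mass t f.
Proof.
move=> t0 tt; rewrite -lee_fin (bump_mass_ereal _ t0) (bump_mass_ereal _ (le_trans t0 tt)).
apply: le_integral_fin => [||x].
- by apply: measurable_bump; exact: mxmeasurable_uvec.
- by apply: measurable_bump; exact: mxmeasurable_uvec.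
- rewrite powR_ge0 le_powR_ge0 ?(ltW s0) ?hyperplane_bump_ge0//.
  by apply: cone_cutoff_nonincreasing => //; exact: bracket_ge0.
Qed.

Lemma continuous_bump_mass t : 0 <= t -> continuous (bump_mass t).
Proof.
move=> t0; rewrite unlock; apply: continuous_param_integral => [f|x|M].
- by apply: measurable_bump; exact: mxmeasurable_uvec.
- have c : continuous (fun f : rV => hyperplane_bump f t (uvec x)).
    apply: (@continuous_cone_cutoff R 0 n (fun=> enorm (uvec x)) (bracket ^~ (uvec x)) t).
      exact: cst_continuous.
    exact: continuous_bracketl.
  rewrite (_ : (fun f => _) = (fun t : R => `|t| `^ s) \o (fun f : rV => hyperplane_bump f t (uvec x))).
    by move=> f; apply: continuous_comp; [exact: c | exact: continuous_powR_norm].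
  by apply/funext => f /=; rewrite ger0_norm ?hyperplane_bump_ge0.
- exists (fun=> 1); first exact: finite_measure_integrable_cst.
  move=> f x _; rewrite ger0_norm ?powR_ge0// powR_le1 ?(ltW s0) ?hyperplane_bump_ge0//.
  by rewrite (le_trans (hyperplane_bump_le _ _ t0))// enorm_uvec.
Qed.

Lemma measurable_hyperplane (f : rV) : measurable [set x : projspace R n 0 | f *m uvec x = 0].
Proof.
have mC : measurable_fun setT (fun x : projspace R n 0 => (f *m uvec x == 0)%:R : R).
  apply: measurable_kernel; apply: mxmeasurable_mul; first exact: mxmeasurable_cst.
  exact: mxmeasurable_uvec.
have := mC measurableT [set 1] (measurable_set1 _); rewrite setTI.
congr measurable; apply/seteqP; split => x /=; last by move=> ->; rewrite eqxx.
by case: eqP => // _ /eqP; rewrite eq_sym oner_eq0.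
Qed.

(** The bumps are bounded by 1 on unit vectors and converge to the indicator of the hyperplane f =
    0, which is null. *)
Lemma bump_mass_cvg0 (f : rV) : f != 0 -> bump_mass k%:R f @[k --> \oo] --> (0 : R).
Proof.
move=> f0; apply: (@fine_cvg _ _ _ _ (fun k : nat => (bump_mass k%:R f)%:E) 0).
rewrite (_ : (fun k : nat => _) = fun k => (\int[nu]_x (hyperplane_bump f k%:R (uvec x) `^ s)%:E)%E); last first.
  by apply/funext => k; rewrite bump_mass_ereal.
have -> : 0%:E = (\int[nu]_x (f *m uvec x == 0)%:R%:E)%E :> \bar R.
  transitivity (nu [set x | f *m uvec x = 0]); first by rewrite (null_hyperplane s0 moment nuE irr f0).
  rewrite -integral_indicT; last exact: measurable_hyperplane.
  apply: eq_integral => x _; rewrite indicE; congr ((nat_of_bool _)%:R%:E).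
  by apply/idP/idP => [/set_mem/= ->|/eqP fx]; [rewrite eqxx|exact: mem_set].
apply: (@dominated_cvg _ _ _ nu setT measurableT _ _ (cst 1%:E)) => //.
- by move=> k; apply/measurable_EFinP; apply: measurable_bump; exact: mxmeasurable_uvec.
- move=> x _; apply: cvg_EFin; first exact: nearW.
  rewrite /= /comp /=; have [fx|fx] := eqVneq (f *m uvec x) 0.
    rewrite (_ : (fun k => _) = fun=> 1); first exact: cvg_cst.
    apply/funext => k; rewrite /hyperplane_bump /cone_cutoff /bracket fx enorm0 mulr0 subr0.
    by rewrite enorm_uvec normr1 -mulr2n divff ?powR1// pnatr_eq0.
  apply: cvg_near_cst; near=> k.
  rewrite /hyperplane_bump /cone_cutoff ler0_norm ?subrr ?mul0r ?powR0 ?gt_eqF//.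
  rewrite subr_le0 -ler_pdivrMr; last by rewrite /bracket enorm_gt0.
  by apply/ltW; near: k; exact: nbhs_infty_gtr.
- exact: finite_measure_integrable_cst.
- move=> k x _; rewrite /= lee_fin ger0_norm ?powR_ge0// powR_le1 ?(ltW s0) ?hyperplane_bump_ge0//.
  by rewrite (le_trans (hyperplane_bump_le _ _ _))// enorm_uvec.
Unshelve. all: by end_near. Qed.

(** Dini's argument: convergence to 0 that is monotone in t and continuous in f is uniform on the
    compact sphere. *)
Lemma bump_mass_uniform (eta : R) : 0 < eta ->
  exists2 t0 : R, 0 < t0 & forall t f, t0 <= t -> enorm f = 1 -> bump_mass t f <= eta.
Proof.
move=> eta0.
have /compact_near_coveringP := @compact_sphere R 1 n.+1.
move=> /(_ nat \oo (fun k f => bump_mass k%:R f <= eta) _) [|].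
  move=> f f1.
  have f0 : f != 0 by rewrite -enorm_gt0 f1.
  have /cvgrPdist_lt/(_ _ eta0)[k0 _ Hk0] := bump_mass_cvg0 f0.
  have := Hk0 k0 (leqnn _); rewrite /= sub0r normrN => /ltr_normlW Hf.
  have [U fU HU] : exists2 U, nbhs f U & forall f', U f' -> bump_mass k0%:R f' < eta.
    exists [set f' | bump_mass k0%:R f' < eta] => //.
    have := @continuous_bump_mass k0%:R (ler0n _ _) f.
    by move=> /cvgr_lt; exact.
  exists (U, [set k | (k0 <= k)%N]) => [|[f' k] [/= Uf' kk]].
    by split => //; exact: nbhs_infty_ge.
  apply: le_trans (ltW (HU _ Uf')); apply: bump_mass_nonincreasing => //.
  by rewrite ler_nat.
move=> k _ /(_ k (leqnn k)) /= Hk; exists k.+1%:R => // t f kt f1.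
apply: le_trans (Hk f f1); apply: bump_mass_nonincreasing => //.
by apply: le_trans kt; rewrite ler_nat.
Qed.

End SmallNeighbourhoods.

Lemma integral_probability_cst d (T : measurableType d) (R : realType)
    (mu : probability T R) (C : R) : (\int[mu]_x C%:E = C%:E)%E.
Proof.
rewrite (@integral_cst _ _ _ mu setT _ C%:E)//.
by rewrite [X in (_ * X)%E](_ : _ = 1%E) ?mule1//; exact: probability_setT.
Qed.

Lemma measurable_natr_bool d (T : measurableType d) (R : realType) (p : T -> bool) :
  measurable_fun setT p -> measurable_fun setT (fun t => (p t)%:R : R).
Proof.
move=> mp; rewrite (_ : (fun t => _) = (fun t => if p t then 1 else 0 : R)); last first.
  by apply/funext => t; case: (p t).
exact: measurable_fun_ifT mp (measurable_cst _) (measurable_cst _).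
Qed.

Lemma enorm_row_le (R : realType) m k (A : 'M[R]_(m, k)) i : enorm (row i A) <= enorm A.
Proof.
rewrite -enorm_tr -[leRHS]enorm_tr -(ler_pXn2r (ltn0Sn 1)) ?nnegrE ?enorm_ge0//.
rewrite [leRHS]enorm_col_sqr (bigD1 i)//= tr_row lerDl.
by apply: sumr_ge0 => j _; exact: sqr_ge0.
Qed.

Section SmallCoefficients.
Context {R : realType} {n : nat}.
Local Notation rV := 'rV[R]_n.+1.
Local Notation MV := 'M[R]_n.+1.
Context (mu : probability (GL R n) R) (s : R) (s0 : 0 < s).
Hypothesis moment : (\int[mu]_g (enorm (GLmx g) `^ s)%:E < +oo)%E.
Context (nu : probability (projspace R n 0) R).
Context (K : R).
Hypothesis nuE : eigenmeasure (P_ mu s) K nu.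
Hypothesis irr : strongly_irreducible (Gamma mu).
Local Notation N' := (copotential nu s).
Local Notation mu_ := (conv_power mu).

(** Each row of A u is at most |A u|, and N' evaluated at the rows of A controls |A|^s; the factor
    n+1 is the number of rows. *)
Lemma matrix_mass_ge : exists2 c : R, 0 < c &
  forall A : MV, ((c * enorm A `^ s)%:E <= \int[nu]_x (enorm (A *m uvec x) `^ s)%:E)%E.
Proof.
have [c0 c00 N0] := copotential_ge s0 moment nuE irr.
pose e i : rV := delta_mx ord0 i.
pose H (A : MV) := \sum_(i < n.+1) N' (e i *m A).
have hH : homogeneous_fun s H.
  split.
  - by apply: continuous_sumr => i; exact: continuous_copotential_mulmx.
  - move=> a v; rewrite /H mulr_sumr; apply: eq_bigr => i _.
    by have [_ NZ _] := homogeneous_copotential s0 nu; rewrite -scalemxAr NZ.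
  - by move=> v; apply: sumr_ge0 => i _; exact: copotential_ge0.
have [c cpos Hc] : exists2 c : R, 0 < c & forall A, c * enorm A `^ s <= H A.
  apply: homogeneous_ge => // A /eqP; rewrite /H psumr_eq0; last first.
    by move=> i _; exact: copotential_ge0.
  move=> /allP HA; apply/matrixP => i j; rewrite mxE.
  have /HA /eqP NA : i \in index_enum 'I_n.+1 by rewrite mem_index_enum.
  have : e i *m A = 0.
    apply/eqP; apply: contraT => w0; have := N0 (e i *m A).
    by rewrite NA leNgt mulr_gt0// powR_gt0// enorm_gt0.
  by rewrite -rowE => /matrixP/(_ ord0 j); rewrite !mxE.
exists (n.+1%:R^-1 * c) => [|A]; first by rewrite mulr_gt0.
have me (f : rV) : measurable_fun setT (fun x : projspace R n 0 => bracket f (uvec x) `^ s).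
  apply: measurable_bracket; last exact: mxmeasurable_uvec.
  exact: mxmeasurable_cst.
have mA : mxmeasurable (fun x : projspace R n 0 => A *m uvec x).
  by apply: mxmeasurable_mul; [exact: mxmeasurable_cst|exact: mxmeasurable_uvec].
have HA : ((H A)%:E <= n.+1%:R%:E * \int[nu]_x (enorm (A *m uvec x) `^ s)%:E)%E.
  rewrite /H -sumEFin mule_natl.
  have -> : (\int[nu]_x (enorm (A *m uvec x) `^ s)%:E *+ n.+1 =
     \sum_(i < n.+1) \int[nu]_x (enorm (A *m uvec x) `^ s)%:E)%E.
    by rewrite sumr_const card_ord.
  apply: lee_sum => i _; rewrite (copotential_ereal s0 nu (e i *m A)).
  apply: le_integral_fin => [||x]; first exact: me.
    exact: measurable_enorm_powR.
  rewrite powR_ge0 le_powR_ge0 ?bracket_ge0 ?(ltW s0)//.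
  rewrite /bracket -mulmxA -rowE; exact: enorm_row_le.
have [_ _ H0] := hH.
rewrite -(@lee_pmul2l _ n.+1%:R%:E)// ?lte_fin ?ltr0Sn//.
apply: le_trans HA; rewrite -EFinM lee_fin.
by rewrite !mulrA divff ?pnatr_eq0// mul1r.
Qed.

Lemma measurable_small_coefficient (f : rV) (e : R) : measurable_fun setT
  (fun g : GL R n => (enorm (f *m GLmx g) < e * enorm (GLmx g))%R%:R : R).
Proof.
apply: measurable_natr_bool; apply: measurable_fun_ltr.
  apply: measurable_continuous_mx (@continuous_enorm _ _ _).
  by apply: mxmeasurable_mul; [exact: mxmeasurable_cst|exact: mxmeasurable_GLmx].
apply: measurable_funM; first exact: measurable_cst.
exact: measurable_GL_mx (@continuous_enorm _ _ _).
Qed.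

(** Put d = sqrt e. If |f g| < e |g|, then |<f, g x>| / d < d |g| for unit x, so |g x| is at most
    the bump at g x plus d |g|. Integrating s-th powers over nu and absorbing the last term by
    [matrix_mass_ge] bounds |g|^s by a multiple of the bump mass seen through g. The k-step average
    of the latter is K^k times the bump mass of f at t = 1/d, which is uniformly small. *)
Lemma small_coefficients (eta : R) : 0 < eta -> exists2 e0 : R, 0 < e0 &
  forall (e : R) k (f : rV), 0 < e -> e <= e0 -> enorm f = 1 ->
    (\int[mu_ k]_g ((enorm (f *m GLmx g) < e * enorm (GLmx g))%R%:R * enorm (GLmx g) `^ s)%:E
      <= (eta * K ^+ k)%:E)%E.
Proof.
move=> eta0; have [c c0 Hc] := matrix_mass_ge.
pose b := 2 `^ s : R.
have b0 : 0 < b by rewrite powR_gt0.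
have eta1 : 0 < eta * c / (2 * b) by rewrite divr_gt0 ?mulr_gt0.
have [t0 t00 Ht0] := bump_mass_uniform s0 moment nuE irr eta1.
(* The first bound gives 1/d >= t0, where the bump mass is small; the second gives b d^s <= c / 2,
   so that half of c |g|^s survives the absorption. *)
pose d0 := Num.min t0^-1 ((c / (2 * b)) `^ s^-1).
have d00 : 0 < d0 by rewrite lt_min invr_gt0 t00 powR_gt0// divr_gt0// mulr_gt0.
exists (d0 ^+ 2) => [|e k f e0 ed f1]; first exact: exprn_gt0.
pose d := Num.sqrt e.
have dpos : 0 < d by rewrite sqrtr_gt0.
have dd0 : d <= d0 by rewrite -(ler_pXn2r (ltn0Sn 1)) ?nnegrE ?(ltW dpos) ?(ltW d00)// sqr_sqrtr ?(ltW e0).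
have ed2 : e = d * d by rewrite -expr2 sqr_sqrtr// ltW.
have dt : t0 <= d^-1.
  rewrite -[t0]invrK lef_pV2 ?posrE ?invr_gt0//.
  by rewrite (le_trans dd0)// ge_min lexx.
have ds : b * d `^ s <= c / 2.
  rewrite mulrC -ler_pdivlMr// -mulrA -invfM.
  rewrite [leRHS](_ : _ = (c / (2 * b)) `^ s^-1 `^ s).
    rewrite le_powR_ge0 ?(ltW s0) ?(ltW dpos)// (le_trans dd0)//.
    by rewrite ge_min lexx orbT.
  rewrite -powRrM mulVf ?gt_eqF// powRr1// ltW// divr_gt0// mulr_gt0//.
have H1 (g : GL R n) : (((enorm (f *m GLmx g) < e * enorm (GLmx g))%R%:R * enorm (GLmx g) `^ s)%:E
   <= (2 * b / c)%:E * \int[nu]_x (hyperplane_bump f d^-1 (GLmx g *m uvec x) `^ s)%:E)%E.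
  have [fg|fg] := ltP; last first.
    rewrite mul0r mule_ge0 ?lee_fin ?divr_ge0 ?mulr_ge0 ?(ltW b0) ?(ltW c0)//.
    by apply: integral_ge0 => x _; rewrite lee_fin powR_ge0.
  have H2 x : enorm (GLmx g *m uvec x) `^ s <=
      b * hyperplane_bump f d^-1 (GLmx g *m uvec x) `^ s + c / 2 * enorm (GLmx g) `^ s.
    have dA : enorm (GLmx g *m uvec x) <=
        hyperplane_bump f d^-1 (GLmx g *m uvec x) + d * enorm (GLmx g).
      rewrite -lerBlDr; apply: le_trans (cone_cutoff_ge _ _ _ _).
      rewrite lerD2l lerN2 ler_pdivrMl// mulrA -ed2 -bracketA.
      by rewrite (le_trans (bracket_le _ _))// enorm_uvec mulr1 ltW.
    have p0 := hyperplane_bump_ge0 f d^-1 (GLmx g *m uvec x).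
    have q0 : 0 <= d * enorm (GLmx g) by rewrite mulr_ge0 ?enorm_ge0 ?ltW.
    apply: (@le_trans _ _ _ _ _ (le_powR_ge0 (ltW s0) (enorm_ge0 _) dA)).
    apply: (le_trans (powRD_le s0 p0 q0)); rewrite mulrDr lerD2l powRM ?enorm_ge0 ?(ltW dpos)//.
    by rewrite mulrA ler_wpM2r ?powR_ge0.
  have mg : mxmeasurable (fun x : projspace R n 0 => GLmx g *m uvec x).
    by apply: mxmeasurable_mul; [exact: mxmeasurable_cst|exact: mxmeasurable_uvec].
  have := le_trans (Hc (GLmx g)) (le_integral_fin nu (measurable_enorm_powR s mg)
    (measurable_funD (measurable_funM (measurable_cst b) (measurable_bump s0 f d^-1 mg))
      (measurable_cst (c / 2 * enorm (GLmx g) `^ s)))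
    (fun x => introT andP (conj (powR_ge0 _ _) (H2 x)))).
  under [X in (_ <= X)%E]eq_integral do rewrite EFinD EFinM.
  have mb : measurable_fun setT (fun x : projspace R n 0 =>
      (hyperplane_bump f d^-1 (GLmx g *m uvec x) `^ s)%:E).
    by apply/measurable_EFinP; exact: measurable_bump.
  rewrite ge0_integralD//=; last 3 first.
  - by move=> x _; rewrite lee_fin mulr_ge0 ?powR_ge0 ?(ltW b0).
  - by apply: measurable_funeM.
  - by move=> x _; rewrite lee_fin mulr_ge0 ?powR_ge0 ?divr_ge0 ?(ltW c0).
  rewrite ge0_integralZl ?lee_fin ?(ltW b0)//; last first.
    by move=> x _; rewrite lee_fin powR_ge0.
  rewrite integral_probability_cst mul1r.
  have : (0 <= \int[nu]_x (hyperplane_bump f d^-1 (GLmx g *m uvec x) `^ s)%:E)%E.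
    by apply: integral_ge0 => x _; rewrite lee_fin powR_ge0.
  case: (integral _ _ _) => [r| |]//.
    rewrite -EFinM -EFinD !lee_fin => r0 Hr.
    have Hb : c / 2 * enorm (GLmx g) `^ s <= b * r by lra.
    by rewrite mulrAC ler_pdivlMr// -mulrA mulrC; lra.
  by move=> _ _; rewrite gt0_muley ?leey// lte_fin divr_gt0// mulr_gt0.
have mB : measurable_fun setT (fun g : GL R n =>
    \int[nu]_x (hyperplane_bump f d^-1 (GLmx g *m uvec x) `^ s)%:E)%E.
  apply: (measurable_fun_fubini_tonelli_F (m2 := nu)
    (fun z : GL R n * projspace R n 0 => (hyperplane_bump f d^-1 (GLmx z.1 *m uvec z.2) `^ s)%:E)) => [|z].
    apply/measurable_EFinP/measurable_bump => //.
    exact: act_measurable linear_action_lact.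
  by rewrite lee_fin powR_ge0.
apply: (@le_trans _ _ (\int[mu_ k]_g ((2 * b / c)%:E *
    \int[nu]_x (hyperplane_bump f d^-1 (GLmx g *m uvec x) `^ s)%:E)))%E.
  apply: ge0_le_integral => //.
  - by move=> g _; rewrite lee_fin mulr_ge0 ?powR_ge0.
  - apply/measurable_EFinP; apply: measurable_funM.
      exact: measurable_small_coefficient.
    by apply: measurable_enorm_powR; exact: mxmeasurable_GLmx.
  - by apply: measurable_funeM.
rewrite ge0_integralZl//; last 2 first.
- by move=> g _; apply: integral_ge0 => x _; rewrite lee_fin powR_ge0.
- by rewrite lee_fin divr_ge0 ?mulr_ge0 ?(ltW b0) ?(ltW c0).
rewrite (conv_power_eigenmeasure s0 moment nuE irr k (homogeneous_hyperplane_bump s0 f d^-1)).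
rewrite -(bump_mass_ereal s0 nu f (ltW (lt_le_trans t00 dt))) -!EFinM lee_fin.
rewrite mulrCA [leRHS]mulrC ler_wpM2l ?exprn_ge0 ?(ltW (K_gt0 s0 moment nuE irr))//.
apply: (@le_trans _ _ (2 * b / c * (eta * c / (2 * b)))).
  by rewrite ler_wpM2l ?Ht0// divr_ge0 ?mulr_ge0 ?(ltW b0) ?(ltW c0).
rewrite le_eqVlt; apply/orP; left; apply/eqP; field.
by rewrite !gt_eqF.
Qed.

End SmallCoefficients.

(** * Powers of a proximal matrix *)

Section ProximalMatrices.
Import Normc.

(** A nonzero cofactor means corank at most one: a kernel vector whose coordinate j vanishes is
    killed by an invertible minor, hence is zero. *)
Lemma ker_adj_neq0 (F : fieldType) n (M : 'M[F]_n.+1) (y z : 'cV[F]_n.+1) :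
  \adj M != 0 -> M *m y = 0 -> M *m z = 0 ->
  exists a b, (a, b) != (0, 0) /\ a *: y + b *: z = 0.
Proof.
move=> adjM My Mz.
have [j [i Mij]] : exists j i, cofactor M i j != 0.
  apply: contrapT => H; move/eqP: adjM; apply; apply/matrixP => j i; rewrite !mxE.
  by apply/eqP; apply: contrapT => Hij; apply: H; exists j, i; exact/negP.
have det0 : \det (row' i (col' j M)) != 0.
  by move: Mij; rewrite /cofactor mulf_eq0 negb_or => /andP[].
have ker0 (w : 'cV[F]_n.+1) : M *m w = 0 -> w j ord0 = 0 -> w = 0.
  move=> Mw wj; have : row' i (col' j M) *m row' j w = 0.
    apply/matrixP => a b; rewrite !mxE.
    have /matrixP/(_ (lift i a) b) := Mw; rewrite !mxE (bigD1_ord j)//= ord1 wj mulr0 add0r => H.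
    by rewrite -[RHS]H; apply: eq_bigr => k _; rewrite !mxE.
  move=> /(congr1 (mulmx (\adj (row' i (col' j M))))).
  rewrite mulmx0 mulmxA mul_adj_mx mul_scalar_mx => /eqP.
  rewrite scaler_eq0 (negbTE det0)/= => /eqP/matrixP H.
  apply/matrixP => k b; rewrite [RHS]mxE ord1; case: (unliftP j k) => [k'|] -> //.
  by have := H k' ord0; rewrite !mxE.
have [/eqP|ne] := eqVneq (z j ord0, - y j ord0) (0, 0).
  rewrite xpair_eqE oppr_eq0 => /andP[/eqP zj /eqP yj].
  exists 1, 0; split; first by rewrite xpair_eqE oner_eq0.
  by rewrite scale0r addr0 scale1r; exact: ker0.
(* The combination of y and z whose coordinate j cancels. *)
exists (z j ord0), (- y j ord0); split => //; apply: ker0.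
  by rewrite mulmxDr -!scalemxAr My Mz !scaler0 addr0.
by rewrite !mxE mulNr [y _ _ * _]mulrC subrr.
Qed.

(* If the adjugate of X - h vanished at r, one could divide it by X - r and obtain an *)
(* inverse of r - h up to the nonzero factor q(r). *)
Lemma simple_root_adj (F : fieldType) n (h : 'M[F]_n.+1) r q :
  char_poly h = q * ('X - r%:P) -> q.[r] != 0 -> \adj (r%:M - h) != 0.
Proof.
move=> hq qr; apply: contraNneq qr => adj0.
set C := char_poly_mx h; pose e : {rmorphism _ -> _} := horner_eval r.
have eC : map_mx e C = r%:M - h.
  apply/matrixP => i j; rewrite !mxE /e /= /horner_eval hornerD hornerN hornerC.
  by rewrite hornerMn hornerX.
have eB : map_mx e (\adj C) = 0 by rewrite map_mx_adj eC.
pose B := map_mx (fun p => p %/ ('X - r%:P)) (\adj C).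
have CB : C *m B = q%:M.
  have BE : \adj C = ('X - r%:P) *: B.
    apply/matrixP => i j; rewrite [RHS]mxE [B i j]mxE mulrC divpK//.
    rewrite dvdp_XsubCl; apply/rootP.
    by have /matrixP/(_ i j) := eB; rewrite !mxE.
  have := mul_mx_adj C; rewrite -/(char_poly h) hq BE -scalemxAr => /matrixP H.
  apply/matrixP => i j; have := H i j; rewrite !mxE mulrC -mulrnAl mulrC.
  by rewrite mulrC => /mulIf; apply; rewrite polyXsubC_eq0.
have := congr1 (fun M => \det (map_mx e M)) CB.
rewrite map_mxM eC det_mulmx map_scalar_mx det_scalar.
have -> : \det (r%:M - h) = 0.
  by rewrite -eC det_map_mx -/(char_poly h) hq /e /= /horner_eval hornerM hornerXsubC subrr mulr0.
by move/esym/eqP; rewrite mul0r expf_eq0 => /andP[].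
Qed.

(** Induction on the roots. Peeling off z gives A^(m+1) u = z A^m u + A^m (A - z) u, where the last
    vector is killed by the remaining factors and so grows like C t^m. As |z| < t strictly, the
    bound D t^m propagates as soon as D >= C / (t - |z|), even with multiple roots. *)
Lemma growth_of_roots (R : realType) n (A : 'M[complex R]_n.+1) (l : seq (complex R)) (t : R) :
  0 < t -> (forall z, z \in l -> normc z < t) ->
  forall u : 'cV_n.+1, horner_mx A (\prod_(z <- l) ('X - z%:P)) *m u = 0 ->
  forall i, exists2 C : R, 0 <= C & forall m, normc ((A ^+ m *m u) i ord0) <= C * t ^+ m.
Proof.
move=> t0; elim: l => [|z l IH] lt u.
  rewrite big_nil rmorph1 mul1mx => -> i; exists 0 => // m.
  by rewrite mulmx0 mxE normc0 mul0r.
rewrite big_cons mulrC rmorphM/= rmorphB/= horner_mx_X horner_mx_C -mulmxA => Hu i.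
have [|C C0 HC] := IH _ _ Hu i.
  by move=> x xl; apply: lt; rewrite in_cons xl orbT.
have zt : normc z < t by apply: lt; rewrite in_cons eqxx.
exists (Num.max (normc (u i ord0)) (C / (t - normc z))).
  by rewrite le_max; apply/orP; right; rewrite divr_ge0// subr_ge0 ltW.
set D := Num.max _ _; elim => [|m IHm].
  by rewrite expr0 mul1mx mulr1 le_max lexx.
have -> : A ^+ m.+1 *m u = z *: (A ^+ m *m u) + A ^+ m *m ((A - z%:M) *m u).
  rewrite mulmxBl mulmxBr mul_scalar_mx -scalemxAr mulmxA -[A ^+ m *m A]exprSr.
  by rewrite addrC subrK.
rewrite mxE (le_trans (le_normcD _ _))// mxE normcM.
have zle : 0 <= normc z by rewrite /normc; case: (z) => a b; exact: sqrtr_ge0.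
apply: (le_trans (lerD (ler_wpM2l zle IHm) (HC m))).
rewrite mulrA -mulrDl exprS mulrCA mulrA ler_wpM2r ?exprn_ge0 ?(ltW t0)//.
have : C <= D * (t - normc z).
  by rewrite -ler_pdivrMr ?subr_gt0// le_max lexx orbT.
by lra.
Qed.

Lemma strict_bound (R : realType) (T : eqType) (f : T -> R) (l : seq T) (p : R) : 0 < p ->
  (forall z, z \in l -> f z < p) ->
  exists t : R, 0 < t < p /\ forall z, z \in l -> f z < t.
Proof.
move=> p0; elim: l => [|z l IH] lp; first by exists (p / 2); split => //; lra.
have [|t [/andP[t0 tp] lt]] := IH.
  by move=> x xl; apply: lp; rewrite in_cons xl orbT.
have zp : f z < p by apply: lp; rewrite in_cons eqxx.
exists (Num.max t ((f z + p) / 2)); split.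
  by rewrite lt_max t0 gt_max tp/=; lra.
move=> x; rewrite in_cons lt_max => /orP[/eqP ->|/lt -> //].
by apply/orP; right; lra.
Qed.

(** The dominant eigenvalue r is a simple root, so the characteristic polynomial is q (X - r) with
    q(r) nonzero, and Q = q(h) is the spectral projection onto the line of r up to a factor.
    Cayley-Hamilton gives h Q = Q h = r Q. On the kernel of Q only the other eigenvalues act, all of
    modulus below t. The image of Q lies in the kernel of r - h, which is a line by
    [simple_root_adj]. *)
Lemma proximal_split (R : realType) n (h : 'M[R]_n.+1) : h \in unitmx -> proximal h ->
  exists (Q : 'M[R]_n.+1) (r t : R), [/\ 0 < t < `|r|, h *m Q = r *: Q & Q *m h = r *: Q] /\
  [/\ Q != 0,
    forall u : 'cV_n.+1, Q *m u = 0 ->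
      exists2 C : R, 0 <= C & forall m, enorm (h ^+ m *m u) <= C * t ^+ m &
    forall y z : 'cV_n.+1, exists a b, (a, b) != (0, 0) /\ Q *m (a *: y + b *: z) = 0].
Proof.
move=> hu [l]; set hC := map_mx _ h => -[evl mupl maxl].
have chiC : char_poly hC = map_poly (real_complex R) (char_poly h) by rewrite map_char_poly.
have normE (z : complex R) : `|z| = (normc z)%:C%C by [].
(* The conjugate of l is an eigenvalue of the same modulus, since h is real; strict domination
   forces it to equal l. *)
have lreal : conjc l = l.
  apply/eqP; apply: contraT => ll; have : `|conjc l| < `|l|.
    apply: maxl ll; move: evl; rewrite !eigenvalue_root_char -complex_root_conj => rl.
    rewrite (_ : map_poly _ _ = char_poly hC)//.
    rewrite chiC -map_poly_comp; apply: eq_map_poly => x /=.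
    by rewrite oppr0.
  by rewrite !normE ltcR; case: (l) => x y /=; rewrite sqrrN ltxx.
have [r lr] : exists r : R, l = r%:C%C.
  exists (complex.Re l); move: lreal; case: (l) => x y [] /= /eqP.
  rewrite -subr_eq0 -opprD oppr_eq0 -mulr2n mulrn_eq0/= => /eqP ->.
  by [].
have rr : root (char_poly h) r.
  by move: evl; rewrite eigenvalue_root_char chiC lr fmorph_root.
have [q hq] := factor_theorem _ _ rr.
set qC := map_poly (real_complex R) q.
have chiqC : char_poly hC = qC * ('X - l%:P).
  by rewrite chiC hq rmorphM/= rmorphB/= map_polyX map_polyC/= lr.
have chiC0 : char_poly hC != 0 by exact/monic_neq0/char_poly_monic.
have qCl : ~~ root qC l.
  apply/negP => ql; have : (2 <= mup l (char_poly hC))%N.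
    by rewrite mup_geq// chiqC expr2 dvdp_mul// dvdp_XsubCl.
  by rewrite mupl.
have qr : q.[r] != 0.
  by apply: contra qCl => qr; rewrite lr fmorph_root.
have r0 : r != 0.
  apply/eqP => r0; move: rr; rewrite -eigenvalue_root_char => /eigenvalueP[z zh z0].
  move/eqP: z0; apply; rewrite -[z](mulmxK hu) zh r0 scale0r mul0mx//.
have [rs qCrs] := closed_field_poly_normal qC.
have qC0 : qC != 0 by apply: contraNneq qCl => ->; exact: root0.
have lc0 : lead_coef qC != 0 by rewrite lead_coef_eq0.
have rsr (z : complex R) : z \in rs -> normc z < `|r|.
  move=> zrs; have qz : root qC z by rewrite qCrs rootZ// root_prod_XsubC.
  have : `|z| < `|l|.
    apply: maxl; first by rewrite eigenvalue_root_char chiqC rootM qz.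
    by apply: contraNneq qCl => <-.
  by rewrite !normE ltcR lr /= expr0n addr0 sqrtr_sqr.
have rpos : 0 < `|r| by rewrite normr_gt0.
have [t [tr rst]] := strict_bound rpos rsr.
pose Q := horner_mx h q.
have hE : horner_mx h ('X - r%:P) = h - r%:M.
  by rewrite rmorphB/= horner_mx_X horner_mx_C.
have Qh : Q *m h = r *: Q.
  apply/eqP; rewrite -subr_eq0 -mul_mx_scalar -mulmxBr -hE; apply/eqP.
  by have := Cayley_Hamilton h; rewrite hq rmorphM.
have hQ : h *m Q = r *: Q.
  apply/eqP; rewrite -subr_eq0 -mul_scalar_mx -mulmxBl -hE; apply/eqP.
  by have := Cayley_Hamilton h; rewrite hq mulrC rmorphM.
exists Q, r, t; split => //; split.
- apply/eqP => Q0; move: qr; apply/negP; rewrite negbK.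
  have /dvdpP[p qE] : mxminpoly h %| q by exact: mxminpoly_min.
  by rewrite -/(root q r) qE rootM root_mxminpoly rr orbT.
- move=> u Qu; pose uC := map_mx (real_complex R) u.
  have QuC : horner_mx hC (\prod_(z <- rs) ('X - z%:P)) *m uC = 0.
    have : map_mx (real_complex R) (Q *m u) = 0 by rewrite Qu map_mx0.
    rewrite map_mxM map_horner_mx -/hC -/qC qCrs linearZ/= -scalemxAl => /eqP.
    by rewrite scaler_eq0 (negbTE lc0) => /eqP.
  have t0 : 0 < t by case/andP: tr.
  have /choice[C HC] : forall i, exists C : R, 0 <= C /\
      forall m, normc ((hC ^+ m *m uC) i ord0) <= C * t ^+ m.
    by move=> i; have [C C0 H] := growth_of_roots t0 rst QuC i; exists C.
  exists (Num.sqrt (\sum_(p : 'I_n.+1 * 'I_1) C p.1 ^+ 2)) => [|m]; first exact: sqrtr_ge0.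
  rewrite -[t ^+ m]ger0_norm ?exprn_ge0 ?(ltW t0)// -sqrtr_sqr -sqrtrM; last first.
    by apply: sumr_ge0 => p _; exact: sqr_ge0.
  rewrite enormE ler_sqrt; last by rewrite mulr_ge0 ?sqr_ge0// sumr_ge0// => p _; exact: sqr_ge0.
  rewrite mulr_suml; apply: ler_sum => -[i j] _ /=; rewrite ord1 -exprMn.
  have [C0 /(_ m)] := HC i.
  rewrite /uC /hC -rmorphXn/= -map_mxM mxE => H.
  rewrite -real_normK ?num_real// lerXn2r ?nnegrE ?mulr_ge0 ?exprn_ge0 ?(ltW t0)//.
  by move: H; rewrite /= expr0n addr0 sqrtr_sqr.
- move=> y z.
  have rQ (w : 'cV_n.+1) : (r%:M - h) *m (Q *m w) = 0.
    by rewrite mulmxA mulmxBl mul_scalar_mx hQ subrr mul0mx.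
  have [a [b [ab H]]] := ker_adj_neq0 (simple_root_adj hq qr) (rQ y) (rQ z).
  by exists a, b; split => //; rewrite mulmxDr -!scalemxAr.
Qed.

End ProximalMatrices.

(** * Contraction *)

Lemma sqrt_mul_le (R : realType) (x y : R) : 0 <= x -> 0 <= y ->
  Num.sqrt (x * y) <= (x + y) / 2 ?= iff (x == y).
Proof.
move=> x0 y0; rewrite sqrtrM//.
suff H (a b : R) : 0 <= a -> 0 <= b -> a * b <= (a ^+ 2 + b ^+ 2) / 2 ?= iff (a ^+ 2 == b ^+ 2).
  by have := H _ _ (sqrtr_ge0 x) (sqrtr_ge0 y); rewrite !sqr_sqrtr.
move=> a0 b0; rewrite eqrXn2//; split; first by have := sqr_ge0 (a - b); lra.
rewrite -subr_eq0 (_ : _ - _ = - ((a - b) ^+ 2 / 2)); last by lra.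
by rewrite oppr_eq0 mulf_eq0 invr_eq0 pnatr_eq0 orbF sqrf_eq0 subr_eq0.
Qed.

Lemma integral_lincomb (R : realType) d (T : measurableType d) (m : {measure set T -> \bar R})
    (f g : T -> R) (a b F G : R) : measurable_fun setT f -> measurable_fun setT g ->
  (forall x, 0 <= f x) -> (forall x, 0 <= g x) -> 0 <= a -> 0 <= b ->
  (\int[m]_x (f x)%:E = F%:E)%E -> (\int[m]_x (g x)%:E = G%:E)%E ->
  (\int[m]_x (a * f x + b * g x)%:E = (a * F + b * G)%:E)%E.
Proof.
move=> mf mg f0 g0 a0 b0 fF gG; under eq_integral do rewrite EFinD.
rewrite ge0_integralD//; last 4 first.
- by move=> x _; rewrite lee_fin mulr_ge0.
- by apply/measurable_EFinP; exact: measurable_funM.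
- by move=> x _; rewrite lee_fin mulr_ge0.
- by apply/measurable_EFinP; exact: measurable_funM.
under eq_integral do rewrite EFinM.
under [X in (_ + X)%E]eq_integral do rewrite EFinM.
rewrite !ge0_integralZl ?lee_fin//; last 4 first.
- exact/measurable_EFinP.
- by move=> x _; rewrite lee_fin.
- exact/measurable_EFinP.
- by move=> x _; rewrite lee_fin.
by rewrite fF gG EFinD !EFinM.
Qed.

(** Used to detect contraction: on average over g this mean at g A loses mass, compared with K^j
    times its value at A, exactly when the ratio of N(g A v) to N(g A w) fluctuates with g. *)
Definition geometric_mean (R : realType) (n : nat) (N : 'cV[R]_n.+1 -> R)
    (v w : 'cV[R]_n.+1) (A : 'M[R]_n.+1) : R :=
  Num.sqrt (N (A *m v) * N (A *m w)).

HB.lock Definition shifted_mean (R : realType) (n : nat) (N : 'cV[R]_n.+1 -> R)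
    (m : probability (GL R n) R) (v w : 'cV[R]_n.+1) (X : 'M[R]_n.+1) : R :=
  \int[m]_g geometric_mean N v w (GLmx g *m X).

Section Contraction.
Context {R : realType} {n : nat}.
Local Notation MV := 'M[R]_n.+1.
Context (mu : probability (GL R n) R) (s : R) (s0 : 0 < s).
Hypothesis moment : (\int[mu]_g (enorm (GLmx g) `^ s)%:E < +oo)%E.
Context (nu : probability (projspace R n 0) R) (nustar : probability (projspace R 0 n) R).
Context (K : R).
Hypothesis nuE : eigenmeasure (P_ mu s) K nu.
Hypothesis nustarE : eigenmeasure (Pstar_ mu s) K nustar.
Hypothesis irr : strongly_irreducible (Gamma mu).
Local Notation N := (potential nustar s).
Local Notation mu_ := (conv_power mu).
Local Notation geo := (geometric_mean N).
Local Notation shift j := (shifted_mean N (mu_ j)).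
Let N0 v : 0 <= N v. Proof. exact: potential_ge0. Qed.
Let K0 : 0 < K. Proof. exact: (K_gt0 s0 moment nuE irr). Qed.

Lemma geometric_mean_ge0 v w A : 0 <= geo v w A. Proof. exact: sqrtr_ge0. Qed.

Lemma homogeneous_geometric_mean v w : homogeneous_fun s (geo v w).
Proof.
have [_ NZ _] := homogeneous_potential s0 nustar.
split; last exact: geometric_mean_ge0.
- move=> A; apply: (@continuous_comp _ _ _ (fun A : MV => N (A *m v) * N (A *m w)) Num.sqrt A).
    by apply: continuousM; exact: continuous_potential_mulmx.
  exact: sqrt_continuous.
- move=> c A; rewrite /geometric_mean -!scalemxAl !NZ mulrACA -expr2.
  by rewrite sqrtrM ?sqr_ge0// sqrtr_sqr ger0_norm ?powR_ge0.
Qed.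

Lemma measurable_geometric_mean v w (X : MV) :
  measurable_fun setT (fun g : GL R n => geo v w (GLmx g *m X)).
Proof.
have [c _ _] := homogeneous_geometric_mean v w.
apply: measurable_continuous_mx c.
by apply: mxmeasurable_mul; [exact: mxmeasurable_GLmx | exact: mxmeasurable_cst].
Qed.

(** The weighted arithmetic-geometric inequality sqrt(p q) <= sqrt(a b) / 2 (p / a + q / b), with a
    = N(X v) and b = N(X w). The averages of p = N(g X v) and q = N(g X w) are K^j a and K^j b. *)
Lemma integral_geometric_mean_le j v w (X : MV) :
  (\int[mu_ j]_g (geo v w (GLmx g *m X))%:E <= (K ^+ j * geo v w X)%:E)%E.
Proof.
have [c c0 Nc] := potential_ge s0 moment nustarE irr.
have zero u : N (X *m u) = 0 -> X *m u = 0.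
  move=> Nu; apply/eqP; apply: contraT => w0; have := Nc (X *m u).
  by rewrite Nu leNgt mulr_gt0// powR_gt0// enorm_gt0.
(* The weights need a and b nonzero; otherwise both sides vanish. *)
have triv : X *m v = 0 \/ X *m w = 0 ->
    (\int[mu_ j]_g (geo v w (GLmx g *m X))%:E <= (K ^+ j * geo v w X)%:E)%E.
  move=> vw; rewrite (_ : (\int[_]_g _ = 0)%E).
    by rewrite lee_fin mulr_ge0 ?exprn_ge0 ?(ltW K0)// geometric_mean_ge0.
  apply: integral0_eq => g _; congr EFin; rewrite /geometric_mean -!mulmxA.
  by case: vw => ->; rewrite mulmx0 (homogeneous0 s0 (homogeneous_potential s0 nustar))
    ?mul0r ?mulr0 sqrtr0.
have [/zero Xv|a0] := eqVneq (N (X *m v)) 0; first by apply: triv; left.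
have [/zero Xw|b0] := eqVneq (N (X *m w)) 0; first by apply: triv; right.
set a := N (X *m v) in a0 *; set b := N (X *m w) in b0 *.
have apos : 0 < a by rewrite lt_neqAle eq_sym a0 N0.
have bpos : 0 < b by rewrite lt_neqAle eq_sym b0 N0.
pose c1 := Num.sqrt (a * b); have c10 : 0 <= c1 by exact: sqrtr_ge0.
have geoE g : geo v w (GLmx g *m X) <=
    c1 / 2 * a^-1 * N (GLmx g *m (X *m v)) + c1 / 2 * b^-1 * N (GLmx g *m (X *m w)).
  rewrite /geometric_mean -!mulmxA; set p := N _; set q := N _.
  have -> : p * q = a * b * (a^-1 * p * (b^-1 * q)).
    by field; rewrite !gt_eqF.
  have ab0 : 0 <= a * b by rewrite ltW// mulr_gt0.
  rewrite (sqrtrM _ ab0) -/c1 -!mulrA -!mulrDr ler_wpM2l// [leRHS]mulrC.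
  have p0 : 0 <= a^-1 * p by rewrite mulr_ge0 ?N0// invr_ge0 ltW.
  have q0 : 0 <= b^-1 * q by rewrite mulr_ge0 ?N0// invr_ge0 ltW.
  by have [] := sqrt_mul_le p0 q0; rewrite -mulrA.
have mp u : measurable_fun setT (fun g : GL R n => N (GLmx g *m u)) by exact: measurable_potential_GL.
apply: le_trans.
  apply: (le_integral_fin (mu_ j)) (fun g => introT andP (conj (geometric_mean_ge0 _ _ _) (geoE g))).
    exact: measurable_geometric_mean.
  by apply: measurable_funD; apply: measurable_funM.
rewrite (integral_lincomb (mp _) (mp _) (fun=> N0 _) (fun=> N0 _) _ _
  (conv_power_potential s0 moment nuE nustarE irr j (X *m v))
  (conv_power_potential s0 moment nuE nustarE irr j (X *m w))); last 2 first.
- by rewrite !divr_ge0// ltW.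
- by rewrite !divr_ge0// ltW.
rewrite lee_fin /geometric_mean -/a -/b -/c1 le_eqVlt; apply/orP; left; apply/eqP; field.
by rewrite !gt_eqF.
Qed.

Lemma shifted_mean_ereal j v w (X : MV) :
  (shift j v w X)%:E = (\int[mu_ j]_g (geo v w (GLmx g *m X))%:E)%E.
Proof.
rewrite unlock; apply: EFin_Rintegral_ge0 => [g|]; first exact: geometric_mean_ge0.
by apply: le_lt_trans (integral_geometric_mean_le j v w X) _; exact: ltry.
Qed.

Lemma shifted_mean_le j v w X : shift j v w X <= K ^+ j * geo v w X.
Proof. by rewrite -lee_fin shifted_mean_ereal; exact: integral_geometric_mean_le. Qed.

Lemma shifted_mean_ge0 j v w X : 0 <= shift j v w X.
Proof.
by rewrite -lee_fin shifted_mean_ereal; apply: integral_ge0 => g _; rewrite lee_fin geometric_mean_ge0.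
Qed.

Lemma continuous_shifted_mean j v w : continuous (shift j v w).
Proof.
have hG := homogeneous_geometric_mean v w; have [cG _ _] := hG.
have [C C0 GC] := homogeneous_le s0 hG.
have [C' C'0 GC'] := conv_power_moment s0 moment nuE nustarE irr.
rewrite unlock; apply: continuous_param_integral => [X|g|M].
- exact: measurable_geometric_mean.
- have c : continuous (fun X : MV => GLmx g *m X).
    by apply: continuous_mulmx => [|X]; [exact: cst_continuous|exact: cvg_id].
  by move=> X; exact: (@continuous_comp _ _ _ (fun X : MV => GLmx g *m X) (geo v w) X (@c X) (cG _)).
- exists (fun g => C * (`|M| `^ s) * enorm (GLmx g) `^ s) => [|X g XM].
    apply/integrableP; split.
      apply/measurable_EFinP; apply: measurable_funM => //.
      by apply: measurable_enorm_powR; exact: mxmeasurable_GLmx.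
    under eq_integral do rewrite /= ger0_norm ?mulr_ge0 ?powR_ge0// EFinM.
    rewrite ge0_integralZl ?lee_fin ?mulr_ge0 ?powR_ge0//; last 2 first.
    + by apply/measurable_EFinP; apply: measurable_enorm_powR; exact: mxmeasurable_GLmx.
    + by move=> g _; rewrite lee_fin powR_ge0.
    rewrite lte_mul_pinfty ?lee_fin ?mulr_ge0 ?powR_ge0//.
    by apply: le_lt_trans (GC' j) _; exact: ltry.
  rewrite ger0_norm ?geometric_mean_ge0// (le_trans (GC _))// -mulrA ler_wpM2l//.
  rewrite -powRM ?enorm_ge0// le_powR_ge0 ?enorm_ge0 ?(ltW s0)//.
  rewrite (le_trans (enormM _ _))// mulrC ler_wpM2r ?enorm_ge0//.
  by rewrite (le_trans XM)// ler_norm.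
Qed.

Lemma homogeneous_shifted_mean j v w : homogeneous_fun s (shift j v w).
Proof.
have [cG GZ G0] := homogeneous_geometric_mean v w.
split; [exact: continuous_shifted_mean|move=> c X|exact: shifted_mean_ge0].
apply: EFin_inj; rewrite EFinM !shifted_mean_ereal.
under eq_integral do rewrite -scalemxAr GZ EFinM.
rewrite ge0_integralZl ?lee_fin ?powR_ge0//.
- by apply/measurable_EFinP; exact: measurable_geometric_mean.
- by move=> g _; rewrite lee_fin.
Qed.

(* Vanishes exactly when Cauchy-Schwarz is an equality for the j-step average. *)
Definition mean_defect j v w X : R := geo v w X - (K ^+ j)^-1 * shift j v w X.

Lemma mean_defect_ge0 j v w X : 0 <= mean_defect j v w X.
Proof.
by rewrite subr_ge0 ler_pdivrMl ?exprn_gt0// shifted_mean_le.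
Qed.

Lemma homogeneous_mean_defect j v w : homogeneous_fun s (mean_defect j v w).
Proof.
have [cG GZ G0] := homogeneous_geometric_mean v w.
have [cS SZ S0] := homogeneous_shifted_mean j v w.
split; last exact: mean_defect_ge0.
- move=> X; apply: continuousB; first exact: cG.
  by apply: (@continuousM _ _ (fun=> (K ^+ j)^-1) (shift j v w)); [exact: cst_continuous|exact: cS].
- by move=> c X; rewrite /mean_defect GZ SZ mulrBr mulrCA.
Qed.

(** The j further factors multiply on the left of g, hence the exchange of k + j into j + k before
    splitting the power, followed by Tonelli's theorem. *)
Lemma integral_shifted_mean j k v w :
  (\int[mu_ k]_g (shift j v w (GLmx g))%:E = (shift (k + j) v w 1%:M)%:E)%E.
Proof.
have mF : measurable_fun setT (fun g : GL R n => (geo v w (GLmx g *m 1%:M))%:E).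
  by apply/measurable_EFinP; exact: measurable_geometric_mean.
have F0 (g : GL R n) : (0 <= (geo v w (GLmx g *m 1%:M))%:E)%E by rewrite lee_fin geometric_mean_ge0.
rewrite shifted_mean_ereal addnC (integral_conv_powerD mu j k mF F0) (convolution_tonelli _ _ mF F0).
apply: eq_integral => g _; rewrite shifted_mean_ereal; apply: eq_integral => h _.
by rewrite mulmx1 GLmxM.
Qed.

Lemma integral_mean_defect j k v w : (\int[mu_ k]_g (mean_defect j v w (GLmx g))%:E =
  (shift k v w 1%:M - (K ^+ j)^-1 * shift (k + j) v w 1%:M)%:E)%E.
Proof.
have [cD _ _] := homogeneous_mean_defect j v w.
have [cS _ _] := homogeneous_shifted_mean j v w.
have mD := measurable_GL_mx cD; have mS := measurable_GL_mx cS.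
have E : (\int[mu_ k]_g (mean_defect j v w (GLmx g))%:E +
    ((K ^+ j)^-1 * shift (k + j) v w 1%:M)%:E = (shift k v w 1%:M)%:E)%E.
  rewrite EFinM -integral_shifted_mean -ge0_integralZl ?lee_fin ?invr_ge0 ?exprn_ge0 ?(ltW K0)//; last 2 first.
  - exact/measurable_EFinP.
  - by move=> g _; rewrite lee_fin shifted_mean_ge0.
  rewrite -ge0_integralD//; last 4 first.
  - by move=> g _; rewrite lee_fin mean_defect_ge0.
  - exact/measurable_EFinP.
  - by move=> g _; rewrite -EFinM lee_fin mulr_ge0 ?shifted_mean_ge0 ?invr_ge0 ?exprn_ge0 ?(ltW K0).
  - by apply: measurable_funeM; exact/measurable_EFinP.
  rewrite shifted_mean_ereal; apply: eq_integral => g _.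
  by rewrite -EFinM -EFinD mulmx1 subrK.
by rewrite EFinB -E addeK.
Qed.

(** The averaged defect is K^k (u_k - u_(k+j)), where u is the normalized mean of the geometric
    mean. Nonnegativity of the defects makes u nonincreasing; being nonnegative it converges, so its
    increments tend to 0. *)
Lemma mean_defect_small j v w (eta : R) : 0 < eta -> exists k0, forall k, (k0 <= k)%N ->
  (\int[mu_ k]_g (mean_defect j v w (GLmx g))%:E <= (eta * K ^+ k)%:E)%E.
Proof.
move=> eta0; pose u k := (K ^+ k)^-1 * shift k v w 1%:M.
have uE i k : (\int[mu_ k]_g (mean_defect i v w (GLmx g))%:E =
    (K ^+ k * (u k - u (k + i)%N))%:E)%E.
  rewrite integral_mean_defect; congr EFin; rewrite /u exprD; field.
  by rewrite !expf_neq0 ?gt_eqF.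
have uni : {homo u : a b / (a <= b)%N >-> b <= a}.
  move=> a b ab; have : (0 <= \int[mu_ a]_g (mean_defect (b - a) v w (GLmx g))%:E)%E.
    by apply: integral_ge0 => g _; rewrite lee_fin mean_defect_ge0.
  by rewrite uE lee_fin subnKC// pmulr_rge0 ?exprn_gt0// subr_ge0.
have u0 k : 0 <= u k by rewrite mulr_ge0 ?invr_ge0 ?exprn_ge0 ?(ltW K0)// shifted_mean_ge0.
have ucv : cvgn u.
  by apply: nonincreasing_is_cvgn => //; exists 0 => _ [k _ <-]; exact: u0.
have /cvgrPdist_lt/(_ _ eta0)[k0 _ Hk0] := ucv.
exists k0 => k kk; rewrite uE lee_fin mulrC ler_wpM2r ?exprn_ge0 ?(ltW K0)//.
have := Hk0 k kk; rewrite /= => /ltr_distlCDr uk.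
have := nonincreasing_cvgn_ge uni ucv (k + j); lra.
Qed.

End Contraction.

(** * Minors and rigidity *)

Section Wedge.
Context {R : realType} {n : nat}.
Local Notation cV := 'cV[R]_n.+1.
Local Notation MV := 'M[R]_n.+1.

(* Measures how far A is from rank one, by its 2 x 2 minors. *)
Definition wedge (A : MV) : R :=
  \sum_(p : ('I_n.+1 * 'I_n.+1) * ('I_n.+1 * 'I_n.+1))
    `|A p.1.1 p.2.1 * A p.1.2 p.2.2 - A p.1.2 p.2.1 * A p.1.1 p.2.2|.

Lemma wedgeZ c A : wedge (c *: A) = c ^+ 2 * wedge A.
Proof.
rewrite /wedge mulr_sumr; apply: eq_bigr => p _; rewrite !mxE.
rewrite (_ : _ - _ = c ^+ 2 * (A p.1.1 p.2.1 * A p.1.2 p.2.2 - A p.1.2 p.2.1 * A p.1.1 p.2.2)).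
  by rewrite normrM ger0_norm ?sqr_ge0.
by ring.
Qed.

Lemma continuous_wedge : continuous wedge.
Proof.
apply: continuous_sumr => p.
have c1 i j : continuous (fun A : MV => A i j).
  by apply: (@continuous_entry R MV _ _ id) => A; exact: cvg_id.
have c2 i j k l : continuous (fun A : MV => A i j * A k l).
  by move=> A; apply: continuousM; exact: c1.
have c3 : continuous (fun A : MV => A p.1.1 p.2.1 * A p.1.2 p.2.2 - A p.1.2 p.2.1 * A p.1.1 p.2.2).
  move=> A; apply: (@continuousB _ _ _ (fun A : MV => A p.1.1 p.2.1 * A p.1.2 p.2.2)
    (fun A => A p.1.2 p.2.1 * A p.1.1 p.2.2)); exact: c2.
by move=> A; exact: (cvg_norm (@c3 A)).
Qed.

(** A nonzero minor lies in two columns k and l, which are therefore linearly independent. *)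
Lemma wedge_neq0 A : wedge A != 0 -> exists k l, forall a b : R, (a, b) != (0, 0) ->
  A *m (a *: delta_mx k ord0 + b *: delta_mx l ord0 : cV) != 0.
Proof.
move=> wA; have [[[i j] [k l]] Aij] : exists p : ('I_n.+1 * 'I_n.+1) * ('I_n.+1 * 'I_n.+1),
    A p.1.1 p.2.1 * A p.1.2 p.2.2 - A p.1.2 p.2.1 * A p.1.1 p.2.2 != 0.
  apply: contrapT => H; move/eqP: wA; apply; apply: big1 => p _.
  by apply/eqP; rewrite normr_eq0; apply: contrapT => /negP Hp; apply: H; exists p.
exists k, l => a b; apply: contraNneq => H.
have E x : a * A x k + b * A x l = 0.
  have /matrixP/(_ x ord0) := H; rewrite mulmxDr -!scalemxAr -!colE !mxE.
  by [].
move: Aij => /=; have := E i; have := E j; set p := A i k; set q := A j l; set r := A j k; set t := A i l.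
move=> Ej Ei d0; rewrite xpair_eqE; apply/andP; split.
  have : a * (p * q - r * t) = 0.
    transitivity (q * (a * p + b * t) - t * (a * r + b * q)); first by ring.
    by rewrite Ei Ej !mulr0 subrr.
  by move/eqP; rewrite mulf_eq0 (negbTE d0) orbF.
have : b * (p * q - r * t) = 0.
  transitivity (p * (a * r + b * q) - r * (a * p + b * t)); first by ring.
  by rewrite Ei Ej !mulr0 subrr.
by move/eqP; rewrite mulf_eq0 (negbTE d0) orbF.
Qed.

End Wedge.

Lemma exponential_gap (R : realType) (c C s t r : R) : 0 < s -> 0 < t -> t < r -> 0 < c ->
  0 <= C -> ~ forall m, c * (r ^+ m) `^ s <= C * (t ^+ m) `^ s.
Proof.
move=> s0 t0 tr c0 C0 H.
have r0 := lt_trans t0 tr.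
have C1 : 0 < 2 * (C + 1) by rewrite mulr_gt0// ltr_wpDl.
pose d := (c / (2 * (C + 1))) `^ s^-1.
have d0 : 0 < d by rewrite powR_gt0// divr_gt0.
have /(@cvg_expr R) : `|t / r| < 1.
  by rewrite ger0_norm ?divr_ge0 ?ltW// ltr_pdivrMr// mul1r.
move=> /cvgrPdist_lt/(_ _ d0)[m _ /(_ m (leqnn m))]; rewrite /= sub0r normrN => /ltr_normlW xd.
have x0 : 0 <= (t / r) ^+ m by rewrite exprn_ge0// divr_ge0// ltW.
have := H m; rewrite (_ : t ^+ m = r ^+ m * (t / r) ^+ m); last first.
  by rewrite -exprMn mulrC divfK// gt_eqF.
rewrite (powRM _ (exprn_ge0 m (ltW r0)) x0) mulrCA [leLHS]mulrC ler_pM2l ?powR_gt0 ?exprn_gt0//.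
apply/negP; rewrite -ltNge; apply: (@le_lt_trans _ _ (C * (c / (2 * (C + 1))))).
  have dE : d `^ s = c / (2 * (C + 1)).
    by rewrite /d -powRrM mulVf ?gt_eqF// powRr1// divr_ge0 ?ltW.
  by rewrite ler_wpM2l// -dE le_powR_ge0 ?(ltW s0)//; exact: ltW.
by rewrite mulrCA gtr_pMr// ltr_pdivrMr//; lra.
Qed.

Section Rigidity.
Context {R : realType} {n : nat}.
Local Notation cV := 'cV[R]_n.+1.
Local Notation MV := 'M[R]_n.+1.
Context (mu : probability (GL R n) R) (s : R) (s0 : 0 < s).
Hypothesis moment : (\int[mu]_g (enorm (GLmx g) `^ s)%:E < +oo)%E.
Context (nu : probability (projspace R n 0) R) (nustar : probability (projspace R 0 n) R).
Context (K : R).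
Hypothesis nuE : eigenmeasure (P_ mu s) K nu.
Hypothesis nustarE : eigenmeasure (Pstar_ mu s) K nustar.
Hypothesis irr : strongly_irreducible (Gamma mu).
Hypothesis prox : exists2 h, Gamma mu h & proximal (GLmx h).
Local Notation N := (potential nustar s).
Local Notation mu_ := (conv_power mu).
Local Notation geo := (geometric_mean N).
Local Notation defect := (mean_defect mu s nustar K).
Let N0 v : 0 <= N v. Proof. exact: potential_ge0. Qed.
Let K0 : 0 < K. Proof. exact: (K_gt0 s0 moment nuE irr). Qed.

Lemma potential_gt0 v : v != 0 -> 0 < N v.
Proof.
have [c c0 Nc] := potential_ge s0 moment nustarE irr.
by move=> v0; apply: lt_le_trans (Nc v); rewrite mulr_gt0// powR_gt0// enorm_gt0.
Qed.

Lemma mean_rigidity v w X : (forall j, defect j v w X = 0) -> X *m v != 0 -> X *m w != 0 ->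
  forall g, Gamma mu g ->
  N (X *m w) * N (GLmx g *m X *m v) = N (X *m v) * N (GLmx g *m X *m w).
Proof.
move=> D0 /potential_gt0; set a := N _ => a0 /potential_gt0; set b := N _ => b0 g gG.
pose H1 (A : MV) := geo v w X / 2 / a * N (A *m X *m v) + geo v w X / 2 / b * N (A *m X *m w).
have abE : geo v w X = Num.sqrt (a * b) by [].
have H2 (A : MV) : geo v w (A *m X) <= H1 A ?= iff (b * N (A *m X *m v) == a * N (A *m X *m w)).
  rewrite /H1 abE; set p := N (A *m X *m v); set q := N (A *m X *m w).
  have p0 : 0 <= a^-1 * p by rewrite mulr_ge0 ?invr_ge0 ?(ltW a0)//; exact: N0.
  have q0 : 0 <= b^-1 * q by rewrite mulr_ge0 ?invr_ge0 ?(ltW b0)//; exact: N0.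
  have ab0 : 0 < a * b by rewrite mulr_gt0.
  have c0 : 0 < Num.sqrt (a * b) by rewrite sqrtr_gt0.
  have -> : geo v w (A *m X) = Num.sqrt (a * b) * Num.sqrt (a^-1 * p * (b^-1 * q)).
    rewrite -sqrtrM ?(ltW ab0)// /geometric_mean -/p -/q; congr Num.sqrt; field.
    by rewrite !gt_eqF.
  rewrite (_ : _ + _ = Num.sqrt (a * b) * ((a^-1 * p + b^-1 * q) / 2)); last by ring.
  have [le eqE] := sqrt_mul_le p0 q0; split; first by rewrite ler_wpM2l ?(ltW c0).
  rewrite (inj_eq (mulfI (lt0r_neq0 c0))) eqE -(inj_eq (mulfI (lt0r_neq0 ab0))).
  have -> : a * b * (a^-1 * p) = b * p by rewrite mulrACA divff ?gt_eqF// mul1r.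
  by have -> : a * b * (b^-1 * q) = a * q by rewrite [a * b]mulrC mulrACA divff ?gt_eqF// mul1r.
have cN u : continuous (fun A : MV => N (A *m X *m u)) by exact: continuous_mulmx_potential.
have cH1 : continuous H1.
  move=> A; apply: (@continuousD _ _ _ (fun A : MV => geo v w X / 2 / a * N (A *m X *m v))
      (fun A => geo v w X / 2 / b * N (A *m X *m w))).
    by apply: (@continuousM _ _ (fun=> geo v w X / 2 / a)); [exact: cst_continuous|exact: cN].
  by apply: (@continuousM _ _ (fun=> geo v w X / 2 / b)); [exact: cst_continuous|exact: cN].
have cH2 : continuous (fun A : MV => geo v w (A *m X)).
  have c : continuous (fun A : MV => A *m X).
    by apply: continuous_mulmx => [A|]; [exact: cvg_id|exact: cst_continuous].
  have [cG _ _] := homogeneous_geometric_mean s0 nustar v w.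
  by move=> A; exact: (@continuous_comp _ _ _ (fun A : MV => A *m X) (geo v w) A (@c A) (cG _)).
have cH : continuous (fun A : MV => H1 A - geo v w (A *m X)).
  by move=> A; apply: (@continuousB _ _ _ H1 (fun A : MV => geo v w (A *m X))); [exact: cH1|exact: cH2].
have Hint j : (\int[mu_ j]_g (H1 (GLmx g) - geo v w (GLmx g *m X))%:E = 0)%E.
  apply: (@integral_sub_eq0 _ _ _ _ _ _ (K ^+ j * geo v w X)).
  - exact: (measurable_GL_mx cH1).
  - exact: (measurable_GL_mx cH2).
  - by move=> g'; rewrite geometric_mean_ge0/=; have [] := H2 (GLmx g').
  - rewrite /H1; under eq_integral do rewrite -!mulmxA.
    rewrite (integral_lincomb _ _ _ _ _ _
      (conv_power_potential s0 moment nuE nustarE irr j (X *m v))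
      (conv_power_potential s0 moment nuE nustarE irr j (X *m w))) -/a -/b.
    + by congr EFin; field; rewrite !gt_eqF.
    + exact: measurable_potential_GL.
    + exact: measurable_potential_GL.
    + by move=> g'; exact: N0.
    + by move=> g'; exact: N0.
    + by rewrite !divr_ge0 ?geometric_mean_ge0// ltW.
    + by rewrite !divr_ge0 ?geometric_mean_ge0// ltW.
  - rewrite -(shifted_mean_ereal s0 moment nuE nustarE irr); congr EFin.
    have /eqP := D0 j; rewrite subr_eq0 => /eqP ->.
    by rewrite mulVKf// expf_neq0// gt_eqF.
apply/eqP; have [le eqE] := H2 (GLmx g); rewrite -eqE eq_sym -subr_eq0.
(* If the difference were positive at g, it would be positive on an open set charged by some
   convolution power. *)
apply: contraT => ne; pose U := [set g : GL R n | 0 < H1 (GLmx g) - geo v w (GLmx g *m X)].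
have Ug : U g by rewrite /U/= lt_neqAle eq_sym ne subr_ge0.
have oU : open U.
  rewrite (_ : U = (fun g : GL R n => H1 (GLmx g) - geo v w (GLmx g *m X)) @^-1` [set x | 0 < x])//.
  apply: open_comp; last exact: open_gt.
  move=> g' _; apply: (@continuous_comp _ _ _ (@GLmx R n) (fun A : MV => H1 A - geo v w (A *m X)) g').
    exact: continuous_GLmx.
  exact: cH.
have [j] := Gamma_conv_power gG oU Ug.
have /ae_zero_integral : (\int[mu_ j]_g (H1 (GLmx g) - geo v w (GLmx g *m X))%:E = 0)%E by exact: Hint.
move=> [||B [mB B0 UB]].
- exact: (measurable_GL_mx cH).
- by move=> g'; rewrite subr_ge0; have [] := H2 (GLmx g').
rewrite lt_neqAle => /andP[/eqP + _]; case; apply/esym/eqP.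
rewrite eq_le measure_ge0 andbT -B0 le_measure ?inE//; first exact: open_GL_measurable.
by move=> g' Ug'; apply: UB => /= E0; move: Ug'; rewrite /U/= E0 ltxx.
Qed.

(* Otherwise N(gXv) / N(gXw) would not depend on g in Gamma.  With Q the spectral    *)
(* projection, up to a factor, of a proximal h, powers of h then force Q g X v = 0     *)
(* as soon as Q g X w = 0 for some w with X w <> 0; such a w exists as Q has rank one *)
(* and X does not, and irreducibility gives Q = 0. *)
Lemma mean_defect_neq0 X : wedge X != 0 -> exists j v w, 0 < defect j v w X.
Proof.
move=> /wedge_neq0[k [l kl]]; apply: contrapT => H.
have D0 j v w : defect j v w X = 0.
  apply/eqP; apply: contraT => D0; case: H; exists j, v, w.
  by rewrite lt_neqAle eq_sym D0 (mean_defect_ge0 s0 moment nuE nustarE irr).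
have [h hG hp] := prox.
have [Q [r [t [[/andP[t0 tr] hQ Qh] [Q0 Qgrow Qline]]]]] := proximal_split (GLmx_unit h) hp.
have GM g1 g2 : Gamma mu g1 -> Gamma mu g2 -> Gamma mu (GLM g1 g2).
  by move=> G1 G2 S HS; have [[_ SM] _] := HS; apply: SM; [exact: G1|exact: G2].
have key g (v w : cV) : Gamma mu g -> X *m w != 0 -> Q *m (GLmx g *m X *m w) = 0 ->
    Q *m (GLmx g *m X *m v) = 0.
  move=> gG Xw0 Qw.
  rewrite -!mulmxA in Qw *.
  have [->|Xv0] := eqVneq (X *m v) 0; first by rewrite !mulmx0.
  apply/eqP; apply: contraT => Qv.
  have hg m : exists2 gm, Gamma mu gm & GLmx gm = GLmx h ^+ m *m GLmx g.
    elim: m => [|m [gm gmG gmE]]; first by exists g => //; rewrite expr0 mul1mx.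
    by exists (GLM h gm); [exact: GM|rewrite GLmxM gmE mulmxA exprS].
  have rig m : N (X *m w) * N (GLmx h ^+ m *m (GLmx g *m (X *m v))) =
      N (X *m v) * N (GLmx h ^+ m *m (GLmx g *m (X *m w))).
    have [gm gmG gmE] := hg m.
    have := mean_rigidity (fun j => D0 j v w) Xv0 Xw0 gmG.
    by rewrite gmE -!mulmxA.
  have [c c0 Nc] := potential_ge s0 moment nustarE irr.
  have [C C0 NC] := homogeneous_le s0 (homogeneous_potential s0 nustar).
  have [C1 C10 grow] := Qgrow _ Qw.
  set y := GLmx g *m (X *m v) in Qv rig *; set z := GLmx g *m (X *m w) in grow rig Qw *.
  have Qhm m : Q *m (GLmx h ^+ m *m y) = r ^+ m *: (Q *m y).
    elim: m => [|m IH]; first by rewrite !expr0 mul1mx scale1r.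
    by rewrite exprS -mulmxA [LHS]mulmxA Qh -scalemxAl IH scalerA -exprS.
  have Qpos : 0 < enorm Q by rewrite enorm_gt0.
  (* As Q h^m y = r^m Q y, the vector h^m y has norm at least c2 |r|^m, whereas z is in the kernel
     of Q and h^m z grows at most like t^m. The proportionality [rig] forbids this discrepancy. *)
  pose c2 := enorm (Q *m y) / enorm Q.
  have c20 : 0 < c2 by rewrite divr_gt0// enorm_gt0.
  have ylow m : c2 * `|r| ^+ m <= enorm (GLmx h ^+ m *m y).
    rewrite /c2 mulrAC ler_pdivrMr// mulrC -normrX -enormZ -Qhm.
    by rewrite (le_trans (enormM _ _))// mulrC.
  exfalso; apply: (@exponential_gap _ (N (X *m w) * (c * c2 `^ s)) (N (X *m v) * (C * C1 `^ s)) s t `|r|) => //.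
  - by rewrite !mulr_gt0 ?powR_gt0//; exact: potential_gt0.
  - by rewrite !mulr_ge0 ?powR_ge0.
  - move=> m; rewrite -!mulrA -!powRM ?exprn_ge0 ?(ltW c20) ?(ltW t0)//.
    apply: (@le_trans _ _ (N (X *m w) * N (GLmx h ^+ m *m y))).
      rewrite ler_wpM2l// (le_trans _ (Nc _))// ler_wpM2l ?(ltW c0)//.
      apply: le_powR_ge0 => //; first exact: ltW.
      by rewrite mulr_ge0 ?(ltW c20)// exprn_ge0.
    rewrite rig ler_wpM2l// (le_trans (NC _))// ler_wpM2l//.
    by rewrite le_powR_ge0 ?(ltW s0) ?enorm_ge0.
have Qall g (v : cV) : Gamma mu g -> Q *m (GLmx g *m X *m v) = 0.
  move=> gG; have [a [b [ab Qab]]] := Qline (GLmx g *m X *m delta_mx k ord0) (GLmx g *m X *m delta_mx l ord0).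
  apply: (key g v _ gG (kl a b ab)).
  by rewrite -[RHS]Qab mulmxDr -!scalemxAr.
pose Z (u : cV) := forall g, Gamma mu g -> Q *m (GLmx g *m u) = 0.
have [|g u gG Zu|Z0|Z1] := irreducible_linear_pred irr (Z := Z).
- split=> [g _|a u v Zu Zv g gG]; first by rewrite !mulmx0.
  by rewrite !mulmxDr -!scalemxAr Zu// Zv// scaler0 addr0.
- by move=> g' g'G; rewrite [GLmx g' *m _]mulmxA -GLmxM; apply: Zu; exact: GM.
- have : Z (X *m delta_mx k ord0) by move=> g gG; rewrite [GLmx g *m _]mulmxA; exact: Qall.
  move/Z0 => Xk; have := kl 1 0; rewrite scale1r scale0r addr0 Xk eqxx.
  by rewrite xpair_eqE oner_eq0 => /(_ isT).
- move/eqP: Q0; apply; apply/matrixP => i j; rewrite mxE.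
  have := Z1 (delta_mx j ord0) h hG; rewrite mulmxA Qh -scalemxAl => /eqP.
  rewrite scaler_eq0 -normr_eq0 gt_eqF ?(lt_trans t0 tr)//= -colE => /eqP/matrixP/(_ i ord0).
  by rewrite !mxE.
Qed.

Lemma mean_defects_small (l : seq ((nat * (cV * cV)) * nat)) (eta : R) : 0 < eta ->
  exists k0, forall k, (k0 <= k)%N -> (\int[mu_ k]_g
    (\sum_(i <- l) i.2.+1%:R * defect i.1.1 i.1.2.1 i.1.2.2 (GLmx g))%:E <= (eta * K ^+ k)%:E)%E.
Proof.
have mD i : measurable_fun setT
    (fun g : GL R n => i.2.+1%:R * defect i.1.1 i.1.2.1 i.1.2.2 (GLmx g)).
  apply: measurable_funM; first exact: measurable_cst.
  by apply: measurable_GL_mx; have [] := homogeneous_mean_defect s0 moment nuE nustarE irr i.1.1 i.1.2.1 i.1.2.2.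
have D0 (i : (nat * (cV * cV)) * nat) (A : MV) : 0 <= i.2.+1%:R * defect i.1.1 i.1.2.1 i.1.2.2 A.
  by rewrite mulr_ge0// (mean_defect_ge0 s0 moment nuE nustarE irr).
elim: l eta => [|i l IH] eta eta0.
  exists 0%N => k _; under eq_integral do rewrite big_nil.
  by rewrite integral0 lee_fin mulr_ge0 ?exprn_ge0 ?ltW.
have e1 : 0 < eta / 2 / i.2.+1%:R by rewrite !divr_gt0.
have [k1 H1] := mean_defect_small s0 moment nuE nustarE irr i.1.1 i.1.2.1 i.1.2.2 e1.
have e2 : 0 < eta / 2 by rewrite divr_gt0.
have [k2 H2] := IH _ e2.
exists (maxn k1 k2) => k; rewrite geq_max => /andP[kk1 kk2].
under eq_integral do rewrite big_cons EFinD.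
rewrite ge0_integralD//; last 4 first.
- by move=> g _; rewrite lee_fin.
- exact/measurable_EFinP.
- by move=> g _; rewrite lee_fin sumr_ge0.
- by apply/measurable_EFinP; apply: measurable_sum.
rewrite (_ : eta * K ^+ k = eta / 2 * K ^+ k + eta / 2 * K ^+ k); last by lra.
rewrite EFinD leeD ?H2//.
under eq_integral do rewrite EFinM.
rewrite ge0_integralZl//; last 2 first.
- apply/measurable_EFinP.
  by apply: measurable_GL_mx; have [] := homogeneous_mean_defect s0 moment nuE nustarE irr i.1.1 i.1.2.1 i.1.2.2.
- by move=> g _; rewrite lee_fin (mean_defect_ge0 s0 moment nuE nustarE irr).
apply: (@le_trans _ _ (i.2.+1%:R%:E * (eta / 2 / i.2.+1%:R * K ^+ k)%:E)%E).
  by rewrite lee_pmul2l ?H1// lte_fin.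
rewrite -EFinM lee_fin le_eqVlt; apply/orP; left; apply/eqP; field.
by rewrite nat1r pnatr_eq0.
Qed.

(** On the compact set of unit matrices with [wedge] at least e, each point has some positive
    defect, hence lies in an open set where a suitable integer multiple of that defect exceeds 1. A
    finite subcover gives the sum, and homogeneity removes the normalization of A. *)
Lemma wedge_cover (e : R) : 0 < e -> exists l : seq ((nat * (cV * cV)) * nat),
  forall A : MV, e * enorm A ^+ 2 <= wedge A ->
  enorm A `^ s <= \sum_(i <- l) i.2.+1%:R * defect i.1.1 i.1.2.1 i.1.2.2 A.
Proof.
move=> e0; pose S := [set A : MV | enorm A = 1] `&` [set A | e <= wedge A].
have hD := homogeneous_mean_defect s0 moment nuE nustarE irr.
have D0 (i : (nat * (cV * cV)) * nat) (A : MV) : 0 <= i.2.+1%:R * defect i.1.1 i.1.2.1 i.1.2.2 A.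
  by rewrite mulr_ge0// (mean_defect_ge0 s0 moment nuE nustarE irr).
have cS : compact S.
  apply: (subclosed_compact _ (@compact_sphere R n.+1 n.+1)); last by move=> A [].
  apply: closedI.
    rewrite (_ : [set A | _] = (@enorm R n.+1 n.+1) @^-1` [set 1])//.
    by apply: closed_comp => [A _|]; [exact: continuous_enorm|exact: closed_eq].
  rewrite (_ : [set A | _] = (@wedge R n) @^-1` [set x | e <= x])//.
  by apply: closed_comp => [A _|]; [exact: continuous_wedge|exact: closed_ge].
move: cS; rewrite compact_cover => /(_ ((nat * (cV * cV)) * nat)%type setT
  (fun i => [set A : MV | 1 < i.2.+1%:R * defect i.1.1 i.1.2.1 i.1.2.2 A])) [i _|A [/= A1 eA]|D _ SD].
- have [cD _ _] := hD i.1.1 i.1.2.1 i.1.2.2.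
  rewrite (_ : [set A | _] = (fun A => i.2.+1%:R * defect i.1.1 i.1.2.1 i.1.2.2 A) @^-1` [set x | 1 < x])//.
  apply: open_comp; last exact: open_gt.
  move=> A _; apply: (@continuousM _ _ (fun=> i.2.+1%:R) (defect i.1.1 i.1.2.1 i.1.2.2)); last exact: cD.
  exact: cst_continuous.
- have [j [v [w D1]]] : exists j v w, 0 < defect j v w A.
    by apply: mean_defect_neq0; rewrite gt_eqF// (lt_le_trans e0).
  have [m _ /(_ m (leqnn m))] := nbhs_infty_gtr (defect j v w A)^-1.
  move=> /= mD; exists ((j, (v, w)), m) => //=.
  rewrite -ltr_pdivrMr// div1r (lt_trans mD)// ltr_nat//.
exists (finmap.enum_fset D) => A eA.
have [->|A0] := eqVneq A 0.
  by rewrite enorm0 powR0 ?gt_eqF// sumr_ge0.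
have Ap : 0 < enorm A by rewrite enorm_gt0.
have AS : S ((enorm A)^-1 *: A).
  split; first by rewrite /= enormZ ger0_norm ?invr_ge0 ?(ltW Ap)// mulVf ?gt_eqF.
  by rewrite /= wedgeZ exprVn mulrC ler_pdivlMr// exprn_gt0.
have [i iD] := SD _ AS; rewrite /= => Di.
rewrite (big_rem i)//= ler_wpDr ?sumr_ge0//.
have [_ DZ _] := hD i.1.1 i.1.2.1 i.1.2.2.
have -> : A = enorm A *: ((enorm A)^-1 *: A) by rewrite scalerA divff ?gt_eqF// scale1r.
rewrite DZ enormZ mulrCA ger0_norm ?(ltW Ap)//.
have [/= -> _] := AS; rewrite mulr1 ler_peMr ?powR_ge0//; exact: ltW.
Qed.

Lemma measurable_wedge_large (e : R) : measurable_fun setT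
  (fun g : GL R n => (e * enorm (GLmx g) ^+ 2 <= wedge (GLmx g))%R%:R : R).
Proof.
apply: measurable_natr_bool; apply: measurable_fun_ler.
  apply: measurable_funM; first exact: measurable_cst.
  apply: measurable_funX; exact: measurable_GL_mx (@continuous_enorm _ _ _).
exact: measurable_GL_mx (@continuous_wedge _ _).
Qed.

Lemma wedge_small (e eta : R) : 0 < e -> 0 < eta -> exists k0, forall k, (k0 <= k)%N ->
  (\int[mu_ k]_g ((e * enorm (GLmx g) ^+ 2 <= wedge (GLmx g))%R%:R * enorm (GLmx g) `^ s)%:E
    <= (eta * K ^+ k)%:E)%E.
Proof.
move=> /wedge_cover[l Hl] /(mean_defects_small l)[k0 Hk0]; exists k0 => k /Hk0; apply: le_trans.
apply: le_integral_fin => [||g].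
- apply: measurable_funM; last by apply: measurable_enorm_powR; exact: mxmeasurable_GLmx.
  exact: measurable_wedge_large.
- apply: measurable_sum => i; apply: measurable_funM; first exact: measurable_cst.
  by apply: measurable_GL_mx; have [] := homogeneous_mean_defect s0 moment nuE nustarE irr i.1.1 i.1.2.1 i.1.2.2.
- rewrite mulr_ge0 ?powR_ge0//=; case: (boolP (e * _ <= _)) => [/Hl|_]; first by rewrite mul1r.
  rewrite mul0r sumr_ge0// => i _.
  by rewrite mulr_ge0// (mean_defect_ge0 s0 moment nuE nustarE irr).
Qed.

End Rigidity.

(** * The drift inequality *)

Section Condition.
Context {R : realType} {n : nat}.
Local Notation rV := 'rV[R]_n.+1.
Local Notation MV := 'M[R]_n.+1.

Lemma measurable_det d (T : measurableType d) m (A : T -> 'M[R]_m) : mxmeasurable A ->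
  measurable_fun setT (fun t => \det (A t)).
Proof.
move=> mA; apply: measurable_sum => s; apply: measurable_funM; first exact: measurable_cst.
by apply: measurable_prod => i _; exact: mA.
Qed.

Lemma measurable_enorm_inv : measurable_fun setT (fun g : GL R n => enorm (invmx (GLmx g))).
Proof.
have E (g : GL R n) : enorm (invmx (GLmx g)) = `|\det (GLmx g)| `^ (-1) * enorm (\adj (GLmx g)).
  by rewrite /invmx GLmx_unit enormZ normfV powR_inv1.
under eq_fun do rewrite E.
have mG := @mxmeasurable_GLmx R n.
apply: measurable_funM.
  apply: (measurableT_comp (measurable_powR (-1))).
  by apply: measurableT_comp; [exact: normr_measurable|exact: measurable_det].
apply: measurable_continuous_mx; last exact: continuous_enorm.
move=> i j; under eq_fun do rewrite mxE /cofactor.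
apply: measurable_funM; first exact: measurable_cst.
by apply: measurable_det => a b; under eq_fun do rewrite !mxE; exact: mG.
Qed.

Definition condition_number (A : MV) : R := enorm A * enorm (invmx A).

Lemma measurable_condition_number :
  measurable_fun setT (fun g : GL R n => condition_number (GLmx g)).
Proof.
apply: measurable_funM; last exact: measurable_enorm_inv.
exact: measurable_GL_mx (@continuous_enorm _ _ _).
Qed.

Lemma condition_number_ge0 A : 0 <= condition_number A.
Proof. by rewrite mulr_ge0 ?enorm_ge0. Qed.

Lemma condition_number_ge1 (g : GL R n) : 1 <= condition_number (GLmx g).
Proof.
have [f f1] := @enorm_sphere_neq0 R 0 n.
have := enormM (f *m GLmx g) (invmx (GLmx g)).
rewrite mulmxK ?GLmx_unit// f1 => /le_trans; apply.
by rewrite ler_wpM2r ?enorm_ge0// (le_trans (enormM _ _))// f1 mul1r.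
Qed.

Lemma condition_numberM (g h : GL R n) :
  condition_number (GLmx (GLM g h)) <= condition_number (GLmx g) * condition_number (GLmx h).
Proof.
have invE : invmx (GLmx (GLM g h)) = invmx (GLmx h) *m invmx (GLmx g).
  rewrite -[RHS](mulKmx (GLmx_unit (GLM g h))) GLmxM -mulmxA mulKVmx ?GLmx_unit//.
  by rewrite mulmxV ?GLmx_unit// mulmx1.
rewrite /condition_number invE mulrACA ler_pM ?enorm_ge0//; first exact: enormM.
by rewrite mulrC enormM.
Qed.

Lemma enorm_rowM_ge (f : rV) (g : GL R n) : enorm f = 1 ->
  enorm (GLmx g) <= condition_number (GLmx g) * enorm (f *m GLmx g).
Proof.
move=> f1; rewrite /condition_number -mulrA ler_peMr ?enorm_ge0// mulrC.
by rewrite -{1}f1 -{1}(mulmxK (GLmx_unit g) f) enormM.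
Qed.

End Condition.

Section InverseCutoff.
Context {R : realType}.
Implicit Types a t e : R.

(* A truncation of t ^ (-a), which avoids the junk value of the inverse at t = 0. *)
Definition inv_cutoff a e t : R := (Num.max t e `^ a)^-1.

Lemma inv_cutoff_gt0 a e t : 0 < e -> 0 < inv_cutoff a e t.
Proof. by move=> e0; rewrite invr_gt0 powR_gt0// lt_max e0 orbT. Qed.

Lemma inv_cutoff_nonincreasing a e t t' : 0 <= a -> 0 < e -> t <= t' ->
  inv_cutoff a e t' <= inv_cutoff a e t.
Proof.
move=> a0 e0 tt; have m0 u : 0 < Num.max u e by rewrite lt_max e0 orbT.
rewrite lef_pV2 ?posrE ?powR_gt0// le_powR_ge0 ?(ltW (m0 _))//.
by rewrite ge_max !le_max tt lexx orbT.
Qed.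

Lemma inv_cutoff_le a e t : 0 <= a -> 0 < e -> inv_cutoff a e t <= (e `^ a)^-1.
Proof.
move=> a0 e0; rewrite lef_pV2 ?posrE ?powR_gt0 ?lt_max ?e0 ?orbT//.
by rewrite le_powR_ge0 ?(ltW e0)// le_max lexx orbT.
Qed.

Lemma inv_cutoff_scale a e t c : 0 <= a -> 0 < e -> 0 <= t -> 1 <= c ->
  inv_cutoff a e (t / c) <= c `^ a * inv_cutoff a e t.
Proof.
move=> a0 e0 t0 c1; have c0 : 0 < c by exact: lt_le_trans c1.
have m0 u : 0 < Num.max u e by rewrite lt_max e0 orbT.
rewrite ler_pdivlMr ?powR_gt0// ler_pdivrMl ?powR_gt0// -powRM ?(ltW c0) ?(ltW (m0 _))//.
rewrite le_powR_ge0 ?(ltW (m0 _))// [leRHS]mulrC.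
rewrite ge_max -ler_pdivrMl// [c^-1 * t]mulrC le_max lexx/=.
rewrite -[leLHS]mul1r ler_pM ?(ltW e0)// le_max lexx orbT//.
Qed.

Lemma continuous_inv_cutoff a e : 0 < a -> 0 < e -> continuous (inv_cutoff a e).
Proof.
move=> a0 e0 t; have m0 u : 0 < Num.max u e by rewrite lt_max e0 orbT.
apply: cvgV; first by rewrite gt_eqF// powR_gt0.
rewrite (_ : (fun t => _) = (fun u : R => `|u| `^ a) \o (fun t => Num.max t e)); last first.
  by apply/funext => u /=; rewrite ger0_norm ?ltW.
have -> : Num.max t e `^ a = `|Num.max t e| `^ a by rewrite ger0_norm ?ltW.
apply: (@continuous_comp _ _ _ (fun t => Num.max t e) (fun u : R => `|u| `^ a) t).
  by apply: continuous_max => //; exact: cst_continuous.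
exact: continuous_powR_norm.
Qed.

End InverseCutoff.

Section DriftBound.
Context {R : realType} {n : nat}.
Local Notation cV := 'cV[R]_n.+1.
Local Notation rV := 'rV[R]_n.+1.
Local Notation MV := 'M[R]_n.+1.

Lemma enorm_le_sum m k (A : 'M[R]_(m, k)) : enorm A <= \sum_p `|A p.1 p.2|.
Proof.
have S0 : 0 <= \sum_p `|A p.1 p.2| by apply: sumr_ge0.
rewrite -(ler_pXn2r (ltn0Sn 1)) ?nnegrE ?enorm_ge0// enorm_sqr.
suff [] : \sum_p A p.1 p.2 ^+ 2 <= (\sum_p `|A p.1 p.2|) ^+ 2 /\ 0 <= \sum_p `|A p.1 p.2| by [].
apply: (big_rec2 (fun x y => x <= y ^+ 2 /\ 0 <= y)); first by rewrite expr0n.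
move=> p x y _ [yx y0]; split; last exact: addr_ge0.
rewrite -[A _ _ ^+ 2]real_normK ?num_real// sqrrD.
by rewrite lerD// ler_wpDr// mulrn_wge0// mulr_ge0.
Qed.

(* The entries of the matrix (Av)(fA) - (fAv)A pair f and v with 2 x 2 minors of A. *)
Lemma bracket_wedge (f : rV) (v : cV) (A : MV) :
  enorm (f *m A) * enorm (A *m v) <=
  bracket f (A *m v) * enorm A + enorm f * enorm v * wedge A.
Proof.
pose c := (f *m (A *m v)) ord0 ord0.
have -> : bracket f (A *m v) * enorm A = enorm (c *: A).
  by rewrite enormZ /bracket enorm_scalar.
rewrite mulrC -enormMdyad -lerBlDl.
pose W := (A *m v) *m (f *m A) - c *: A.
have -> : A *m v *m (f *m A) = W + c *: A by rewrite subrK.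
apply: (@le_trans _ _ (enorm W)); first by rewrite lerBlDr enormD.
have WE x y : `|W x y| <= enorm f * enorm v *
    \sum_(q : 'I_n.+1 * 'I_n.+1) `|A x q.1 * A q.2 y - A q.2 q.1 * A x y|.
  have -> : W x y = \sum_(q : 'I_n.+1 * 'I_n.+1)
      (f ord0 q.2 * v q.1 ord0) * (A x q.1 * A q.2 y - A q.2 q.1 * A x y).
    rewrite /W /c !mxE big_ord1 !mxE big_distrlr/= mulr_suml.
    rewrite -(pair_bigA _ (fun k l => f ord0 l * v k ord0 * (A x k * A l y - A l k * A x y)))/=.
    under [X in _ - X]eq_bigr do rewrite mxE mulr_sumr mulr_suml.
    rewrite [X in _ - X]exchange_big/= -sumrB; apply: eq_bigr => k _.
    by rewrite -sumrB; apply: eq_bigr => l _; ring.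
  rewrite mulr_sumr (le_trans (ler_norm_sum _ _ _))//; apply: ler_sum => q _.
  by rewrite normrM ler_wpM2r// normrM ler_pM// entry_le_enorm.
apply: (le_trans (enorm_le_sum W)).
apply: (le_trans (ler_sum _ (fun p _ => WE p.1 p.2))).
pose h (P : ('I_n.+1 * 'I_n.+1) * ('I_n.+1 * 'I_n.+1)) := ((P.1.1, P.2.2), (P.2.1, P.1.2)).
have hK : involutive h by case=> -[? ?] [? ?].
rewrite -mulr_sumr pair_bigA/= /wedge [X in _ <= _ * X](reindex_inj (inv_inj hK))/=.
by [].
Qed.

Lemma inv_cutoff_ge (a e t t0 : R) : 0 <= a -> 0 < e -> 0 < t0 -> t0 <= t ->
  inv_cutoff a e t <= (t0 `^ a)^-1.
Proof.
move=> a0 e0 t00 tt; rewrite lef_pV2 ?posrE ?powR_gt0 ?lt_max ?e0 ?orbT//.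
by rewrite le_powR_ge0 ?(ltW t00)// le_max tt.
Qed.

(* The s-homogeneous function equal to the truncation of |<f, v>| ^ (-a) on the sphere. *)
Definition drift_fun (s a r : R) (f : rV) (v : cV) : R :=
  enorm v `^ s * inv_cutoff a r (bracket f v / enorm v).

Lemma homogeneous_drift_fun (s a r : R) f : 0 < s -> 0 < a -> 0 < r ->
  homogeneous_fun s (drift_fun s a r f).
Proof.
move=> s0 a0 r0.
have hE : homogeneous_fun s (fun v : cV => enorm v `^ s).
  apply: homogeneous_powR_enorm => //; last exact: enorm_ge0.
    exact: continuous_enorm.
  by move=> c v; rewrite enormZ.
have [cE EZ E0] := hE.
have ge0 v : 0 <= drift_fun s a r f v by rewrite mulr_ge0 ?powR_ge0// ltW// inv_cutoff_gt0.
split => // [v|c v]; last first.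
  rewrite /drift_fun EZ -mulrA; have [->|c0] := eqVneq c 0.
    by rewrite normr0 (powR0 (lt0r_neq0 s0)) 2!mul0r.
  congr (_ * (_ * inv_cutoff _ _ _)).
  rewrite bracketZr enormZ invfM mulrACA divff ?mul1r// normr_eq0//.
have [->|v0] := eqVneq v 0; last first.
  apply: (@continuousM _ _ (fun v : cV => enorm v `^ s)); first exact: cE.
  apply: (@continuous_comp _ _ _ (fun v : cV => bracket f v / enorm v) (inv_cutoff a r) v).
    apply: (@continuousM _ _ (bracket f)); first exact: continuous_bracketr.
    by apply: continuousV; [rewrite enorm_eq0|exact: continuous_enorm].
  exact: continuous_inv_cutoff.
rewrite /continuous_at {2}/drift_fun enorm0 (powR0 (lt0r_neq0 s0)) mul0r.
apply: (@squeeze_cvgr _ (nbhs (0 : cV)) _ R (fun=> 0) (fun v : cV => (r `^ a)^-1 * enorm v `^ s)).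
- apply: nearW => w; rewrite ge0/= /drift_fun mulrC ler_wpM2r ?powR_ge0//.
  by apply: inv_cutoff_le => //; exact: ltW.
- exact: cvg_cst.
- rewrite -[X in _ --> X](mulr0 (r `^ a)^-1); apply: cvgMr.
  by have := cE 0; rewrite /continuous_at enorm0 (powR0 (lt0r_neq0 s0)).
Qed.

(** With f' = f g / |f g| one has |<f, g u>| / |g u| = |<f', u>| |f g| / |g u|, so the truncated
    power worsens only when |g u| exceeds |f g|. The three terms correspond to a good g that shrinks
    u, a bad g, and a good g that does not shrink u; the last one no longer involves f'. *)
Lemma drift_fun_bound (s a r e : R) (f : rV) (u : cV) (g : GL R n) :
  0 < s -> 0 < a -> 0 < r -> 0 < e -> e <= 1 / 2 -> enorm f = 1 -> enorm u = 1 ->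
  drift_fun s a r f (GLmx g *m u) <= enorm (GLmx g) `^ s *
    (((2 * e ^+ 2) `^ s +
      ((enorm (f *m GLmx g) < e * enorm (GLmx g))%R%:R + (e ^+ 3 * enorm (GLmx g) ^+ 2 <= wedge (GLmx g))%R%:R) *
        condition_number (GLmx g) `^ a) *
     inv_cutoff a r (bracket ((enorm (f *m GLmx g))^-1 *: (f *m GLmx g)) u)
     + ((e / 2) `^ a)^-1).
Proof.
move=> s0 a0 r0 e0 e2 f1 u1; rewrite /drift_fun; set A := GLmx g.
set p := enorm (f *m A); set q := enorm (A *m u); set b := bracket f (A *m u).
have p0 : 0 < p.
  rewrite enorm_gt0; apply/eqP => fA; move: f1.
  by rewrite -(mulmxK (GLmx_unit g) f) fA mul0mx enorm0 => /esym/eqP; rewrite oner_eq0.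
have q0 : 0 < q.
  rewrite enorm_gt0; apply/eqP => uA; move: u1.
  by rewrite -(mulKmx (GLmx_unit g) u) uA mulmx0 enorm0 => /esym/eqP; rewrite oner_eq0.
have b0 : 0 <= b by exact: bracket_ge0.
have A0 : 0 < enorm A by exact: enorm_unitmx_gt0.
have qA : q <= enorm A by rewrite (le_trans (enormM _ _))// u1 mulr1.
have -> : bracket (p^-1 *: (f *m A)) u = b / p.
  by rewrite bracketZl bracketA ger0_norm ?invr_ge0 ?(ltW p0)// mulrC.
have V0 t : 0 <= inv_cutoff a r t by rewrite ltW// inv_cutoff_gt0.
have c0 : 0 <= condition_number A `^ a by exact: powR_ge0.
have e2s : 0 <= (2 * e ^+ 2) `^ s by exact: powR_ge0.
have ea : 0 <= ((e / 2) `^ a)^-1 by rewrite invr_ge0 powR_ge0.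
set bad := _%:R + _%:R.
have [good|bad1] : bad = 0 \/ 1 <= bad.
  by rewrite /bad -natrD ler1n; case: (_ < _); case: (_ <= _); [right|right|right|left].
- have [fA wA] : e * enorm A <= p /\ wedge A <= e ^+ 3 * enorm A ^+ 2.
    move/eqP: good; rewrite /bad paddr_eq0// !pnatr_eq0 !eqb0 -leNgt -ltNge => /andP[-> /ltW].
    by [].
  rewrite good mul0r addr0.
  (* Below the threshold, |g u| <= e |g| <= |f g| since 2 e <= 1, and the weight |g u|^s is small.
     Above it, the error e^3 |g|^2 from the minors is less than half of e |g| |g u|, so
     [bracket_wedge] leaves |<f, g u>| >= (e / 2) |g u|. *)
  have [qe|qe] := leP q (2 * e ^+ 2 * enorm A).
    apply: (@le_trans _ _ (enorm A `^ s * ((2 * e ^+ 2) `^ s * inv_cutoff a r (b / p)))); last first.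
      by rewrite ler_wpM2l ?powR_ge0// lerDl.
    rewrite mulrA ler_pM ?powR_ge0//.
      rewrite -powRM ?enorm_ge0// ?mulr_ge0 ?exprn_ge0 ?(ltW e0)//.
      by rewrite le_powR_ge0 ?(ltW s0) ?(ltW q0)// mulrC.
    apply: inv_cutoff_nonincreasing => //; first exact: ltW.
    rewrite ler_wpM2l// lef_pV2 ?posrE//.
    apply: (le_trans qe); apply: le_trans fA; rewrite ler_wpM2r ?(ltW A0)//.
    by rewrite expr2 mulrA ler_piMl ?(ltW e0)//; lra.
  apply: (@le_trans _ _ (enorm A `^ s * ((e / 2) `^ a)^-1)); last first.
    by rewrite ler_wpM2l ?powR_ge0// lerDr mulr_ge0.
  rewrite ler_pM ?powR_ge0 ?le_powR_ge0 ?(ltW s0) ?(ltW q0)//.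
  apply: inv_cutoff_ge => //; [exact: ltW|exact: divr_gt0|].
  rewrite ler_pdivlMr//.
  have := bracket_wedge f u A; rewrite f1 u1 mul1r mul1r -/p -/q -/b => bw.
  have H1 : e * enorm A * q <= b * enorm A + e ^+ 3 * enorm A ^+ 2.
    by apply: le_trans (le_trans bw _); rewrite ?lerD2l// ler_wpM2r// ltW.
  rewrite -(ler_pM2r A0).
  have H2 : e * enorm A * (2 * e ^+ 2 * enorm A) <= e * enorm A * q.
    by rewrite ler_wpM2l ?mulr_ge0 ?(ltW e0) ?(ltW A0)// ltW.
  by lra.
(* For a bad g only |g u| <= |g| <= condition number times |f g| is available. *)
- apply: (@le_trans _ _ (enorm A `^ s * (condition_number A `^ a * inv_cutoff a r (b / p)))); last first.
    rewrite ler_wpM2l ?powR_ge0//; apply: ler_wpDr => //; rewrite ler_wpM2r//.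
    by apply: ler_wpDl => //; rewrite ler_peMl.
  rewrite ler_pM ?powR_ge0 ?le_powR_ge0 ?(ltW s0) ?(ltW q0)//.
  apply: le_trans (inv_cutoff_scale (ltW a0) r0 _ (condition_number_ge1 g)); last first.
    by rewrite divr_ge0// ltW.
  apply: inv_cutoff_nonincreasing => //; first exact: ltW.
  have k0 : 0 < condition_number A by exact: lt_le_trans (condition_number_ge1 g).
  have qk : q <= p * condition_number A.
    by rewrite mulrC (le_trans qA)// enorm_rowM_ge.
  by rewrite -mulrA -invfM ler_wpM2l// lef_pV2 ?posrE// mulr_gt0.
Qed.

End DriftBound.

Lemma integral_fin_real (R : realType) d (T : measurableType d)
    (m : {measure set T -> \bar R}) (h : T -> R) : (forall x, 0 <= h x) ->
  (\int[m]_x (h x)%:E < +oo)%E -> exists2 J : R, 0 <= J & (\int[m]_x (h x)%:E = J%:E)%E.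
Proof.
move=> h0 hoo.
have I0 : (0 <= \int[m]_x (h x)%:E)%E by apply: integral_ge0 => x _; rewrite lee_fin.
exists (fine (\int[m]_x (h x)%:E)); first exact: fine_ge0.
by rewrite fineK// ge0_fin_numE.
Qed.

Lemma integral_lincomb_bound (R : realType) d (T : measurableType d)
    (m : {measure set T -> \bar R}) (f g : T -> R) (a b F G : R) :
  measurable_fun setT f -> measurable_fun setT g ->
  (forall x, 0 <= f x) -> (forall x, 0 <= g x) -> 0 <= a -> 0 <= b ->
  (\int[m]_x (f x)%:E <= F%:E)%E -> (\int[m]_x (g x)%:E <= G%:E)%E ->
  (\int[m]_x (a * f x + b * g x)%:E <= (a * F + b * G)%:E)%E.
Proof.
move=> mf mg f0 g0 a0 b0 fF gG.
have [F' F'0 fF'] := integral_fin_real f0 (le_lt_trans fF (ltry F)).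
have [G' G'0 gG'] := integral_fin_real g0 (le_lt_trans gG (ltry G)).
move: fF gG; rewrite (integral_lincomb mf mg f0 g0 a0 b0 fF' gG') fF' gG' !lee_fin => fF gG.
by rewrite lerD ?ler_wpM2l.
Qed.

(** Young's inequality for x^a and 1 with exponent b / a. It replaces the condition number to the
    power a by 1 plus a small multiple of a fixed integrable power. *)
Lemma powR_le_affine (R : realType) (a b x : R) : 0 < a -> a < b -> 1 <= x ->
  x `^ a <= 1 + a / b * x `^ b.
Proof.
move=> a0 ab x1; have b0 := lt_trans a0 ab.
have ab1 : a / b < 1 by rewrite ltr_pdivrMr// mul1r.
have p0 : 0 < b / a by rewrite divr_gt0.
have q0 : 0 < (1 - a / b)^-1 by rewrite invr_gt0 subr_gt0.
have pq : (b / a)^-1 + (1 - a / b)^-1^-1 = 1 by rewrite invrK invf_div addrC subrK.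
have := conjugate_powR (powR_ge0 x a) (@ler01 R) p0 q0 pq.
rewrite mulr1 powR1 -powRrM mulrCA divff ?gt_eqF// mulr1 invf_div invrK mul1r.
move=> /le_trans; apply; rewrite addrC [_ * (a / b)]mulrC lerD2r.
by rewrite lerBlDr lerDl divr_ge0 ?ltW.
Qed.

Section Drift.
Context {R : realType} {n : nat}.
Local Notation rV := 'rV[R]_n.+1.
Context (mu : probability (GL R n) R) (s : R) (s0 : 0 < s).
Hypothesis moment : (\int[mu]_g (enorm (GLmx g) `^ s)%:E < +oo)%E.
Context (nu : probability (projspace R n 0) R) (nustar : probability (projspace R 0 n) R).
Context (K : R).
Hypothesis nuE : eigenmeasure (P_ mu s) K nu.
Hypothesis nustarE : eigenmeasure (Pstar_ mu s) K nustar.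
Hypothesis irr : strongly_irreducible (Gamma mu).
Hypothesis prox : exists2 h, Gamma mu h & proximal (GLmx h).
Context (b : R) (b0 : 0 < b).
Hypothesis condition_moment : (\int[mu]_g
  (enorm (GLmx g) `^ s * condition_number (GLmx g) `^ b)%:E < +oo)%E.
Local Notation mu_ := (conv_power mu).
Let K0 : 0 < K. Proof. exact: (K_gt0 s0 moment nuE irr). Qed.
Let F (g : GL R n) := enorm (GLmx g) `^ s * condition_number (GLmx g) `^ b.
Let F0 g : 0 <= F g. Proof. by rewrite mulr_ge0 ?powR_ge0. Qed.
Let mE : measurable_fun setT (fun g : GL R n => enorm (GLmx g) `^ s).
Proof. by apply: measurable_enorm_powR; exact: mxmeasurable_GLmx. Qed.
Let mF : measurable_fun setT F.
Proof.
apply: measurable_funM => //; apply: (measurableT_comp (measurable_powR b)).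
exact: measurable_condition_number.
Qed.

(** The integrand is submultiplicative, so its k-step average is bounded by a product of one-step
    averages. *)
Lemma conv_power_condition k : exists2 M : R, 0 <= M & (\int[mu_ k]_g (F g)%:E <= M%:E)%E.
Proof.
have mFE : measurable_fun setT (EFin \o F) by exact/measurable_EFinP.
have F0E g : (0 <= (EFin \o F) g)%E by rewrite lee_fin.
elim: k => [|k [M M0 IH]].
  by exists (F GL1) => //; rewrite (integral_conv_power0 _ mFE).
have [M1 M10 M1E] := integral_fin_real F0 condition_moment.
exists (M1 * M); first exact: mulr_ge0.
rewrite /= (integral_convolution _ _ mFE F0E).
apply: (@le_trans _ _ (\int[mu]_g (M%:E * (F g)%:E))%E); last first.
  rewrite ge0_integralZl ?lee_fin//; last by move=> g _; exact: F0E.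
  by rewrite [leLHS]muleC EFinM M1E.
apply: ge0_le_integral => //.
- by move=> g _; apply: integral_ge0 => h _; exact: F0E.
- exact: (measurable_convolution_inner _ mFE F0E).
- exact: measurable_funeM.
move=> g _; apply: (@le_trans _ _ (\int[mu_ k]_h (F g * F h)%:E)%E); last first.
  under eq_integral do rewrite EFinM.
  rewrite ge0_integralZl ?lee_fin//; last by move=> h _; exact: F0E.
  by rewrite muleC lee_wpmul2r ?lee_fin.
apply: (@le_integral_fin _ _ _ (mu_ k) (fun h => F (GLM g h)) (fun h => F g * F h)).
- by apply: (measurableT_comp mF); exact: measurable_GLMl.
- exact: (measurable_funM (measurable_cst _) mF).
- move=> h; rewrite F0/= /F mulrACA.
  rewrite ler_pM ?powR_ge0// -powRM ?enorm_ge0 ?condition_number_ge0//.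
    by rewrite le_powR_ge0 ?(ltW s0) ?enorm_ge0// enormM.
  by rewrite le_powR_ge0 ?(ltW b0) ?condition_number_ge0// condition_numberM.
Qed.

Local Notation V a r f x := (inv_cutoff a r (bracket f (uvec x))).

Lemma measurable_inv_cutoff_bracket a r (f : rV) : 0 < a -> 0 < r ->
  measurable_fun setT (fun x : projspace R n 0 => V a r f x).
Proof.
move=> a0 r0.
have mb : measurable_fun setT (fun x : projspace R n 0 => bracket f (uvec x)).
  apply: measurable_continuous_mx (@continuous_enorm _ _ _).
  by apply: mxmeasurable_mul; [exact: mxmeasurable_cst|exact: mxmeasurable_uvec].
by apply: (measurableT_comp _ mb); apply: continuous_measurable_fun; exact: continuous_inv_cutoff.
Qed.

(** The constants are chosen in the order e, k, a, none depending on the truncation r. Four terms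
    carry H, each contributing at most K^k H / 8: vectors that g shrinks, each of the two bad
    events, and the excess of the condition number over 1. The rest is D = c2 C. The exponent a
    comes last because it must be small relative to the moment M of the k-step law, while [c1]
    depends on e and s only. *)
Lemma drift_step : exists a D : R, [/\ 0 < a, 0 <= D & forall r H, 0 < r -> 0 <= H ->
  (forall f, enorm f = 1 -> (\int[nu]_x (V a r f x)%:E <= H%:E)%E) ->
  (forall f, enorm f = 1 -> (\int[nu]_x (V a r f x)%:E <= (H / 2 + D)%:E)%E)].
Proof.
have [C C0 HC] := conv_power_moment s0 moment nuE nustarE irr.
have eta0 : 0 < 1 / 8 :> R by [].
have [e0 e00 He0] := small_coefficients s0 moment nuE irr eta0.
(* The three bounds serve [drift_fun_bound], [small_coefficients] and the estimate [c1C]. *)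
pose e := Num.min (1 / 2) (Num.min e0 ((1 / (8 * C)) `^ s^-1)).
have C8 : 0 < 1 / (8 * C) by rewrite divr_gt0// mulr_gt0.
have epos : 0 < e by rewrite !lt_min e00 powR_gt0// divr_gt0.
have e2 : e <= 1 / 2 by rewrite ge_min lexx.
have ee0 : e <= e0 by rewrite !ge_min lexx !orbT.
pose c1 := (2 * e ^+ 2) `^ s.
have c10 : 0 <= c1 by exact: powR_ge0.
have c1C : c1 * C <= 1 / 8.
  rewrite -ler_pdivlMr// -[leRHS]mulrA -invfM.
  have -> : 1 / (8 * C) = (1 / (8 * C)) `^ s^-1 `^ s.
    by rewrite -powRrM mulVf ?gt_eqF// powRr1// ltW.
  rewrite le_powR_ge0 ?(ltW s0) ?mulr_ge0 ?exprn_ge0 ?(ltW epos)//.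
  apply: (@le_trans _ _ e); last by rewrite !ge_min lexx !orbT.
  by rewrite expr2 mulrA ler_piMl ?(ltW epos)//; lra.
have [k /(_ k (leqnn k)) Hk] := wedge_small s0 moment nuE nustarE irr prox (exprn_gt0 3 epos) eta0.
have [M M0 HM] := conv_power_condition k.
(* The second bound makes 2 (a / b) M at most K^k / 8; the 2 is the maximal value of
   [bad1 + bad2]. *)
pose a := Num.min (b / 2) (b * K ^+ k / (16 * (M + 1))).
have M1 : 0 < 16 * (M + 1) by rewrite mulr_gt0// ltr_wpDl.
have a0 : 0 < a by rewrite lt_min !divr_gt0// mulr_gt0// exprn_gt0.
have ab : a < b by rewrite gt_min ltr_pdivrMr// ltr_pMr// ltr1n.
have Kk : 0 < K ^+ k by exact: exprn_gt0.
have aM : 2 * (a / b) * M <= K ^+ k / 8.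
  have abK : a / b <= K ^+ k / (16 * (M + 1)).
    by rewrite ler_pdivrMr// mulrAC [K ^+ k * b]mulrC ge_min lexx orbT.
  apply: (@le_trans _ _ (2 * (K ^+ k / (16 * (M + 1))) * M)).
    by rewrite ler_wpM2r// ler_wpM2l.
  rewrite (_ : 2 * _ * M = K ^+ k / 8 * (M / (M + 1))); last first.
    by field; rewrite gt_eqF// ltr_wpDl.
  rewrite ler_piMr ?divr_ge0 ?(ltW Kk)// ler_pdivrMr ?ltr_wpDl//; lra.
pose c2 := ((e / 2) `^ a)^-1.
have c20 : 0 <= c2 by rewrite invr_ge0 powR_ge0.
exists a, (c2 * C); split => [//||r H r0 H0 HH f f1]; first by rewrite mulr_ge0// ltW.
rewrite -(@lee_pmul2l _ (K ^+ k)%:E)// -EFinM.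
have hD := homogeneous_drift_fun f s0 a0 r0.
(* On unit vectors the two integrands agree, and the homogeneous one can be unrolled over k steps by
   the eigenmeasure equation. *)
have -> : (\int[nu]_x (V a r f x)%:E = \int[nu]_x (drift_fun s a r f (uvec x))%:E)%E.
  by apply: eq_integral => x _; rewrite /drift_fun enorm_uvec powR1 mul1r divr1.
rewrite -(conv_power_eigenmeasure s0 moment nuE irr k hD).
pose bad1 (g : GL R n) : R := (enorm (f *m GLmx g) < e * enorm (GLmx g))%R%:R.
pose bad2 (g : GL R n) : R := (e ^+ 3 * enorm (GLmx g) ^+ 2 <= wedge (GLmx g))%R%:R.
pose phi (g : GL R n) := (c1 * H + c2) * enorm (GLmx g) `^ s +
  1 * (H * (bad1 g * enorm (GLmx g) `^ s) + 1 * (H * (bad2 g * enorm (GLmx g) `^ s) +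
    (2 * H * (a / b)) * F g)).
have be0 : 0 <= 2 * H * (a / b) by rewrite !mulr_ge0 ?invr_ge0 ?(ltW a0) ?(ltW b0).
have b10 g : 0 <= bad1 g * enorm (GLmx g) `^ s by rewrite mulr_ge0 ?powR_ge0.
have b20 g : 0 <= bad2 g * enorm (GLmx g) `^ s by rewrite mulr_ge0 ?powR_ge0.
have inner (g : GL R n) : (\int[nu]_x (drift_fun s a r f (GLmx g *m uvec x))%:E <= (phi g)%:E)%E.
  pose f' := (enorm (f *m GLmx g))^-1 *: (f *m GLmx g).
  have f'1 : enorm f' = 1.
    have p0 : 0 < enorm (f *m GLmx g).
      rewrite enorm_gt0; apply/eqP => fA; move: f1.
      by rewrite -(mulmxK (GLmx_unit g) f) fA mul0mx enorm0 => /esym/eqP; rewrite oner_eq0.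
    by rewrite enormZ ger0_norm ?invr_ge0 ?(ltW p0)// mulVf// gt_eqF.
  pose l1 := enorm (GLmx g) `^ s * (c1 + (bad1 g + bad2 g) * condition_number (GLmx g) `^ a).
  have l10 : 0 <= l1 by rewrite mulr_ge0 ?powR_ge0// addr_ge0// mulr_ge0 ?addr_ge0 ?powR_ge0.
  have l20 : 0 <= enorm (GLmx g) `^ s * c2 by rewrite mulr_ge0 ?powR_ge0.
  have mV := measurable_inv_cutoff_bracket f' a0 r0.
  have V0 x : 0 <= V a r f' x by rewrite ltW// inv_cutoff_gt0.
  have ub x : 0 <= drift_fun s a r f (GLmx g *m uvec x) <=
      l1 * V a r f' x + (enorm (GLmx g) `^ s * c2) * 1.
    apply/andP; split; first by have [_ _] := hD; exact.
    apply: (le_trans (drift_fun_bound g s0 a0 r0 epos e2 f1 (enorm_uvec x))).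
    by rewrite mulrDr mulr1 mulrA.
  have md : measurable_fun setT (fun x : projspace R n 0 => drift_fun s a r f (GLmx g *m uvec x)).
    have [cD _ _] := hD; apply: (measurable_continuous_mx _ cD).
    by apply: mxmeasurable_mul; [exact: mxmeasurable_cst|exact: mxmeasurable_uvec].
  have mu1 : measurable_fun setT
      (fun x : projspace R n 0 => l1 * V a r f' x + (enorm (GLmx g) `^ s * c2) * 1).
    by apply: measurable_funD; apply: measurable_funM.
  apply: (le_trans (le_integral_fin nu md mu1 ub)).
  have one : (\int[nu]_x 1%:E <= 1%:E)%E by rewrite integral_probability_cst.
  have J := (@integral_lincomb_bound _ _ _ nu (fun x => V a r f' x) (fun=> 1) _ _ H 1 mV
    (measurable_cst _) V0 (fun=> ler01) l10 l20 (HH f' f'1) one).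
  apply: (le_trans J).
  rewrite lee_fin mulr1 /phi /l1 /F.
  set E := enorm _ `^ s; set X := condition_number _ `^ a; set Y := condition_number _ `^ b.
  have E0 : 0 <= E by exact: powR_ge0.
  have Y0 : 0 <= Y by exact: powR_ge0.
  have XY : X <= 1 + a / b * Y by exact: powR_le_affine (condition_number_ge1 g).
  have bb : 0 <= bad1 g + bad2 g <= 2.
    by rewrite addr_ge0//= (_ : 2 = 1 + 1)// lerD// lern1 leq_b1.
  have bX : (bad1 g + bad2 g) * X <= bad1 g + bad2 g + 2 * (a / b * Y).
    case/andP: bb => bb0 bb2.
    apply: (le_trans (ler_wpM2l bb0 XY)); rewrite mulrDr mulr1 lerD2l ler_wpM2r//.
    by rewrite mulr_ge0// divr_ge0 ?ltW.
  have := ler_wpM2l (mulr_ge0 E0 H0) bX; lra.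
have mb1 : measurable_fun setT (fun g => bad1 g * enorm (GLmx g) `^ s).
  by apply: measurable_funM; [exact: measurable_small_coefficient|exact: mE].
have mb2 : measurable_fun setT (fun g => bad2 g * enorm (GLmx g) `^ s).
  by apply: measurable_funM; [exact: measurable_wedge_large|exact: mE].
have J3 := integral_lincomb_bound mb2 mF b20 F0 H0 be0 Hk HM.
have mS3 : measurable_fun setT (fun g : GL R n =>
    H * (bad2 g * enorm (GLmx g) `^ s) + 2 * H * (a / b) * F g).
  exact: (measurable_funD (measurable_funM (measurable_cst _) mb2)
    (measurable_funM (measurable_cst _) mF)).
have S30 g : 0 <= H * (bad2 g * enorm (GLmx g) `^ s) + 2 * H * (a / b) * F g.
  by rewrite addr_ge0 ?(mulr_ge0 H0)// mulr_ge0.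
have J2 := integral_lincomb_bound mb1 mS3 b10 S30 H0 ler01 (He0 e k f epos ee0 f1) J3.
have mS2 : measurable_fun setT (fun g : GL R n => H * (bad1 g * enorm (GLmx g) `^ s) +
    1 * (H * (bad2 g * enorm (GLmx g) `^ s) + 2 * H * (a / b) * F g)).
  exact: (measurable_funD (measurable_funM (measurable_cst _) mb1)
    (measurable_funM (measurable_cst _) mS3)).
have S20 g : 0 <= H * (bad1 g * enorm (GLmx g) `^ s) +
    1 * (H * (bad2 g * enorm (GLmx g) `^ s) + 2 * H * (a / b) * F g).
  by rewrite addr_ge0 ?(mulr_ge0 H0)// mul1r.
have c1H : 0 <= c1 * H + c2 by rewrite addr_ge0 ?mulr_ge0.
have J1 := integral_lincomb_bound mE mS2 (fun g => powR_ge0 _ _) S20 c1H ler01 (HC k) J2.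
have mphi : measurable_fun setT phi.
  exact: (measurable_funD (measurable_funM (measurable_cst _) mE)
    (measurable_funM (measurable_cst _) mS2)).
apply: (@le_trans _ _ (\int[mu_ k]_g (phi g)%:E)%E).
  apply: ge0_le_integral => //.
  - by move=> g _; apply: integral_ge0 => x _; have [_ _ D0] := hD; rewrite lee_fin.
  - apply: (measurable_fun_fubini_tonelli_F (m2 := nu) (fun z : GL R n * projspace R n 0 =>
      (drift_fun s a r f (GLmx z.1 *m uvec z.2))%:E)) => [|z].
      have [cD _ _] := hD; apply/measurable_EFinP/(measurable_continuous_mx _ cD).
      exact: act_measurable linear_action_lact.
    by have [_ _ D0] := hD; rewrite lee_fin.
  - exact/measurable_EFinP.
apply: (le_trans J1); rewrite lee_fin.
have := ler_wpM2l (mulr_ge0 H0 (ltW Kk)) c1C.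
have := ler_wpM2l H0 aM.
set Q := K ^+ k; set P := a / b; lra.
Qed.

(** The truncation provides the finite starting bound r^(-a), and m steps of H -> H / 2 + D bring it
    to r^(-a) / 2^m + 2 D. With m large the first term is at most 1, so the final bound does not
    depend on r. *)
Lemma inv_cutoff_bounded : exists a B : R, [/\ 0 < a, 0 < B &
  forall r f, 0 < r -> enorm f = 1 -> (\int[nu]_x (V a r f x)%:E <= B%:E)%E].
Proof.
have [a [D [a0 D0 step]]] := drift_step.
exists a, (2 * D + 1); split => [//||r f r0 f1]; first by rewrite ltr_wpDl// mulr_ge0.
pose H0 := (r `^ a)^-1; have H00 : 0 <= H0 by rewrite invr_ge0 powR_ge0.
have it m f' : enorm f' = 1 -> (\int[nu]_x (V a r f' x)%:E <= (H0 / 2 ^+ m + 2 * D)%:E)%E.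
  elim: m f' => [|m IH] f' f'1.
    apply: integral_probability_le => [|x]; first exact: measurable_inv_cutoff_bracket.
    rewrite ltW ?inv_cutoff_gt0//= expr0 divr1 ler_wpDr ?mulr_ge0//.
    exact: inv_cutoff_le (ltW a0) r0.
  have Hm : 0 <= H0 / 2 ^+ m + 2 * D by rewrite addr_ge0 ?divr_ge0 ?mulr_ge0 ?exprn_ge0.
  have := step r _ r0 Hm IH f' f'1; rewrite (_ : _ / 2 + D = H0 / 2 ^+ m.+1 + 2 * D)//.
  by rewrite exprS; field; rewrite expf_neq0.
have [m _ /(_ m (leqnn m))] := nbhs_infty_gtr H0.
move=> /= H0m; apply: (le_trans (it m f f1)); rewrite lee_fin addrC lerD2l.
rewrite ler_pdivrMr ?exprn_gt0// mul1r (le_trans (ltW H0m))//.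
by rewrite -natrX ler_nat ltnW// ltn_expl.
Qed.

End Drift.

(** * Moments and conclusion *)

(** The integral of a nonnegative function is a supremum over simple functions below it, hence
    monotone. This compares moments in [opnorm] and [iotamx], defined by a supremum and an infimum,
    with moments in [enorm]. *)
Lemma ge0_le_integral_nonmeas (R : realType) d (T : measurableType d)
    (m : {measure set T -> \bar R}) (f g : T -> \bar R) :
  (forall x, (0 <= f x <= g x)%E) -> (\int[m]_x f x <= \int[m]_x g x)%E.
Proof.
move=> fg; have f0 x : (0 <= f x)%E by have /andP[] := fg x.
have fle x : (f x <= g x)%E by have /andP[] := fg x.
rewrite !ge0_integralTE//; last by move=> x; exact: le_trans (fle x).
apply: ge_ereal_sup => _ [h hf <-]; apply: ereal_sup_ubound; exists h => // x.
exact: le_trans (hf x) (fle x).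
Qed.

Lemma integral_scale_lty (R : realType) d (T : measurableType d)
    (m : {measure set T -> \bar R}) (f : T -> R) (c : R) : 0 < c ->
  measurable_fun setT f -> (forall x, 0 <= f x) ->
  (\int[m]_x (c * f x)%:E < +oo)%E -> (\int[m]_x (f x)%:E < +oo)%E.
Proof.
move=> c0 mf f0; under eq_integral do rewrite EFinM.
rewrite ge0_integralZl ?lee_fin ?(ltW c0)//; last 2 first.
- exact/measurable_EFinP.
- by move=> x _; rewrite lee_fin.
case: (integral _ _ _) => [r||]//; first by move=> _; exact: ltry.
by rewrite gt0_muley ?lte_fin.
Qed.

Section OperatorNorm.
Context {R : realType} {n : nat}.
Local Notation cV := 'cV[R]_n.+1.
Local Notation MV := 'M[R]_n.+1.
Let S (A : MV) := [set enorm (A *m v) / enorm v | v in [set v : cV | v != 0]].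

Let S_lbound (A : MV) : lbound (S A) 0.
Proof. by move=> _ [v _ <-]; rewrite divr_ge0 ?enorm_ge0. Qed.

Let S_ubound (A : MV) : ubound (S A) (enorm A).
Proof.
move=> _ [v /= v0 <-]; rewrite ler_pdivrMr ?enorm_gt0//; exact: enormM.
Qed.

Lemma opnorm_ge (A : MV) (v : cV) : enorm (A *m v) <= opnorm A * enorm v.
Proof.
have [->|v0] := eqVneq v 0; first by rewrite mulmx0 enorm0 mulr0.
rewrite -ler_pdivrMr ?enorm_gt0//; apply: ub_le_sup; last by exists v.
by exists (enorm A); exact: S_ubound.
Qed.

Lemma iotamx_le (A : MV) (v : cV) : iotamx A * enorm v <= enorm (A *m v).
Proof.
have [->|v0] := eqVneq v 0; first by rewrite mulmx0 enorm0 mulr0.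
rewrite -ler_pdivlMr ?enorm_gt0//; apply: ge_inf; last by exists v.
by exists 0; exact: S_lbound.
Qed.

Lemma enorm_le_columns (A : MV) (c : R) : 0 <= c -> (forall j, enorm (col j A) <= c) ->
  enorm A <= n.+1%:R * c.
Proof.
move=> c0 Ac; rewrite -(ler_pXn2r (ltn0Sn 1)) ?nnegrE ?enorm_ge0 ?mulr_ge0// enorm_col_sqr.
apply: (@le_trans _ _ (n.+1%:R * c ^+ 2)).
  rewrite mulr_natl -[X in _ *+ X]card_ord -sumr_const; apply: ler_sum => j _.
  by rewrite lerXn2r ?nnegrE ?enorm_ge0.
by rewrite exprMn ler_wpM2r ?sqr_ge0// expr2 ler_peMl// ler1n.
Qed.

Lemma enorm_delta_col (j : 'I_n.+1) : enorm (delta_mx j ord0 : cV) = 1.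
Proof.
rewrite enormE (bigD1 (j, ord0))//= big1 => [|[a b] /= ab].
  by rewrite mxE !eqxx expr1n addr0 sqrtr1.
rewrite mxE; case: eqP => [ja|]; last by rewrite expr0n.
by move: ab; rewrite ja [b]ord1 eqxx.
Qed.

Lemma enorm_le_opnorm (A : MV) : enorm A <= n.+1%:R * opnorm A.
Proof.
have Aj j : enorm (col j A) <= opnorm A.
  by rewrite colE (le_trans (opnorm_ge _ _))// enorm_delta_col mulr1.
by apply: enorm_le_columns => //; exact: le_trans (enorm_ge0 _) (Aj ord0).
Qed.

Lemma iotamx_gt0 (g : GL R n) : 0 < iotamx (GLmx g).
Proof.
have i0 : 0 < enorm (invmx (GLmx g)).
  rewrite lt_neqAle enorm_ge0 andbT eq_sym.
  apply: contraTneq (condition_number_ge1 g) => i0.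
  by rewrite /condition_number i0 mulr0 ler10.
apply: (@lt_le_trans _ _ (enorm (invmx (GLmx g)))^-1); first by rewrite invr_gt0.
apply: lb_le_inf.
  have d0 : (delta_mx ord0 ord0 : cV) != 0 by rewrite -enorm_gt0 enorm_delta_col.
  by exists (enorm (GLmx g *m (delta_mx ord0 ord0 : cV)) / enorm (delta_mx ord0 ord0 : cV)), (delta_mx ord0 ord0).
move=> _ [v /= v0 <-]; rewrite ler_pdivlMr ?enorm_gt0// ler_pdivrMl//.
by rewrite -{1}(mulKmx (GLmx_unit g) v) enormM.
Qed.

(** The columns of the inverse are the vectors g^-1 e_j, to which [iotamx_le] applies, with image
    e_j of norm 1. *)
Lemma enorm_inv_le_iotamx (g : GL R n) : enorm (invmx (GLmx g)) <= n.+1%:R * (iotamx (GLmx g))^-1.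
Proof.
apply: enorm_le_columns => [|j]; first by rewrite invr_ge0 ltW// iotamx_gt0.
rewrite -[_^-1]mul1r ler_pdivlMr ?iotamx_gt0// mulrC (le_trans (iotamx_le _ _))//.
by rewrite colE mulKVmx ?GLmx_unit// enorm_delta_col.
Qed.

End OperatorNorm.

Lemma powR_interpolation (R : realType) (t x y : R) : 0 <= t -> t <= 1 -> 0 <= x -> 0 <= y ->
  x `^ (1 - t) * y `^ t <= x + y.
Proof.
move=> t0 t1 x0 y0; have t1' : 0 <= 1 - t by rewrite subr_ge0.
have m0 : 0 <= x + y by exact: addr_ge0.
apply: (@le_trans _ _ ((x + y) `^ (1 - t) * (x + y) `^ t)).
  by rewrite ler_pM ?powR_ge0// le_powR_ge0// ?lerDl ?lerDr.
by rewrite -powRD subrK ?oner_eq0// powRr1.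
Qed.

Section Moments.
Context {R : realType} {n : nat}.
Context (mu : probability (GL R n) R).
Context (dO : measure_display) (Omega : measurableType dO) (P : probability Omega R).
Context (g : nat -> {RV P >-> GL R n}).
Hypothesis g_iid : iid mu g.

Lemma I_mu_moment t : I_mu g t -> (\int[mu]_h (enorm (GLmx h) `^ t)%:E < +oo)%E.
Proof.
move=> [t0 Et].
have c0 : 0 < (n.+1%:R^-1 : R) `^ t by rewrite powR_gt0.
have mE : measurable_fun setT (fun h : GL R n => enorm (GLmx h) `^ t).
  by apply: measurable_enorm_powR; exact: mxmeasurable_GLmx.
pose F (h : GL R n) : \bar R := (n.+1%:R^-1 `^ t * enorm (GLmx h) `^ t)%:E.
have mF : measurable_fun setT F.
  by apply/measurable_EFinP; exact: (measurable_funM (measurable_cst _) mE).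
have F0 h : (0 <= F h)%E by rewrite lee_fin mulr_ge0 ?powR_ge0.
have : (\int[mu]_h F h < +oo)%E.
  rewrite (@eq_measure_integral _ _ _ _ (distribution P (g 0%N))); last first.
    by move=> A mA _; have [gd _] := g_iid; exact/esym/gd.
  rewrite ge0_integral_distribution//.
  apply: le_lt_trans Et; rewrite unlock; apply: ge0_le_integral_nonmeas => w.
  rewrite F0/= lee_fin -powRM ?enorm_ge0 ?invr_ge0//.
  rewrite le_powR_ge0 ?mulr_ge0 ?enorm_ge0// ler_pdivrMl//.
  exact: enorm_le_opnorm.
exact: (integral_scale_lty c0 mE (fun h => powR_ge0 _ _)).
Qed.

(** I_mu contains no negative number, so 0 is not an interior point. *)
Lemma interior_I_mu_gt0 t : interior (I_mu g) t -> 0 < t.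
Proof.
move=> It; have [t0 _] := interior_subset It.
rewrite lt_neqAle t0 andbT eq_sym; apply/eqP => t00.
move: It; rewrite t00 /interior/= => /nbhs_ballP[e /= e0 He].
have [] : I_mu g (- (e / 2)).
  apply: He; rewrite /ball/= sub0r opprK ger0_norm ?divr_ge0 ?(ltW e0)//.
  by rewrite ltr_pdivrMr// ltr_pMr// ltr1n.
by rewrite oppr_ge0 leNgt divr_gt0.
Qed.

(** Interpolation between two moments. The point s + t (s - s1), beyond s as seen from s1, is still
    in I_mu for small t > 0, and s is its barycentre with s1 for the weights 1 - th and th. The
    weighted geometric mean of |g|^(s + t (s - s1)) and |g|^(s1 + beta) |g^-1|^beta is |g|^s times
    the condition number to the power th beta. *)
Lemma condition_number_moment (s s1 beta : R) :
  interior (I_mu g) s -> interior (I_mu g) s1 -> 0 < beta ->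
  (\int[mu]_h (opnorm (GLmx h) `^ (s1 + beta) * iotamx (GLmx h) `^ (- beta))%:E < +oo)%E ->
  exists2 b : R, 0 < b &
    (\int[mu]_h (enorm (GLmx h) `^ s * condition_number (GLmx h) `^ b)%:E < +oo)%E.
Proof.
move=> Is Is1 beta0 mom.
have s0 := interior_I_mu_gt0 Is; have s10 := interior_I_mu_gt0 Is1.
have [t t0 It] : exists2 t : R, 0 < t & I_mu g (s + t * (s - s1)).
  move: Is => /nbhs_ballP[e /= e0 He].
  (* The summand 1 avoids a division by zero when s = s1. *)
  pose d := `|s - s1| + 1; have d0 : 0 < d by rewrite ltr_wpDl.
  exists (e / (2 * d)); first by rewrite divr_gt0// mulr_gt0.
  apply: He; rewrite /ball/= opprD addNKr normrN normrM ger0_norm; last first.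
    by rewrite divr_ge0 ?mulr_ge0 ?ltW.
  rewrite mulrAC ltr_pdivrMr ?mulr_gt0// ltr_pM2l//.
  rewrite /d; have := normr_ge0 (s - s1); lra.
pose th := t / (1 + t).
have t1 : 0 < 1 + t by rewrite ltr_wpDl// ltW.
have th0 : 0 < th by rewrite divr_gt0.
have th1 : th <= 1 by rewrite ler_pdivrMr// mul1r lerDr.
exists (th * beta); first exact: mulr_gt0.
have mE : measurable_fun setT (fun h : GL R n => enorm (GLmx h) `^ (s + t * (s - s1))).
  by apply: measurable_enorm_powR; exact: mxmeasurable_GLmx.
pose G (h : GL R n) := enorm (GLmx h) `^ (s1 + beta) * enorm (invmx (GLmx h)) `^ beta.
have mG : measurable_fun setT G.
  apply: measurable_funM.
    by apply: measurable_enorm_powR; exact: mxmeasurable_GLmx.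
  by apply: (measurableT_comp (measurable_powR beta)); exact: measurable_enorm_inv.
have G0 h : 0 <= G h by rewrite mulr_ge0 ?powR_ge0.
have [J1 _ I1] := integral_fin_real (fun h => powR_ge0 _ _) (I_mu_moment It).
pose c := (n.+1%:R^-1 : R) `^ (s1 + beta) * n.+1%:R^-1 `^ beta.
have c0 : 0 < c by rewrite mulr_gt0// powR_gt0.
have GI : (\int[mu]_h (G h)%:E < +oo)%E.
  apply: (integral_scale_lty c0 mG G0).
  apply: le_lt_trans mom; apply: ge0_le_integral_nonmeas => h.
  rewrite !lee_fin mulr_ge0 ?(ltW c0)//= /c /G mulrACA.
  have i0 := iotamx_gt0 h.
  have -> : iotamx (GLmx h) `^ (- beta) = (iotamx (GLmx h))^-1 `^ beta.
    by rewrite -powR_inv1 ?(ltW i0)// -powRrM mulN1r.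
  rewrite -!powRM ?enorm_ge0 ?invr_ge0// ler_pM ?powR_ge0// le_powR_ge0 ?mulr_ge0 ?invr_ge0 ?enorm_ge0//.
  - by rewrite addr_ge0// ltW.
  - by rewrite ler_pdivrMl// enorm_le_opnorm.
  - exact: ltW.
  - by rewrite ler_pdivrMl// enorm_inv_le_iotamx.
have [J2 _ I2] := integral_fin_real G0 GI.
apply: (@le_lt_trans _ _ (1 * J1 + 1 * J2)%:E); last exact: ltry.
rewrite -(integral_lincomb mE mG (fun h => powR_ge0 _ _) G0 ler01 ler01 I1 I2).
apply: le_integral_fin => [||h].
- apply: measurable_funM.
    by apply: measurable_enorm_powR; exact: mxmeasurable_GLmx.
  by apply: (measurableT_comp (measurable_powR _)); exact: measurable_condition_number.
- by apply: measurable_funD; apply: measurable_funM.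
rewrite mulr_ge0 ?powR_ge0//= !mul1r.
apply: le_trans (powR_interpolation (ltW th0) th1 (powR_ge0 _ _) (G0 h)).
rewrite /G /condition_number.
set X := enorm (GLmx h); set Y := enorm (invmx _).
have X0 : 0 < X by exact: enorm_unitmx_gt0.
have Y0 : 0 <= Y by exact: enorm_ge0.
rewrite (powRM _ (ltW X0) Y0) (powRM _ (powR_ge0 _ _) (powR_ge0 _ _)) -!powRrM [leLHS]mulrA [leRHS]mulrA.
rewrite [beta * th]mulrC ler_wpM2r ?powR_ge0//.
rewrite -!powRD ?(gt_eqF X0) ?implybT// le_eqVlt; apply/orP; left; apply/eqP; congr (_ `^ _).
by rewrite /th; field; rewrite gt_eqF.
Qed.

End Moments.

(** At d = 0 the truncations tend to [+oo], in accordance with the inverse taken in [\bar R]; for d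
    > 0 they are eventually constant. *)
Lemma limn_inv_cutoff (R : realType) (a d : R) : 0 < a -> 0 <= d ->
  limn (fun m : nat => (inv_cutoff a m.+1%:R^-1 d)%:E) = (((d `^ a)%:E)^-1)%E.
Proof.
move=> a0 d0; apply/cvg_lim => //.
rewrite inver powR_eq0 (gt_eqF a0) andbT.
have [->|dn0] := eqVneq d 0.
  apply/cvgeyPge => A; near=> m.
  rewrite lee_fin /inv_cutoff (max_idPr _); last by rewrite invr_ge0.
  have [A0|A0] := leP A 0; first by rewrite (le_trans A0)// invr_ge0 powR_ge0.
  rewrite -[leRHS]mul1r ler_pdivlMr ?powR_gt0 ?invr_gt0//.
  have -> : A = (A `^ a^-1) `^ a by rewrite -powRrM mulVf ?gt_eqF// powRr1// ltW.
  rewrite -powRM ?powR_ge0 ?invr_ge0// powR_le1 ?(ltW a0) ?mulr_ge0 ?powR_ge0 ?invr_ge0//.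
  rewrite ler_pdivrMr// mul1r (@le_trans _ _ m%:R) ?ler_nat//.
  by near: m; exact: nbhs_infty_ger.
have dpos : 0 < d by rewrite lt_neqAle eq_sym dn0.
apply: cvg_near_cst; near=> m; congr EFin; congr (_ `^ _)^-1.
apply/max_idPl; rewrite -[leRHS]invrK lef_pV2 ?posrE ?invr_gt0//.
rewrite (@le_trans _ _ m%:R) ?ler_nat//.
by near: m; exact: nbhs_infty_ger.
Unshelve. all: by end_near. Qed.

Section Conclusion.
Context {R : realType} {n : nat}.
Context (m : probability (projspace R n 0) R) (a B : R) (a0 : 0 < a).
Hypothesis HB : forall r y, 0 < r ->
  (\int[m]_x (inv_cutoff a r (delta y x))%:E <= B%:E)%E.

Let mV r (y : projspace R 0 n) : 0 < r ->
  measurable_fun setT (fun x : projspace R n 0 => inv_cutoff a r (delta y x)).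
Proof.
by move=> r0; under eq_fun do rewrite deltaE; exact: measurable_inv_cutoff_bracket.
Qed.

Let V0 r y x : 0 < r -> 0 <= inv_cutoff a r (@delta R n y x).
Proof. by move=> r0; rewrite ltW// inv_cutoff_gt0. Qed.

(** Monotone convergence as the truncation levels 1 / (k + 1) decrease to 0. *)
Lemma sup_inv_delta_le : (sup_inv_delta m a <= B%:E)%E.
Proof.
apply: ge_ereal_sup => _ [y _ <-].
have r0 k : 0 < k.+1%:R^-1 :> R by rewrite invr_gt0.
pose V k (x : projspace R n 0) := (inv_cutoff a k.+1%:R^-1 (delta y x))%:E.
rewrite (_ : (\int[m]_x _)%E = (\int[m]_x limn (V^~ x))%E); last first.
  apply: eq_integral => x _; rewrite limn_inv_cutoff// deltaE; exact: bracket_ge0.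
have cv : (\int[m]_x V k x)%E @[k --> \oo] --> (\int[m]_x limn (V^~ x))%E.
  apply: cvg_monotone_convergence => // [k|k x _|x _ i j ij].
  - by apply/measurable_EFinP; exact: mV.
  - by rewrite lee_fin V0.
  - rewrite lee_fin lef_pV2 ?posrE ?powR_gt0 ?lt_max ?r0 ?orbT//.
    apply: le_powR_ge0; [exact: ltW|by rewrite le_max (ltW (r0 _)) orbT|].
    by rewrite ge_max !le_max lexx/= lef_pV2 ?posrE// ler_nat ltnS ij orbT.
rewrite -(cvg_lim _ cv)//; apply: lime_le; last by apply: nearW => k; exact: HB.
by apply/cvg_ex; eexists; exact: cv.
Qed.

Lemma measurable_delta_ball (y : projspace R 0 n) r : measurable (delta_ball y r).
Proof.
have md : measurable_fun setT (fun x : projspace R n 0 => delta y x).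
  under eq_fun do rewrite deltaE.
  apply: measurable_continuous_mx (@continuous_enorm _ _ _).
  by apply: mxmeasurable_mul; [exact: mxmeasurable_cst|exact: mxmeasurable_uvec].
have := md measurableT `]-oo, r]%classic (measurable_itv _); rewrite setTI.
by congr measurable; apply/seteqP; split => x /=; rewrite in_itv.
Qed.

(** Markov's inequality with the truncation level equal to the radius: on the ball of radius t the
    truncated power is exactly t^(-a). *)
Lemma sup_delta_ball_le r : 0 < B -> 0 <= r -> (sup_delta_ball m r <= (B * r `^ a)%:E)%E.
Proof.
move=> B0; have pos t : 0 < t -> forall y, (m (delta_ball y t) <= (B * t `^ a)%:E)%E.
  move=> t0 y; rewrite -integral_indicT; last exact: measurable_delta_ball.
  have ta : 0 < t `^ a by rewrite powR_gt0.
  apply: (@le_trans _ _ (\int[m]_x (t `^ a * inv_cutoff a t (delta y x))%:E)%E).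
    apply: le_integral_fin => [||x].
    - by apply: measurable_indic; exact: measurable_delta_ball.
    - exact: (measurable_funM (measurable_cst _) (mV y t0)).
    - rewrite indicE ler0n/=; have [xt|_] := boolP (_ \in _); last first.
        by rewrite mulr_ge0 ?(ltW ta)// V0.
      move/set_mem: xt; rewrite /delta_ball/= => xt.
      by rewrite /inv_cutoff (max_idPr xt) divff// gt_eqF.
  under eq_integral do rewrite EFinM.
  rewrite ge0_integralZl ?lee_fin ?(ltW ta)//; last 2 first.
  - by apply/measurable_EFinP; exact: mV.
  - by move=> x _; rewrite lee_fin V0.
  by rewrite mulrC EFinM lee_pmul2l ?HB// lte_fin.
rewrite le_eqVlt => /orP[/eqP <-|r0]; apply: ge_ereal_sup => _ [y _ <-]; last exact: pos.
rewrite powR0 ?gt_eqF// mulr0.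
apply/lee_addgt0Pr => e e0; rewrite add0e.
(* For r = 0 no truncation level is available. The set where delta vanishes lies in every ball, and
   the radius t is chosen so that B t^a = e. *)
have eB : 0 < e / B by rewrite divr_gt0.
pose t := (e / B) `^ a^-1; have t0 : 0 < t by rewrite powR_gt0.
have -> : e = B * t `^ a.
  by rewrite /t -powRrM mulVf ?gt_eqF// powRr1 ?(ltW eB)// mulrC divfK// gt_eqF.
apply: le_trans (pos t t0 y); apply: le_measure; rewrite ?inE; try exact: measurable_delta_ball.
by move=> x /= /le_trans; apply; exact: ltW.
Qed.

End Conclusion.

(** r_s is the potential at unit vectors, so it lies between the positive constant c of
    [potential_ge] and the upper bound C of [homogeneous_le]. Hence pi_s is bounded by a multiple of
    nu on nonnegative continuous functions, which is enough for the truncated integrands. *)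
Lemma normalized_by_bound (R : realType) (n : nat) (mu : probability (GL R n) R) (s K : R)
    (nu : probability (projspace R n 0) R) (nustar : probability (projspace R 0 n) R)
    (pis : probability (projspace R n 0) R) :
  0 < s -> (\int[mu]_g (enorm (GLmx g) `^ s)%:E < +oo)%E ->
  eigenmeasure (Pstar_ mu s) K nustar -> strongly_irreducible (Gamma mu) ->
  normalized_by nu (r_ nustar s) pis ->
  exists2 C : R, 0 < C & forall (phi : projspace R n 0 -> R) (M B : R),
    continuous phi -> measurable_fun setT phi -> (forall x, 0 <= phi x <= M) ->
    (\int[nu]_x (phi x)%:E <= B%:E)%E -> (\int[pis]_x (phi x)%:E <= (C * B)%:E)%E.
Proof.
move=> s0 moment nustarE irr pi_s.
have [c c0 Nc] := potential_ge s0 moment nustarE irr.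
have hN := homogeneous_potential s0 nustar.
have [cN _ N0] := hN.
have [C C0 NC] := homogeneous_le s0 hN.
have rE x : r_ nustar s x = potential nustar s (uvec x).
  by rewrite /r_ unlock; apply: eq_Rintegral => y _; rewrite deltaE.
have r_ge x : c <= r_ nustar s x.
  by rewrite rE; have := Nc (uvec x); rewrite enorm_uvec powR1 mulr1.
have r_le x : r_ nustar s x <= C.
  by rewrite rE; have := NC (uvec x); rewrite enorm_uvec powR1 mulr1.
have mr : measurable_fun setT (r_ nustar s).
  rewrite (_ : r_ nustar s = fun x => potential nustar s (uvec x)); last by apply/funext.
  exact: (measurable_continuous_mx mxmeasurable_uvec cN).
have r0 x : 0 <= r_ nustar s x by exact: le_trans (ltW c0) (r_ge x).
have rI : ((\int[nu]_x r_ nustar s x)%R%:E = \int[nu]_x (r_ nustar s x)%:E)%E.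
  apply: EFin_Rintegral_ge0 => //; apply: le_lt_trans (ltry C).
  by apply: integral_probability_le => // x; rewrite r0 r_le.
have rpos : c <= \int[nu]_x r_ nustar s x.
  rewrite -lee_fin rI -(integral_probability_cst nu c).
  by apply: le_integral_fin => [||x]; [exact: measurable_cst|exact: mr|rewrite (ltW c0) r_ge].
(* C is only known to be nonnegative here, so C + 1 is used to obtain a positive constant. *)
exists ((C + 1) / c) => [|phi M B cphi mphi phiM nuB]; first by rewrite divr_gt0// ltr_wpDl.
have p0 x : 0 <= phi x by have /andP[] := phiM x.
have piI : ((\int[pis]_x phi x)%R%:E = \int[pis]_x (phi x)%:E)%E.
  apply: EFin_Rintegral_ge0 => //; apply: le_lt_trans (ltry M).
  exact: integral_probability_le.
have mpr : measurable_fun setT (fun x => phi x * r_ nustar s x) by exact: measurable_funM.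
have prle : (\int[nu]_x (phi x * r_ nustar s x)%:E <= (C * B)%:E)%E.
  apply: (@le_trans _ _ (\int[nu]_x (C * phi x)%:E)%E).
    apply: le_integral_fin => [||x]; first exact: mpr.
      exact: (measurable_funM (measurable_cst _) mphi).
    by rewrite mulr_ge0//= mulrC ler_wpM2r.
  under eq_integral do rewrite EFinM.
  rewrite ge0_integralZl ?lee_fin//; last 2 first.
  - exact/measurable_EFinP.
  - by move=> x _; rewrite lee_fin.
  by rewrite EFinM lee_wpmul2l ?lee_fin.
have prI : ((\int[nu]_x (phi x * r_ nustar s x))%R%:E = \int[nu]_x (phi x * r_ nustar s x)%:E)%E.
  apply: EFin_Rintegral_ge0 => [x|]; first exact: mulr_ge0.
  exact: le_lt_trans prle (ltry _).
have B0 : 0 <= B.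
  by rewrite -lee_fin (le_trans _ nuB)// integral_ge0// => x _; rewrite lee_fin.
rewrite -piI (pi_s _ cphi) lee_fin ler_pdivrMr; last exact: lt_le_trans rpos.
apply: (@le_trans _ _ (C * B)); first by rewrite -lee_fin prI.
apply: (@le_trans _ _ ((C + 1) / c * B * c)).
  by rewrite mulrAC divfK ?gt_eqF// ler_wpM2r// lerDl.
by rewrite ler_wpM2l// mulr_ge0// divr_ge0 ?(ltW c0)// addr_ge0.
Qed.

Theorem proposition3p4 (R : realType) (n : nat) (d_ge2 : (2 <= n.+1)%N)
    (mu : probability (GL R n) R)
    (dO : measure_display) (Omega : measurableType dO) (P : probability Omega R)
    (g : nat -> {RV P >-> GL R n}) (g_iid : iid mu g)
    (mu_moment : exists2 s : R, 0 < s & I_mu g s)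
    (s1 beta : R) (s1_I : interior (I_mu g) s1) (beta01 : 0 < beta < 1)
    (mu_s1_beta :
      (\int[mu]_h (opnorm (GLmx h) `^ (s1 + beta) *
                   iotamx (GLmx h) `^ (- beta))%:E < +oo)%E)
    (mu_irr : strongly_irreducible (Gamma mu))
    (mu_prox : exists2 h, Gamma mu h & proximal (GLmx h))
    (s : R) (s_I : interior (I_mu g) s)
    (nu : probability (projspace R n 0) R)
    (nu_s : unique_eigenmeasure (P_ mu s) (kappa g s) nu)
    (nustar : probability (projspace R 0 n) R)
    (nustar_s : unique_eigenmeasure (Pstar_ mu s) (kappa g s) nustar)
    (pis : probability (projspace R n 0) R)
    (pi_s : normalized_by nu (r_ nustar s) pis) :
  ((exists2 alpha : R, 0 < alpha & (sup_inv_delta pis alpha < +oo)%E) /\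
   (exists alpha C : R, [/\ 0 < alpha, 0 < C & forall r : R, 0 <= r ->
      (sup_delta_ball pis r <= (C * r `^ alpha)%:E)%E])) /\
  ((exists2 alpha : R, 0 < alpha & (sup_inv_delta nu alpha < +oo)%E) /\
   (exists alpha C : R, [/\ 0 < alpha, 0 < C & forall r : R, 0 <= r ->
      (sup_delta_ball nu r <= (C * r `^ alpha)%:E)%E])).
Proof.
have [nuE _] := nu_s; have [nustarE _] := nustar_s.
have s0 := interior_I_mu_gt0 s_I; have beta0 : 0 < beta by case/andP: beta01.
have moment := I_mu_moment g_iid (interior_subset s_I).
have [b b0 bmom] := condition_number_moment g_iid s_I s1_I beta0 mu_s1_beta.
have [a [B [a0 B0 HB]]] := inv_cutoff_bounded s0 moment nuE nustarE mu_irr mu_prox b0 bmom.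
have nuB r y : 0 < r -> (\int[nu]_x (inv_cutoff a r (delta y x))%:E <= B%:E)%E.
  by move=> r0; under eq_integral do rewrite deltaE; apply: HB => //; exact: enorm_uvec.
have [C C0 piC] := normalized_by_bound s0 moment nustarE mu_irr pi_s.
have piB r y : 0 < r -> (\int[pis]_x (inv_cutoff a r (delta y x))%:E <= (C * B)%:E)%E.
  move=> r0; apply: (piC _ (r `^ a)^-1).
  (* The truncated integrand is the drift function at unit representatives, hence continuous on the
     projective space and admissible in the definition of pi_s. *)
  - rewrite (_ : (fun x => _) = fun x => drift_fun s a r (uvec y) (uvec x)).
      exact: continuous_homogeneous_uvec s0 (homogeneous_drift_fun (uvec y) s0 a0 r0).
    by apply/funext => x; rewrite /drift_fun enorm_uvec powR1 mul1r divr1 deltaE.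
  - by under eq_fun do rewrite deltaE; exact: measurable_inv_cutoff_bracket.
  - by move=> x; rewrite (ltW (inv_cutoff_gt0 _ _ r0)) inv_cutoff_le// ltW.
  - exact: nuB.
have CB : 0 < C * B by exact: mulr_gt0.
split; split.
- by exists a => //; exact: le_lt_trans (sup_inv_delta_le a0 piB) (ltry _).
- by exists a, (C * B); split => // r; exact: sup_delta_ball_le.
- by exists a => //; exact: le_lt_trans (sup_inv_delta_le a0 nuB) (ltry _).
- by exists a, B; split => // r; exact: sup_delta_ball_le.
Qed.
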